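(* Let $\rho:\mathbb R^n\times A\to\mathbb R_+$ be a continuous function. Assume that there exists a local Minimum Restraint Function $U$ for $l$, defined in $\Omega\setminus\overset{\circ}{\mathcal T}$ for some open set $\Omega\supset\mathcal T$, with constant $k>0$, and let $\sigma,\hat g,\hat\rho$ be as in the context. (i) If $$\int_0^\sigma\frac{ds}{\hat g(s)}=+\infty,\qquad\int_0^\sigma\frac{\hat\rho(s)}{\hat g(s)}\,ds<+\infty,$$ then $\mathcal U^\rho(x)\le k^{-1}U(x)$ for all $x\in\Omega\setminus\overset{\circ}{\mathcal T}$, so that $\mathcal U^\rho$ is continuous on $\partial\mathcal T$. Moreover, $\mathcal U^\rho\equiv\mathcal V$. (ii) If $$\int_0^\sigma\frac{ds}{\hat g(s)}<+\infty,$$ then $\mathcal V^f(x)\le k^{-1}U(x)$ for all $x\in\Omega\setminus\overset{\circ}{\mathcal T}$, so that $\mathcal V^f$ is continuous on $\partial\mathcal T$. Moreover, $\mathcal V^f\equiv\mathcal U^\rho\equiv\mathcal V$ for every continuous $\rho:\mathbb R^n\times A\to\mathbb R_+$.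
   Context: Standing setting. $A\subset\mathbb R^m$ is compact; the target $\mathcal T\subset\mathbb R^n$ is closed with compact boundary; $\mathcal T^c=\mathbb R^n\setminus\mathcal T$, $\overset{\circ}{\mathcal T}$ is the interior of $\mathcal T$, $\mathbb R_+=[0,+\infty[$. The functions $f:\mathbb R^n\times A\to\mathbb R^n$ and $l:\mathbb R^n\times A\to\mathbb R_+$ are continuous; there is $M>0$ with $|f(x,a)|\le M(1+|x|)$ for all $(x,a)$, and for every $R>0$ there is $L_R>0$ with $|f(x_1,a)-f(x_2,a)|\le L_R|x_1-x_2|$ and $|l(x_1,a)-l(x_2,a)|\le L_R|x_1-x_2|$ whenever $|x_1|,|x_2|\le R$, $a\in A$. $\mathcal A$ is the set of measurable controls $\alpha:\mathbb R_+\to A$, and $y_x(\cdot,\alpha)$ is the solution on $\mathbb R_+$ of $\dot y(t)=f(y(t),\alpha(t))$, $y(0)=x$. Put $t_x(\alpha)=\inf\{t\ge0: y_x(t,\alpha)\in\mathcal T\}\le+\infty$, $\mathcal J(t,x,\alpha)=\int_0^t l(y_x(s,\alpha),\alpha(s))\,ds$, $\mathcal A(x)=\{\alpha\in\mathcal A:\ \liminf_{t\to t_x(\alpha)^-}\mathrm{dist}(y_x(t,\alpha),\mathcal T)=0\}$, and $\mathcal A_\rho(x)=\{\alpha\in\mathcal A(x):\ \int_0^{t_x(\alpha)}\rho(y_x(t,\alpha),\alpha(t))\,dt<+\infty\}$. For $x\in\mathcal T^c$ (with $\inf\emptyset=+\infty$): $\mathcal V(x)=\inf_{\alpha\in\mathcal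 A(x)}\mathcal J(t_x(\alpha),x,\alpha)$, $\mathcal V^f(x)=\inf_{\{\alpha\in\mathcal A:\,t_x(\alpha)<+\infty\}}\mathcal J(t_x(\alpha),x,\alpha)$, $\mathcal U^\rho(x)=\inf_{\alpha\in\mathcal A_\rho(x)}\mathcal J(t_x(\alpha),x,\alpha)$. All these functions are $0$ on $\mathcal T$. ''Continuous on $\partial\mathcal T$'' means continuous at each point of $\partial\mathcal T$ as a function on $\mathbb R^n\setminus\overset{\circ}{\mathcal T}$. Local Minimum Restraint Function (MRF) for $l$: given an open $\Omega\supset\mathcal T$, a function $U:\Omega\setminus\overset{\circ}{\mathcal T}\to\mathbb R_+$ continuous on $\Omega\setminus\overset{\circ}{\mathcal T}$, locally semiconcave, positive definite ($U>0$ on $\Omega\setminus\mathcal T$, $U=0$ on $\partial\mathcal T$) and proper ($U^{-1}(K)$ compact for every compact $K\subset\mathbb R_+$) on $\Omega\setminus\mathcal T$, such that for some $U_0\in\,]0,+\infty]$ one has $\lim_{x\to x_0,x\in\Omega}U(x)=U_0$ for all $x_0\in\partial\Omega$ and $U(x)<U_0$ for all $x\in\Omega\setminus\overset{\circ}{\mathcal T}$, and such that for some $k>0$, for every $x\in\Omega\setminus\mathcal T$, $\min_{a\in A}\{\langle p,f(x,a)\rangle+k\,l(x,a)\}<0$ for all $p\in D^*U(x)$. Here $D^*U(x)$ is the set of limits $p=\lim_j\nabla U(x_j)$ with $x_j\to x$, $x_j\ne x$ points of differentiability of $U$. Definition of $\hat g,\hat\rho$. Fix $\sigma\in\,]0,U_0[$.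 It is known (Motta–Rampazzo) that there exists a continuous, strictly increasing $m:\,]0,\sigma]\to\,]0,+\infty[$ such that, with $g(x,a)=k\,l(x,a)+m(U(x))$ for $(x,a)\in U^{-1}(]0,\sigma])\times A$, one has $\min_{a\in A}\{\langle p,f(x,a)\rangle+g(x,a)\}\le0$ for all $x\in U^{-1}(]0,\sigma])$, $p\in D^*U(x)$; fix such $m$. Fix a selection $p(x)\in D^*U(x)$ and let $A(x)$ be the (nonempty) set of all $a\in A$ with $\langle p(x),f(x,a)\rangle+g(x,a)\le0$; for a set $S$, $A(S)=\bigcup_{x\in S}A(x)$. For $s\in\,]0,\sigma]$, $\hat g(s)=\inf\{g(x,a):\ x\in U^{-1}([s,\sigma]),\ a\in A(U^{-1}([s,\sigma]))\}$, $\hat\rho(s)=\sup\{\rho(x,a):\ x\in U^{-1}(]0,s]),\ a\in A(U^{-1}(]0,s]))\}$. As a convention, $\hat g$ and $\hat\rho$ are assumed continuous (otherwise they are replaced by continuous approximations from below and from above, respectively, with the same properties $\hat g(s)\ge m(s)>0$, $\hat\rho$ bounded). *)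

(* Defs.v *)
From HB Require Import structures.
From mathcomp Require Import all_boot all_order all_algebra.
From mathcomp Require Import all_classical all_reals all_analysis.
Set Implicit Arguments.
Unset Strict Implicit.
Unset Printing Implicit Defensive.
Import Order.TTheory GRing.Theory Num.Theory.
Import numFieldNormedType.Exports.
Local Open Scope classical_set_scope.
Local Open Scope ring_scope.

(* The library norm on 'rV[R]_d is the sup norm: it supplies the topology and
   the differential, while |.| below is the Euclidean norm. *)
Definition dotv (R : realType) (d : nat) (u v : 'rV[R]_d) : R :=
  \sum_(i < d) u 0 i * v 0 i.

Definition enorm (R : realType) (d : nat) (u : 'rV[R]_d) : R :=
  Num.sqrt (dotv u u).

(* Extended-real valued, so that the distance to the empty set is +oo. *)
Definition distance (R : realType) (d : nat) (S : set 'rV[R]_d) (x : 'rV[R]_d) :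
    \bar R :=
  ereal_inf [set (enorm (x - z))%:E | z in S].

Definition boundary (X : topologicalType) (S : set X) : set X :=
  closure S `\` S°.

(* Lebesgue measure on the complete (Caratheodory) sigma-algebra, so that
   "measurable" means Lebesgue measurable. *)
Definition lebesgue_type (R : realType) :=
  caratheodory_type ((@wlength R idfun)^*)%mu.

Notation leb := completed_lebesgue_measure.

Section ControlSystem.
Context (R : realType) (n q : nat).
Implicit Types (A : set 'rV[R]_q) (T : set 'rV[R]_n) (x p : 'rV[R]_n).
Implicit Types (f : 'rV[R]_n -> 'rV[R]_q -> 'rV[R]_n).
Implicit Types (l rho : 'rV[R]_n -> 'rV[R]_q -> R).
Implicit Types (y : R -> 'rV[R]_n) (alpha : R -> 'rV[R]_q).

Record running_cost A l : Prop := {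
  running_cost_ge0 : forall x a, A a -> 0 <= l x a;
  running_cost_cont : {within setT `*` A, continuous (uncurry l)} }.

Record standing_hypotheses A T f l : Prop := {
  A_compact : compact A;
  T_closed : closed T;
  T_boundary : compact (boundary T);
  f_cont : {within setT `*` A, continuous (uncurry f)};
  l_cost : running_cost A l;
  f_growth : exists2 M : R, 0 < M &
    forall x a, A a -> enorm (f x a) <= M * (1 + enorm x);
  fl_lipschitz : forall r : R, 0 < r -> exists2 L : R, 0 < L &
    forall x1 x2 a, enorm x1 <= r -> enorm x2 <= r -> A a ->
      enorm (f x1 a - f x2 a) <= L * enorm (x1 - x2) /\
      `|l x1 a - l x2 a| <= L * enorm (x1 - x2) }.

(* Functions on R_+ are functions on R of which only the values at t >= 0 are
   used. *)
Definition control A alpha : Prop :=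
  (forall t, 0 <= t -> A (alpha t)) /\
  (forall j, measurable_fun
     ([set t | 0 <= t] : set (lebesgue_type R)) (fun t => alpha t 0 j : R)).

(* Caratheodory solution of y' = f(y, alpha), y(0) = x, in integral form, i.e.
   y is locally absolutely continuous and solves the equation almost
   everywhere. Under the standing hypotheses it exists and is unique. *)
Definition trajectory f x alpha y : Prop :=
  forall (t : R) (i : 'I_n), 0 <= t ->
    leb.-integrable `[0, t] (fun s => (f (y s) (alpha s) 0 i)%:E) /\
    y t 0 i = x 0 i + \int[leb]_(s in `[0, t]) f (y s) (alpha s) 0 i.

Definition exit_time T y : \bar R :=
  ereal_inf [set t%:E | t in [set t : R | 0 <= t /\ T (y t)]].

Definition cost l y alpha (t : \bar R) : \bar R :=
  (\int[leb]_(s in [set s : R | (0 <= s)%R /\ s%:E < t]) (l (y s) (alpha s))%:E)%E.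

Definition left_filter (t : \bar R) : set_system R :=
  match t with
  | r%:E => at_left r
  | +oo%E => pinfty_nbhs R
  | -oo%E => ninfty_nbhs R
  end.

(* The process (alpha, y) stands for the control alpha with its solution
   y = y_x(., alpha). *)
Definition process A f x : set ((R -> 'rV[R]_q) * (R -> 'rV[R]_n)) :=
  [set c | control A c.1 /\ trajectory f x c.1 c.2].

Definition approaching A T f x : set ((R -> 'rV[R]_q) * (R -> 'rV[R]_n)) :=
  [set c | process A f x c /\
    limf_einf (fun t => distance T (c.2 t)) (left_filter (exit_time T c.2)) = 0%E].

Definition finite_exit A T f x : set ((R -> 'rV[R]_q) * (R -> 'rV[R]_n)) :=
  [set c | process A f x c /\ (exit_time T c.2 < +oo)%E].

Definition approaching_rho A T f rho x :
    set ((R -> 'rV[R]_q) * (R -> 'rV[R]_n)) :=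
  [set c | approaching A T f x c /\
    (cost rho c.2 c.1 (exit_time T c.2) < +oo)%E].

Definition value T l
    (adm : 'rV[R]_n -> set ((R -> 'rV[R]_q) * (R -> 'rV[R]_n))) x : \bar R :=
  if `[< T x >] then 0%E
  else ereal_inf [set cost l c.2 c.1 (exit_time T c.2) | c in adm x].

Definition V A T f l := value T l (approaching A T f).
Definition Vf A T f l := value T l (finite_exit A T f).
Definition Urho A T f l rho := value T l (approaching_rho A T f rho).

Definition continuous_on_boundary T (W : 'rV[R]_n -> \bar R) : Prop :=
  forall z, boundary T z -> W x @[x --> within (~` T°) (nbhs z)] --> W z.

Definition locally_semiconcave (S : set 'rV[R]_n) (F : 'rV[R]_n -> R) : Prop :=
  forall K, compact K -> K `<=` S -> exists2 C : R, 0 < C &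
    forall x z, (forall s : R, 0 <= s <= 1 -> K ((1 - s) *: x + s *: z)) ->
      F x + F z - 2 * F (2^-1 *: (x + z)) <= C * enorm (x - z) ^+ 2.

Definition gradient (U : 'rV[R]_n -> R) x : 'rV[R]_n :=
  \row_(i < n) 'd U x (delta_mx 0 i).

(* Limiting gradients. Only the values of U near x matter, so at a point of the
   open set Omega \ T the values of U outside its domain play no role. *)
Definition Dstar (U : 'rV[R]_n -> R) x : set 'rV[R]_n :=
  [set p | exists xs : nat -> 'rV[R]_n,
    [/\ forall j, xs j != x /\ differentiable U (xs j),
        xs @ \oo --> x &
        gradient U (xs j) @[j --> \oo] --> p]].

(* min over a in A of <p, f(x,a)> + h(x,a): for f and h(x, .) continuous and A
   compact nonempty the infimum is a minimum. *)
Definition hamiltonian A f h x p : \bar R :=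
  ereal_inf [set (dotv p (f x a) + h x a)%:E | a in A].

(* U is a total function of which only the values on the domain
   Omega \ int T are meaningful. *)
Record local_MRF A T f l (Omega : set 'rV[R]_n) (U : 'rV[R]_n -> R)
    (U0 : \bar R) (k : R) : Prop := {
  Omega_open : open Omega;
  T_sub_Omega : T `<=` Omega;
  U_ge0 : forall x, (Omega `\` T°) x -> 0 <= U x;
  U_cont : {within Omega `\` T°, continuous U};
  U_semiconcave : locally_semiconcave (Omega `\` T) U;
  U_gt0 : forall x, (Omega `\` T) x -> 0 < U x;
  U_eq0 : forall x, boundary T x -> U x = 0;
  U_proper : forall K : set R, compact K -> K `<=` [set s | 0 <= s] ->
    compact ((Omega `\` T°) `&` U @^-1` K);
  U0_gt0 : (0 < U0)%E;
  U_lim : forall x0, boundary Omega x0 ->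
    (U x)%:E @[x --> within Omega (nbhs x0)] --> U0;
  U_ltU0 : forall x, (Omega `\` T°) x -> ((U x)%:E < U0)%E;
  k_gt0 : 0 < k;
  U_decrease : forall x, (Omega `\` T) x -> forall p, Dstar U x p ->
    (hamiltonian A f (fun z a => (k * l z a)%R) x p < 0)%E }.

(* U^{-1}(I), U having domain Omega \ int T. *)
Definition level T (Omega : set 'rV[R]_n) (U : 'rV[R]_n -> R) (I : set R) :
    set 'rV[R]_n :=
  (Omega `\` T°) `&` U @^-1` I.

Definition gcost l (U : 'rV[R]_n -> R) (k : R) (m : R -> R) x (a : 'rV[R]_q) : R :=
  k * l x a + m (U x).

Record admissible_m A T f l (Omega : set 'rV[R]_n) (U : 'rV[R]_n -> R)
    (k sigma : R) (m : R -> R) : Prop := {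
  m_cont : {within `]0, sigma], continuous m};
  m_incr : {in `]0, sigma] &, {homo m : s t / s < t}};
  m_gt0 : {in `]0, sigma], forall s, 0 < m s};
  m_decrease : forall x, level T Omega U `]0, sigma] x ->
    forall p, Dstar U x p -> (hamiltonian A f (gcost l U k m) x p <= 0)%E }.

(* A(x), for the selection p(x) of D*U(x) given by psel, and A(S). *)
Definition feedback A f (g : 'rV[R]_n -> 'rV[R]_q -> R)
    (psel : 'rV[R]_n -> 'rV[R]_n) x : set 'rV[R]_q :=
  [set a | A a /\ dotv (psel x) (f x a) + g x a <= 0].

Definition feedback_on A f (g : 'rV[R]_n -> 'rV[R]_q -> R)
    (psel : 'rV[R]_n -> 'rV[R]_n) (S : set 'rV[R]_n) : set 'rV[R]_q :=
  \bigcup_(x in S) feedback A f g psel x.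

Definition ghat_exact A T f l (Omega : set 'rV[R]_n) (U : 'rV[R]_n -> R)
    (k sigma : R) (m : R -> R) (psel : 'rV[R]_n -> 'rV[R]_n) (s : R) : \bar R :=
  let g := gcost l U k m in
  let S := level T Omega U `[s, sigma] in
  ereal_inf [set (g z.1 z.2)%:E | z in S `*` feedback_on A f g psel S].

Definition rhohat_exact A T f l rho (Omega : set 'rV[R]_n) (U : 'rV[R]_n -> R)
    (k : R) (m : R -> R) (psel : 'rV[R]_n -> 'rV[R]_n) (s : R) : \bar R :=
  let g := gcost l U k m in
  let S := level T Omega U `]0, s] in
  ereal_sup [set (rho z.1 z.2)%:E | z in S `*` feedback_on A f g psel S].

(* The infimum and supremum above need not be continuous in s, in which case
   they are replaced by continuous approximations, from below and from above
   respectively. If they are continuous, they satisfy these conditions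
   themselves. *)
Record is_ghat A T f l (Omega : set 'rV[R]_n) (U : 'rV[R]_n -> R)
    (k sigma : R) (m : R -> R) (psel : 'rV[R]_n -> 'rV[R]_n)
    (ghat : R -> R) : Prop := {
  ghat_cont : {within `]0, sigma], continuous ghat};
  ghat_ge_m : {in `]0, sigma], forall s, m s <= ghat s};
  ghat_le : {in `]0, sigma], forall s,
    ((ghat s)%:E <= ghat_exact A T f l Omega U k sigma m psel s)%E} }.

Record is_rhohat A T f l rho (Omega : set 'rV[R]_n) (U : 'rV[R]_n -> R)
    (k sigma : R) (m : R -> R) (psel : 'rV[R]_n -> 'rV[R]_n)
    (rhohat : R -> R) : Prop := {
  rhohat_cont : {within `]0, sigma], continuous rhohat};
  rhohat_ge0 : {in `]0, sigma], forall s, 0 <= rhohat s};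
  rhohat_bounded : exists C : R, {in `]0, sigma], forall s, rhohat s <= C};
  rhohat_ge : {in `]0, sigma], forall s,
    (rhohat_exact A T f l rho Omega U k m psel s <= (rhohat s)%:E)%E} }.

End ControlSystem.

(* Main.v *)
(* From a point x outside the target at a level of U below sigma, freeze a control
   a in A(x) for a short time.  Semiconcavity of U and the decrease condition at one
   limiting gradient give, along the resulting arc, k times the cost <= the drop of U,
   and a drop of U of at least half the time times ghat; hence the integral of rho
   along the arc is at most the drop of the potential
     u |-> 2 (u + integral of rhohat/ghat over ]0, u]).
   At higher levels only the decrease of U and the cost bound are needed. Steps with a
   uniform decrease exist near each point, and each step is chosen greedily, to gain
   at least half of what any step from the same point could gain; compactness of the
   level sets of U between two positive values then forces U -> 0. So every point
   starts a process approaching the target with cost <= U/k and finite rho-integral.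
   Switching to it near the target along an arbitrary approaching process makes the
   rho-integral finite at an arbitrarily small extra cost, which identifies the value
   functions. Part (ii) follows from the case rho = 1, in which the rho-integral is
   the time needed to reach the target. *)

Require Import Defs.
From HB Require Import structures.
From mathcomp Require Import all_boot all_order all_algebra.
From mathcomp Require Import all_classical all_reals all_analysis.
From mathcomp Require Import measurable_realfun.
From mathcomp Require Import ring lra.
Set Implicit Arguments.
Unset Strict Implicit.
Unset Printing Implicit Defensive.
Import Order.TTheory GRing.Theory Num.Theory.
Import numFieldNormedType.Exports.
Local Open Scope classical_set_scope.
Local Open Scope ring_scope.

(** * Integrals on intervals *)

(** A selection of A(x) is in general discontinuous in x, so the closed-loop equation may have no
    solution. Controls frozen along short arcs avoid this, at the price of using a control of A(z)
    at points other than z; this is why [rhohat] is taken over all pairs in S x A(S). No lower bound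
    on the step lengths is available near the target, so the sampling times may converge to a finite
    theta as well as tend to infinity. A process lives on all of R_+, hence in the first case it is
    prolonged past theta by a constant control. U enters the arc estimate through one inequality: a
    limiting gradient p at x satisfies U(x + h) <= U(x) + <p, h> + 2C|h|^2, with C uniform near each
    point. Half of the first-order decrease is given up to absorb the quadratic errors, which is the
    factor 2 of the potential. Its summand u pays for the oscillation of [rhohat / ghat] between the
    levels crossed by one step, which is kept below 1. *)

Lemma integrable_setU d (T : measurableType d) (R : realType)
    (mu : {measure set T -> \bar R}) (A B : set T) (f : T -> \bar R) :
  measurable A -> measurable B -> mu.-integrable A f -> mu.-integrable B f ->
  [disjoint A & B] -> mu.-integrable (A `|` B) f.
Proof.
move=> mA mB /integrableP[mfA iA] /integrableP[mfB iB] AB.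
have mf : measurable_fun (A `|` B) f by apply/measurable_funU.
apply/integrableP; split => //; rewrite ge0_integral_setU//.
  by rewrite lte_add_pinfty.
exact: measurableT_comp.
Qed.

Section leb_basics.
Context {R : realType}.
Implicit Types (D : set R) (F G : R -> R) (a b c : R).

Lemma leb_measurable D : measurable (D : set (measurableTypeR R)) ->
  measurable (D : set (lebesgue_type R)).
Proof. exact: sub_caratheodory. Qed.

Lemma leb_itv_measurable (i : interval R) : measurable ([set` i] : set (lebesgue_type R)).
Proof. by apply: leb_measurable; exact: measurable_itv. Qed.

 
Lemma lebE D : leb D = lebesgue_measure D :> \bar R.
Proof. by []. Qed.

Lemma leb_itv_co a b : a <= b -> leb (`[a, b[%classic : set R) = (b - a)%:E.
Proof.
move=> ab; rewrite lebE lebesgue_measure_itv/= lte_fin.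
move: ab; rewrite le_eqVlt => /predU1P[->|->]; last by rewrite EFinB.
by rewrite ltxx subrr.
Qed.

Lemma leb_measurable_fun D F : measurable D -> measurable_fun (D : set (measurableTypeR R)) F ->
  measurable_fun (D : set (lebesgue_type R)) (F : _ -> R).
Proof. by move=> mD mF _ Y mY; apply: leb_measurable; apply: mF. Qed.

Lemma leb_continuous F D : measurable D -> continuous F -> 
  measurable_fun (D : set (lebesgue_type R)) (F : _ -> R).
Proof.
move=> mD cF; apply: leb_measurable_fun => //; apply: measurable_funTS.
exact: continuous_measurable_fun.
Qed.

(** Half-open intervals tile without overlap, which suits controls that change value at the sampling
    times. [integrable_cc] and [int_cc] translate to the closed intervals of [trajectory]. *)
Definition integrable_co F a b := leb.-integrable (`[a, b[%classic : set R) (EFin \o F).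
Definition int_co F a b : R := \int[leb]_(s in `[a, b[) F s.

Lemma integrable_co_bounded F a b (C : R) : a <= b ->
  measurable_fun (`[a, b[%classic : set (lebesgue_type R)) (F : _ -> R) ->
  (forall s, a <= s < b -> `|F s| <= C) -> integrable_co F a b.
Proof.
move=> ab mF bF; apply: measurable_bounded_integrable => //.
- exact: leb_itv_measurable.
- by have := leb_itv_co ab => /= ->; rewrite ltry.
- exists C; split; first exact: num_real.
  by move=> x Cx s /= ; rewrite in_itv/= => /bF /le_trans; apply; apply: ltW.
Qed.

Lemma integrable_coS F a b a' b' : a <= a' -> b' <= b ->
  integrable_co F a b -> integrable_co F a' b'.
Proof.
move=> aa bb; apply: integrableS; try exact: leb_itv_measurable.
by apply: subset_itv; rewrite bnd_simp.
Qed.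

Lemma itv_co_setU a b c : a <= b -> b <= c ->
  `[a, c[%classic = `[a, b[%classic `|` `[b, c[%classic :> set R.
Proof. by move=> ab bc; apply: itv_bndbnd_setU; rewrite bnd_simp. Qed.

Lemma itv_co_disj a b c : [disjoint `[a, b[%classic & `[b, c[%classic].
Proof.
apply/disj_setPS => s [/=]; rewrite !in_itv/= => /andP[_ sb] /andP[+ _].
by rewrite leNgt sb.
Qed.

Lemma integrable_co_cat F a b c : a <= b -> b <= c ->
  integrable_co F a b -> integrable_co F b c -> integrable_co F a c.
Proof.
move=> ab bc ia ib; rewrite /integrable_co (itv_co_setU ab bc).
by apply: integrable_setU => //; [exact: leb_itv_measurable..|exact: itv_co_disj].
Qed.

Lemma int_co_cat F a b c : a <= b -> b <= c -> integrable_co F a c ->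
  int_co F a c = int_co F a b + int_co F b c.
Proof.
move=> ab bc iF; rewrite /int_co.
rewrite (itv_co_setU ab bc).
apply: Rintegral_setU; [exact: leb_itv_measurable..| |exact: itv_co_disj].
by rewrite -(itv_co_setU ab bc).
Qed.

Lemma int_co_nn F a b : b <= a -> int_co F a b = 0.
Proof. by move=> ba; rewrite /int_co set_itv_ge ?Rintegral_set0// bnd_simp -leNgt. Qed.

Lemma integrable_co_nn F a b : b <= a -> integrable_co F a b.
Proof. by move=> ba; rewrite /integrable_co set_itv_ge ?bnd_simp -?leNgt//;
  exact: integrable_set0. Qed.

Lemma int_co_cst a b C : a <= b -> int_co (fun=> C) a b = C * (b - a).
Proof.
move=> ab; rewrite /int_co Rintegral_cst; last exact: leb_itv_measurable.
by have /= -> := leb_itv_co ab.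
Qed.

Lemma integrable_co_cst a b C : a <= b -> integrable_co (fun=> C) a b.
Proof. by move=> ab; apply: (@integrable_co_bounded _ _ _ `|C|) => //. Qed.

Lemma int_co_le F G a b : integrable_co F a b -> integrable_co G a b ->
  (forall s, a <= s < b -> F s <= G s) -> int_co F a b <= int_co G a b.
Proof.
by move=> iF iG FG; apply: le_Rintegral => //; exact: leb_itv_measurable.
Qed.

Lemma int_co_abs F a b : integrable_co F a b -> `|int_co F a b| <= int_co (fun s => `|F s|) a b.
Proof. by move=> iF; apply: le_normr_Rintegral => //; exact: leb_itv_measurable. Qed.

Lemma integrable_co_abs F a b : integrable_co F a b -> integrable_co (fun s => `|F s|) a b.
Proof. by move=> iF; apply: integrable_norm => //; exact: leb_itv_measurable. Qed.

Lemma int_co_bound F a b C : a <= b -> integrable_co F a b ->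
  (forall s, a <= s < b -> `|F s| <= C) ->
  `|int_co F a b| <= C * (b - a).
Proof.
move=> ab iF FC; rewrite (le_trans (int_co_abs iF))// -int_co_cst//.
by apply: int_co_le => //; [exact: integrable_co_abs|exact: integrable_co_cst].
Qed.

Lemma int_co_eq F G a b : (forall s, a <= s < b -> F s = G s) -> int_co F a b = int_co G a b.
Proof.
by move=> FG; apply: eq_Rintegral => s; rewrite inE/= in_itv/=; exact: FG.
Qed.

Lemma integrable_co_eq F G a b : (forall s, a <= s < b -> F s = G s) ->
  integrable_co F a b -> integrable_co G a b.
Proof.
move=> FG; apply: eq_integrable; first exact: leb_itv_measurable.
by move=> s; rewrite inE/= in_itv/= => /FG ->.
Qed.

Lemma int_co_B F G a b : integrable_co F a b -> integrable_co G a b ->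
  int_co (fun s => F s - G s) a b = int_co F a b - int_co G a b.
Proof. by move=> iF iG; apply: RintegralB => //; exact: leb_itv_measurable. Qed.

Lemma integrable_co_B F G a b : integrable_co F a b -> integrable_co G a b ->
  integrable_co (fun s => F s - G s) a b.
Proof.
move=> iF iG; rewrite /integrable_co.
rewrite (_ : _ \o _ = (EFin \o F) \- (EFin \o G))%E//.
by apply: integrableB => //; exact: leb_itv_measurable.
Qed.

Lemma int_co_Z F a b C : integrable_co F a b -> int_co (fun s => C * F s) a b = C * int_co F a b.
Proof. by move=> iF; apply: RintegralZl => //; exact: leb_itv_measurable. Qed.

Lemma integrable_co_Z F a b C : integrable_co F a b -> integrable_co (fun s => C * F s) a b.
Proof.
move=> iF; rewrite /integrable_co.
rewrite (_ : _ \o _ = fun s => C%:E * (EFin \o F) s)%E//.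
by apply: integrableZl => //; exact: leb_itv_measurable.
Qed.

Lemma int_co_ge0 F a b : (forall s, a <= s < b -> 0 <= F s) -> 0 <= int_co F a b.
Proof. by move=> F0; apply: Rintegral_ge0 => s /=; rewrite in_itv/=; exact: F0. Qed.

Lemma integrable_co_cont F a b : a <= b -> continuous F -> integrable_co F a b.
Proof.
move=> ab cF.
have cFw : {within `[a, b], continuous F} by apply: continuous_subspaceT.
have [c _ Fc] := EVT_max ab
  (continuous_subspaceT (fun x => continuous_comp (cF x) (@norm_continuous _ _ (F x)))).
apply: (@integrable_co_bounded _ _ _ `|F c|) => //.
  by apply: leb_continuous => //; exact: measurable_itv.
by move=> s /andP[sa sb]; apply: Fc; rewrite in_itv/= sa ltW.
Qed.

End leb_basics.

(* The integral of a nonnegative function is a supremum over simple functions, so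
   these bounds need no measurability of the integrand; this matters because the cost
   of an arbitrary process is never shown to be measurable. *)
Section lower_integral.
Context d (T : measurableType d) (R : realType) (mu : {measure set T -> \bar R}).
Implicit Types (D A B : set T) (f g : T -> \bar R).
Import HBNNSimple.
Local Open Scope ereal_scope.

Lemma le_integral_restrict A B f g : (forall x, A x -> 0 <= f x) ->
  (forall x, A x -> B x /\ f x <= g x) -> (forall x, B x -> 0 <= g x) ->
  \int[mu]_(x in A) f x <= \int[mu]_(x in B) g x.
Proof.
move=> f0 AB g0; rewrite !ge0_integralE//.
apply: ge_ereal_sup => _ [h/= hf <-]; apply: ereal_sup_ubound; exists h => //= x.
apply: le_trans (hf x) _; rewrite /patch; case: ifPn => [|_].
  by rewrite inE => /AB[Bx fg]; rewrite mem_set.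
by case: ifPn => //; rewrite inE => /g0.
Qed.

Lemma ge0_integral_setU_le A B f : measurable A -> measurable B -> [disjoint A & B] ->
  (forall x, (A `|` B) x -> 0 <= f x) ->
  \int[mu]_(x in A `|` B) f x <= \int[mu]_(x in A) f x + \int[mu]_(x in B) f x.
Proof.
move=> mA mB AB f0; rewrite ge0_integralE//.
apply: ge_ereal_sup => _ [h/= hf <-].
have hfAB x : (A `|` B) x -> (h x)%:E <= f x.
  by move=> ABx; have := hf x; rewrite /patch mem_set.
(* A simple function below the restriction of f vanishes off the union, and for it additivity
   holds. *)
have h0 x : ~ (A `|` B) x -> h x = 0%R.
  move=> nABx; have := hf x; rewrite /patch memNset// lee_fin => hx0.
  by apply/eqP; rewrite eq_le hx0/= fun_ge0.
rewrite -integralT_nnsfun (_ : \int[mu]_x (h x)%:E = \int[mu]_(x in A `|` B) (h x)%:E); last first.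
  rewrite [RHS]integral_mkcond; apply: eq_integral => x _; rewrite /patch.
  by case: ifPn => //; rewrite notin_setE => /h0 ->.
rewrite (@ge0_integral_setU _ _ _ _ _ _ mA mB)//.
- apply: leeD; apply: le_integral_restrict.
  + by move=> x _; rewrite lee_fin fun_ge0.
  + by move=> x Ax; split => //; apply: hfAB; left.
  + by move=> x Ax; apply: f0; left.
  + by move=> x _; rewrite lee_fin fun_ge0.
  + by move=> x Bx; split => //; apply: hfAB; right.
  + by move=> x Bx; apply: f0; right.
- exact/measurable_EFinP/measurable_funTS.
- by move=> x _; rewrite lee_fin fun_ge0.
Qed.

Lemma ge0_integral_cst_le A f (C : R) : measurable A -> (0 <= C)%R ->
  (forall x, A x -> 0 <= f x <= C%:E) -> \int[mu]_(x in A) f x <= C%:E * mu A.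
Proof.
move=> mA C0 fC; rewrite -integral_cst//; apply: le_integral_restrict.
- by move=> x /fC/andP[].
- by move=> x Ax; split => //; have /andP[] := fC x Ax.
- by move=> x _; rewrite lee_fin.
Qed.

End lower_integral.

Section leb_integrals.
Context {R : realType}.
Implicit Types (D : set R) (F G : R -> R) (a b c : R).

(** The identity is measurable from the completed sigma-algebra to the Borel one and pushes [leb]
    forward to Lebesgue measure. This opens the fundamental theorem of calculus to integrals against
    [leb]. *)
Lemma ge0_integral_leb D (f : R -> \bar R) : measurable D -> measurable_fun D f ->
  (forall x, D x -> 0 <= f x)%E ->
  (\int[leb]_(x in D) f x = \int[lebesgue_measure]_(x in D) f x)%E.
Proof.
move=> mD mf f0.
have mid : measurable_fun [set: lebesgue_type R] (idfun : lebesgue_type R -> measurableTypeR R).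
  by move=> _ Y mY; rewrite setTI; exact: leb_measurable.
rewrite -[LHS](ge0_integral_pushforward mid leb mD mf); last first.
  by move=> y; rewrite inE; exact: f0.
by apply: eq_measure_integral => A mA AD.
Qed.

Lemma leb_set1 a : leb ([set a] : set R) = 0%E :> \bar R.
Proof. by rewrite lebE lebesgue_measure_set1. Qed.

Lemma leb_measurable_set1 a : measurable ([set a] : set (lebesgue_type R)).
Proof. exact: leb_measurable. Qed.

Lemma itv_cc_setU1 a b : a <= b -> `[a, b]%classic = `[a, b[%classic `|` [set b] :> set R.
Proof. by move=> ab; rewrite setUitv1. Qed.

Lemma integrable_cc F a b : a <= b ->
  leb.-integrable (`[a, b]%classic : set R) (EFin \o F) <-> integrable_co F a b.
Proof.
move=> ab; split.
  apply: integrableS; try exact: leb_itv_measurable.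
  by apply: subset_itv; rewrite bnd_simp.
move=> iF; rewrite (itv_cc_setU1 ab); apply: integrable_setU => //.
- exact: leb_itv_measurable.
- exact: leb_measurable_set1.
- apply: null_set_integrable; [exact: leb_measurable_set1| |exact: leb_set1].
  exact: measurable_fun_set1.
- by apply/disj_setPS => s [/=]; rewrite in_itv/= => /andP[_ sb] sb'; move: sb; rewrite sb' ltxx.
Qed.

Lemma int_set1 F b : \int[leb]_(s in ([set b] : set R)) F s = 0.
Proof.
have mb := leb_measurable_set1 b.
have mF : measurable_fun ([set b] : set (lebesgue_type R)) (EFin \o F).
  exact: measurable_fun_set1.
by rewrite /Rintegral (null_set_integral mb mF (leb_set1 b)).
Qed.

Lemma int_cc F a b : a <= b -> integrable_co F a b ->
  \int[leb]_(s in `[a, b]) F s = int_co F a b.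
Proof.
move=> ab iF; rewrite (itv_cc_setU1 ab) Rintegral_setU ?int_set1 ?addr0//.
- exact: leb_itv_measurable.
- exact: leb_measurable_set1.
- by rewrite -(itv_cc_setU1 ab); apply/integrable_cc.
- by apply/disj_setPS => s [/=]; rewrite in_itv/= => /andP[_ sb] sb'; move: sb; rewrite sb' ltxx.
Qed.

Lemma integral_coE F a b : integrable_co F a b ->
  (\int[leb]_(s in `[a, b[) (F s)%:E = (int_co F a b)%:E)%E.
Proof.
move=> iF; rewrite /int_co /Rintegral fineK//; apply: integrable_fin_num => //.
exact: leb_itv_measurable.
Qed.

(** A primitive is exp(c(s - a))/c, and its value at a is dropped. With c = 2L this makes the Picard
    map contract by 1/2 in an exponentially weighted norm. *)
Lemma int_co_expR c a b : 0 < c -> a <= b ->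
  int_co (fun s => expR (c * (s - a))) a b <= expR (c * (b - a)) / c.
Proof.
move=> c0; rewrite le_eqVlt => /predU1P[<-|ab].
  by rewrite int_co_nn// divr_ge0 ?expR_ge0// ltW.
pose F s : R := expR (c * (s - a)) / c.
have dF (s : R) : is_derive s 1 F (expR (c * (s - a))).
  rewrite /F; apply: is_derive_eq.
  by rewrite /= /GRing.scale/=; field; rewrite gt_eqF.
have cF : continuous F by move=> s; apply: differentiable_continuous; apply/derivable1_diffP.
have ce : continuous (fun s : R => expR (c * (s - a))).
  move=> s; apply: (@continuous_comp _ _ _ (fun s => c * (s - a)) expR); last exact: continuous_expR.
  by apply: cvgMr; apply: cvgB => //; exact: cvg_cst.
have mexp : measurable_fun [set: R] (fun s : R => (expR (c * (s - a)))%:E).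
  by apply/measurable_EFinP; apply: continuous_measurable_fun.
rewrite /int_co /Rintegral ge0_integral_leb//; last exact: measurable_funTS mexp.
rewrite integral_itv_bndo_bndc; last exact: measurable_funTS.
rewrite (@continuous_FTC2 _ _ F)//.
- by rewrite /F /= lerBlDr lerDl subrr mulr0 divr_ge0 ?expR_ge0// ltW.
- exact: continuous_subspaceT.
- split; first by move=> x _; apply: ex_derive.
  + by apply: cvg_at_right_filter; exact: cF.
  + by apply: cvg_at_left_filter; exact: cF.
- by move=> x _; rewrite derive1E derive_val.
Qed.

End leb_integrals.

(** * Row vectors and distances *)

Section row_vectors.
Context {R : realType} {n : nat}.
Implicit Types (u v p : 'rV[R]_n) (C : R).

Lemma rV_norm_le v C : 0 <= C -> (forall i, `|v 0 i| <= C) -> `|v| <= C.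
Proof.
move=> C0 vC; rewrite [`|v|]mx_normrE; apply/bigmax_leP; split => // -[i j] _ /=.
by rewrite ord1.
Qed.

Lemma rV_coord_le v i : `|v 0 i| <= `|v|.
Proof. by rewrite [`|v|]mx_normrE; apply: (le_bigmax _ (fun ij => `|v ij.1 ij.2|) (0, i)). Qed.

Lemma dotvDr p u v : dotv p (u + v) = dotv p u + dotv p v.
Proof. by rewrite /dotv -big_split/=; apply: eq_bigr => i _; rewrite mxE mulrDr. Qed.

Lemma dotvZr p v C : dotv p (C *: v) = C * dotv p v.
Proof. by rewrite /dotv mulr_sumr; apply: eq_bigr => i _; rewrite mxE mulrCA. Qed.

Lemma dotvBl p u v : dotv (p - u) v = dotv p v - dotv u v.
Proof. by rewrite /dotv -sumrB; apply: eq_bigr => i _; rewrite !mxE mulrBl. Qed.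

Lemma dotvNr p v : dotv p (- v) = - dotv p v.
Proof. by rewrite /dotv -sumrN; apply: eq_bigr => i _; rewrite mxE mulrN. Qed.

Lemma dotv_le p v : `|dotv p v| <= n%:R * (`|p| * `|v|).
Proof.
rewrite /dotv (le_trans (ler_norm_sum _ _ _))//.
rewrite (le_trans (ler_sum _ (G := fun=> `|p| * `|v|) _))//.
  by move=> i _; rewrite normrM ler_pM// rV_coord_le.
by rewrite sumr_const card_ord mulr_natl.
Qed.

Lemma enorm_ge0 v : 0 <= enorm v. Proof. exact: sqrtr_ge0. Qed.

Lemma dotvv_ge0 v : 0 <= dotv v v.
Proof. by apply: sumr_ge0 => i _; rewrite -expr2 sqr_ge0. Qed.

Lemma norm_le_enorm v : `|v| <= enorm v.
Proof.
apply: rV_norm_le; first exact: enorm_ge0.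
move=> i; rewrite -[leLHS]ger0_norm// -sqrtr_sqr ler_wsqrtr//.
rewrite real_normK ?num_real// /dotv (bigD1 i)//= -expr2 lerDl.
by apply: sumr_ge0 => j _; rewrite -expr2 sqr_ge0.
Qed.

Lemma enorm_sqr_le v : enorm v ^+ 2 <= n%:R * `|v| ^+ 2.
Proof.
by rewrite sqr_sqrtr ?dotvv_ge0// expr2 (le_trans (ler_norm _))// dotv_le.
Qed.

Lemma enorm_le v : enorm v <= n%:R * `|v|.
Proof.
rewrite -(@ler_pXn2r _ 2)// ?nnegrE ?enorm_ge0 ?mulr_ge0//.
rewrite (le_trans (enorm_sqr_le v))// exprMn ler_wpM2r ?sqr_ge0//.
by rewrite -natrX ler_nat; case: (n) => // k; rewrite expnS leq_pmulr// expn_gt0.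
Qed.

Lemma lipschitz_continuous (y : R -> 'rV[R]_n) B :
  (forall s t, `|y t - y s| <= B * `|t - s|) -> continuous y.
Proof.
move=> yB s; apply/cvgrPdist_le => e e0.
have B1 : 0 < `|B| + 1 by rewrite ltr_wpDl.
near=> t; rewrite (le_trans (yB _ _))//.
rewrite (@le_trans _ _ ((`|B| + 1) * `|s - t|))//.
  by rewrite ler_wpM2r// (le_trans (ler_norm _))// lerDl.
rewrite mulrC -ler_pdivlMr//; near: t.
by apply: (@cvgr_dist_le _ _ _ _ _ id); [exact: cvg_id|rewrite divr_gt0].
Unshelve. all: by end_near. Qed.

Lemma coord_cont (y : R -> 'rV[R]_n) i : continuous y -> continuous (fun s => y s 0 i).
Proof.
move=> cy s; apply: (@continuous_comp _ _ _ y (fun v : 'rV[R]_n => v 0 i)).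
  exact: cy.
exact: coord_continuous.
Qed.

End row_vectors.

Section metric_continuity.
Context {R : realType}.

Lemma nbhs_dist (V : normedModType R) (x : V) (P : set V) :
  nbhs x P <-> exists2 d : R, 0 < d & forall y, `|x - y| < d -> P y.
Proof.
split => [/nbhs_normP[d d0 dP]|[d d0 dP]].
  by exists d => // y xy; apply: dP.
by apply/nbhs_normP; exists d => // y; exact: dP.
Qed.

Lemma continuous_dist (V W : normedModType R) (g : V -> W) (x : V) :
  {for x, continuous g} <->
  forall e : R, 0 < e -> exists2 d : R, 0 < d & forall y, `|x - y| < d -> `|g x - g y| < e.
Proof.
split => [gx e e0|H P /nbhs_dist[e e0 eP]].
  have /gx/nbhs_dist// : nbhs (g x) [set w | `|g x - w| < e].
  by apply/nbhs_dist; exists e.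
by have [d d0 dP] := H e e0; apply/nbhs_dist; exists d => // y /dP/eP.
Qed.

Lemma within_dist (V : normedModType R) (x : V) (D P : set V) :
  within D (nbhs x) P <-> exists2 d : R, 0 < d & forall y, `|x - y| < d -> D y -> P y.
Proof. exact: nbhs_dist. Qed.

Lemma within_continuous_dist (V W : normedModType R) (D : set V) (g : V -> W) :
  {within D, continuous g} -> forall x, D x -> forall e : R, 0 < e ->
  exists2 d : R, 0 < d & forall y, D y -> `|x - y| < d -> `|g x - g y| < e.
Proof.
move=> cg x Dx e e0; have := cg x; rewrite /prop_for /continuous_at.
move=> /(_ [set w | `|g x - w| < e]) /=.
have ng : nbhs (g x) [set w | `|g x - w| < e] by apply/nbhs_dist; exists e.
move=> /(_ ng); rewrite /nbhs/= -nbhs_subspace_in// => /within_dist[d d0 dP].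
by exists d => // y Dy /dP; apply.
Qed.

(** Compactness in the form used by all the contradiction arguments below: infinitely many terms
    come near p, and no subsequence has to be named. *)
Lemma compact_cvg_cluster (V : normedModType R) (K : set V) (u : nat -> V) :
  compact K -> (forall k, K (u k)) ->
  exists2 p, K p & forall e : R, 0 < e -> forall N, exists2 k, (N <= k)%N & `|p - u k| < e.
Proof.
move=> cK uK; have uo : (u @ \oo) K by exists 0%N => // k _; exact: uK.
have [p [Kp cl]] := cK (u @ \oo) _ uo; exists p => // e e0 N.
have [||v [[k /= Nk <-] pv]] := cl [set u k | k in [set k | (N <= k)%N]] [set w | `|p - w| < e].
- by exists N => // k /= Nk; exists k.
- by apply/nbhs_dist; exists e.
by exists k.
Qed.

End metric_continuity.

Section geometric_sequences.
Context {R : realType}.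

(** This replaces passages to the limit of Picard iterates: a bound D/2^k for every k gives the
    limiting inequality. *)
Lemma half_pow_small (x D : R) : (forall k : nat, x <= D / 2 ^+ k) -> x <= 0.
Proof.
move=> xD; rewrite leNgt; apply/negP => x0.
have D0 : 0 < D by have := xD 0%N; rewrite expr0 divr1; apply: lt_le_trans.
have : \forall k \near \oo, (fun k => D * (2^-1) ^+ k) k < x.
  apply: (@cvgr_lt _ _ _ _ _ (D * 0)); last by rewrite mulr0.
  by apply: cvgMr; apply: cvg_expr; rewrite ger0_norm// invf_lt1// ltr1n.
move=> [N _ /(_ N (leqnn N))] /= xN; have := xD N; rewrite -exprVn leNgt.
by rewrite xN.
Qed.

(** Nested intervals: u k minus and plus the tail sum 2C/2^k are monotone in opposite directions,
    and the supremum of the lower ends lies in all of the intervals. *)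
Lemma geometric_cauchy (u : nat -> R) C : (forall k, `|u k.+1 - u k| <= C / 2 ^+ k) ->
  exists l, forall k, `|u k - l| <= 2 * C / 2 ^+ k.
Proof.
move=> uC.
have E k : 2 * C / 2 ^+ k = 2 * C / 2 ^+ k.+1 + C / 2 ^+ k.
  by rewrite exprS; field; rewrite expf_eq0 pnatr_eq0 andbF.
have C0 k : 0 <= C / 2 ^+ k by exact: le_trans (uC k).
pose v k := u k - 2 * C / 2 ^+ k; pose w k := u k + 2 * C / 2 ^+ k.
have vS k : v k <= v k.+1.
  by have := uC k; rewrite /v ler_norml => /andP[]; have := E k; lra.
have wS k : w k.+1 <= w k.
  by have := uC k; rewrite /w ler_norml => /andP[]; have := E k; lra.
have vm i j : (i <= j)%N -> v i <= v j.
  by move=> ij; apply: (homo_leq (@le_refl _ R) (@le_trans _ R) vS).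
have wm i j : (i <= j)%N -> w j <= w i.
  by move=> ij; apply: (homo_leq (r := fun x y => y <= x)
    (@le_refl _ R) (fun y x z a b => le_trans b a) wS).
have vw k : v k <= w k by rewrite /v /w; have := C0 k; lra.
have vwij i j : v i <= w j.
  case: (leqP i j) => ij; first exact: le_trans (vm _ _ ij) (vw _).
  exact: le_trans (vw _) (wm _ _ (ltnW ij)).
have ub : has_sup (range v).
  by split; [exists (v 0%N); exists 0%N|exists (w 0%N) => _ [i _ <-]].
exists (sup (range v)) => k; rewrite distrC ler_distlC.
have le1 : v k <= sup (range v) by apply: ub_le_sup; [case: ub|exists k].
have le2 : sup (range v) <= w k by apply: ge_sup; [case: ub|move=> _ [i _ <-]].
by move: le1 le2; rewrite /v /w => le1 le2; apply/andP; split; lra.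
Qed.

End geometric_sequences.

(** * Solutions of the controlled equation *)

Section picard.
Context {R : realType} {n : nat}.
Variables (F : 'rV[R]_n -> 'rV[R]_n) (L B tau : R) (z : 'rV[R]_n).
Hypotheses (L_gt0 : 0 < L) (B_ge0 : 0 <= B).
Hypothesis F_lip : forall x y, `|F x - F y| <= L * `|x - y|.
Hypothesis F_bound : forall x, `|F x| <= B.

Let F_cont : continuous F.
Proof.
move=> x; apply/continuous_dist => e e0; exists (e / L); first by rewrite divr_gt0.
by move=> y xy; rewrite (le_lt_trans (F_lip _ _))// mulrC -ltr_pdivlMr.
Qed.

Let Fy_cont (y : R -> 'rV[R]_n) i : continuous y -> continuous (fun s => F (y s) 0 i).
Proof.
move=> cy; apply: (@coord_cont _ _ (F \o y)) => s.
by apply: (@continuous_comp _ _ _ y F); [exact: cy|exact: F_cont].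
Qed.

(** Before tau the integral runs over an empty interval, so every iterate is constantly z there and
    is Lipschitz on the whole line. *)
Fixpoint picard_iter (k : nat) : R -> 'rV[R]_n :=
  if k is k'.+1 then
    fun t => \row_i (z 0 i + int_co (fun s => F (picard_iter k' s) 0 i) tau t)
  else fun=> z.

Let int_lip (G : R -> R) s t : continuous G -> (forall x, `|G x| <= B) ->
  `|int_co G tau t - int_co G tau s| <= B * `|t - s|.
Proof.
move=> cG GB; wlog st : s t / s <= t.
  by move=> H; have [/H//|/ltW/H] := leP s t; rewrite distrC (distrC s).
have iG a b : a <= b -> integrable_co G a b by move=> ab; exact: integrable_co_cont.
have [ts|st'] := leP tau s.
  rewrite (int_co_cat ts st) ?iG ?(le_trans ts)// addrAC subrr add0r.
  by rewrite (ger0_norm (_ : 0 <= t - s)) ?subr_ge0// int_co_bound ?iG.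
rewrite (int_co_nn _ (ltW st')) subr0.
have [tt|tt] := leP tau t.
  rewrite (le_trans (int_co_bound (C := B) tt (iG _ _ tt) _))//.
  rewrite ler_wpM2l// ger0_norm ?subr_ge0//; lra.
by rewrite int_co_nn ?normr0 ?mulr_ge0// ltW.
Qed.

Let picard_iter_lip k s t : `|picard_iter k t - picard_iter k s| <= B * `|t - s|.
Proof.
elim: k s t => [|k IH] s t /=; first by rewrite subrr normr0 mulr_ge0.
apply: rV_norm_le; first by rewrite mulr_ge0.
move=> i; rewrite !mxE opprD addrACA subrr add0r; apply: int_lip.
  by apply: Fy_cont; apply: lipschitz_continuous IH.
by move=> x; rewrite (le_trans (rV_coord_le _ _)).
Qed.

Let picard_iter_cont k : continuous (picard_iter k).
Proof. by apply: lipschitz_continuous => s t; exact: picard_iter_lip. Qed.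

(** In this weight one Picard iteration halves distances on any time interval, so a single limit
    gives a solution for all times after tau. *)
Let W t := expR ((2 * L) * (t - tau)).

Let W_cont : continuous W.
Proof.
move=> s; apply: (@continuous_comp _ _ _ (fun s => 2 * L * (s - tau)) expR); last exact: continuous_expR.
by apply: cvgMr; apply: cvgB => //; exact: cvg_cst.
Qed.

Let F_diff_int (y1 y2 : R -> 'rV[R]_n) (C : R) t i : tau <= t -> continuous y1 -> continuous y2 ->
  0 <= C -> (forall s, tau <= s -> s <= t -> `|y1 s - y2 s| <= C * W s) ->
  `|int_co (fun s => F (y1 s) 0 i) tau t - int_co (fun s => F (y2 s) 0 i) tau t|
    <= C / 2 * W t.
Proof.
move=> tt c1 c2 C0 yC.
have i1 : integrable_co (fun s => F (y1 s) 0 i) tau t by apply: integrable_co_cont => //; exact: Fy_cont.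
have i2 : integrable_co (fun s => F (y2 s) 0 i) tau t by apply: integrable_co_cont => //; exact: Fy_cont.
have iW : integrable_co W tau t by exact: integrable_co_cont.
rewrite -int_co_B// (le_trans (int_co_abs _)) ?(integrable_co_B)//.
rewrite (@le_trans _ _ (int_co (fun s => (L * C) * W s) tau t))//.
  apply: int_co_le.
  - exact/integrable_co_abs/integrable_co_B.
  - exact: integrable_co_Z.
  - move=> s /andP[ts st]; have := rV_coord_le (F (y1 s) - F (y2 s)) i.
    rewrite !mxE => /le_trans; apply; rewrite (le_trans (F_lip _ _))// -mulrA.
    by rewrite ler_wpM2l ?(ltW L_gt0)// yC// ltW.
rewrite int_co_Z// (@le_trans _ _ (L * C * (W t / (2 * L))))//.
  by rewrite ler_wpM2l ?mulr_ge0 ?(ltW L_gt0)//; apply: int_co_expR => //; rewrite mulr_gt0.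
by rewrite le_eqVlt; apply/orP; left; apply/eqP; field; rewrite gt_eqF.
Qed.

(** Chosen so that the first difference, at most B(t - tau) = C0 * 2L(t - tau), is at most C0 * W t
    by 1 + x <= exp x. *)
Let C0 := B / (2 * L).

Let C0_ge0 : 0 <= C0. Proof. by rewrite divr_ge0// mulr_ge0// ltW. Qed.

Let picard_iter_diff k t : tau <= t ->
  `|picard_iter k.+1 t - picard_iter k t| <= C0 / 2 ^+ k * W t.
Proof.
elim: k t => [|k IH] t tt.
  rewrite expr0 divr1 (le_trans (_ : _ <= B * (t - tau)))//.
    apply: rV_norm_le; first by rewrite mulr_ge0 ?subr_ge0.
    move=> i; rewrite !mxE addrAC subrr add0r int_co_bound//.
      by apply: integrable_co_cont => //; apply: cst_continuous.
    by move=> s _ /=; rewrite (le_trans (rV_coord_le _ _)).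
  rewrite (_ : B * (t - tau) = C0 * (2 * L * (t - tau))); last first.
    by rewrite /C0; field; rewrite gt_eqF.
  by rewrite ler_wpM2l// /W (le_trans _ (expR_ge1Dx _))// lerDr.
apply: rV_norm_le; first by rewrite mulr_ge0 ?expR_ge0// divr_ge0 ?exprn_ge0.
move=> i; rewrite [X in `|X|](_ : _ =
  int_co (fun s => F (picard_iter k.+1 s) 0 i) tau t -
  int_co (fun s => F (picard_iter k s) 0 i) tau t); last by rewrite !mxE opprD addrACA subrr add0r.
rewrite (_ : C0 / 2 ^+ k.+1 = C0 / 2 ^+ k / 2); last first.
  by rewrite exprS; field; rewrite expf_eq0 pnatr_eq0 andbF.
apply: F_diff_int => //; first by rewrite divr_ge0 ?exprn_ge0.
by move=> s ts st; exact: IH.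
Qed.

Let picard_iter_before k t : t <= tau -> picard_iter k t = z.
Proof.
move=> tt; case: k => [//|k] /=; by apply/rowP => i; rewrite mxE (int_co_nn _ tt) addr0.
Qed.

Lemma picard_lipschitz : exists y : R -> 'rV[R]_n,
  [/\ y tau = z,
      forall s t, `|y t - y s| <= B * `|t - s| &
      forall t i, tau <= t ->
        y t 0 i = z 0 i + int_co (fun s => F (y s) 0 i) tau t].
Proof.
have lim_ex t : {yt : 'rV[R]_n | forall k,
    `|picard_iter k t - yt| <= 2 * (C0 * W t) / 2 ^+ k}.
  apply: cid.
  have W0 : 0 <= C0 * W t by rewrite mulr_ge0// expR_ge0.
  have [tt|tt] := leP tau t; last first.
    exists z => k; rewrite (picard_iter_before _ (ltW tt)) subrr normr0.
    by rewrite divr_ge0 ?exprn_ge0// mulr_ge0.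
  have lim_i i : {l | forall k, `|picard_iter k t 0 i - l| <= 2 * (C0 * W t) / 2 ^+ k}.
    apply: cid; apply: geometric_cauchy => k.
    have := rV_coord_le (picard_iter k.+1 t - picard_iter k t) i.
    rewrite mxE [X in _ + X]mxE => /le_trans; apply.
    by rewrite (le_trans (picard_iter_diff _ tt))// mulrAC.
  exists (\row_i sval (lim_i i)) => k; apply: rV_norm_le.
    by rewrite divr_ge0 ?exprn_ge0// mulr_ge0.
  by move=> i; rewrite !mxE; exact: (svalP (lim_i i)).
pose y t := sval (lim_ex t).
have yP t k : `|picard_iter k t - y t| <= 2 * (C0 * W t) / 2 ^+ k.
  exact: (svalP (lim_ex t)).
have ylip s t : `|y t - y s| <= B * `|t - s|.
  rewrite -subr_le0; apply: (@half_pow_small _ _ (2 * (C0 * W t) + 2 * (C0 * W s))) => k.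
  rewrite lerBlDr mulrDl (_ : y t - y s = (picard_iter k t - picard_iter k s)
    - (picard_iter k t - y t) + (picard_iter k s - y s)); last first.
    by apply/rowP => i; rewrite !mxE; ring.
  rewrite (le_trans (ler_normD _ _))// (le_trans (lerD (ler_normB _ _) (lexx _)))//.
  by have := yP t k; have := yP s k; have := picard_iter_lip k s t; lra.
have ycont : continuous y by exact: lipschitz_continuous ylip.
exists y; split => //.
  apply/eqP; rewrite -subr_eq0 -normr_le0.
  apply: (@half_pow_small _ _ (2 * (C0 * W tau))) => k.
  by rewrite distrC -(picard_iter_before k (lexx tau)).
move=> t i tt; apply/eqP; rewrite -subr_eq0 -normr_le0.
apply: (@half_pow_small _ _ (2 * (C0 * W t))) => k.
have h1 := le_trans (rV_coord_le _ i) (yP t k.+1).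
have h2 : `|int_co (fun s => F (picard_iter k s) 0 i) tau t - int_co (fun s => F (y s) 0 i) tau t|
  <= (2 * C0 / 2 ^+ k) / 2 * W t.
  apply: F_diff_int tt (@picard_iter_cont k) ycont _ _.
    by rewrite divr_ge0 ?exprn_ge0// mulr_ge0.
  by move=> s ts st; rewrite (le_trans (yP s k))// le_eqVlt; apply/orP; left; apply/eqP; ring.
rewrite !mxE in h1.
(* The residual of the integral equation is split into the error of iterate k + 1 and the effect of
   the error of iterate k under the integral; both decay like 1/2^k. *)
rewrite -[X in `|X|](_ : (z 0 i + int_co (fun s => F (picard_iter k s) 0 i) tau t + - y t 0 i) * -1 +
  (int_co (fun s => F (picard_iter k s) 0 i) tau t - int_co (fun s => F (y s) 0 i) tau t) = _); last by ring.
rewrite (le_trans (ler_normD _ _))// mulrN1 normrN.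
rewrite (le_trans (lerD h1 h2))// exprS invfM le_eqVlt; apply/orP; left; apply/eqP.
by field; rewrite expf_eq0 pnatr_eq0 andbF.
Qed.

End picard.

Section supnorm_hypotheses.
Context {R : realType} {n q : nat}.
Variables (A : set 'rV[R]_q) (T : set 'rV[R]_n).
Variables (f : 'rV[R]_n -> 'rV[R]_q -> 'rV[R]_n) (l : 'rV[R]_n -> 'rV[R]_q -> R).
Hypothesis hyps : standing_hypotheses A T f l.

(** Euclidean and sup norm differ by at most the factor n; n + 1 leaves room for the constant term
    and keeps the bound positive. *)
Lemma growth_supnorm : exists2 M : R, 0 < M &
  forall x a, A a -> `|f x a| <= M * (1 + `|x|).
Proof.
have [M M0 fM] := f_growth hyps.
exists (M * n.+1%:R); first by rewrite mulr_gt0.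
move=> x a Aa; rewrite (le_trans (norm_le_enorm _))// (le_trans (fM _ _ Aa))//.
rewrite -mulrA ler_pM2l// (le_trans (lerD (lexx _) (enorm_le _)))//.
rewrite -natr1; have := normr_ge0 x; have : 0 <= n%:R :> R by []; nra.
Qed.

Lemma lipschitz_supnorm (r : R) : exists2 L : R, 0 < L &
  forall x1 x2 a, `|x1| <= r -> `|x2| <= r -> A a ->
    `|f x1 a - f x2 a| <= L * `|x1 - x2| /\ `|l x1 a - l x2 a| <= L * `|x1 - x2|.
Proof.
(* A sup-norm ball of radius r lies in the Euclidean ball of radius n|r|; the added 1 makes the
   radius positive for every r. *)
have r0 : 0 < n%:R * `|r| + 1 by rewrite ltr_wpDl// mulr_ge0.
have [L L0 H] := fl_lipschitz hyps r0.
exists (L * n.+1%:R); first by rewrite mulr_gt0.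
move=> x1 x2 a x1r x2r Aa.
have er (x : 'rV[R]_n) : `|x| <= r -> enorm x <= n%:R * `|r| + 1.
  move=> xr; have xr' : n%:R * `|x| <= n%:R * `|r|.
    by rewrite ler_wpM2l// (le_trans xr)// ler_norm.
  by have := enorm_le x; lra.
have [h1 h2] := H x1 x2 a (er _ x1r) (er _ x2r) Aa.
have e12 : L * enorm (x1 - x2) <= L * n.+1%:R * `|x1 - x2|.
  by rewrite -mulrA ler_pM2l// (le_trans (enorm_le _))// ler_wpM2r// ler_nat.
by split; [rewrite (le_trans (norm_le_enorm _))//|]; apply: le_trans e12.
Qed.

End supnorm_hypotheses.

Section clamp.
Context {R : realType} {n : nat}.
Implicit Types (x y : 'rV[R]_n) (r : R).

(** A 1-Lipschitz retraction onto the sup-norm ball of radius r. Composed with it, a locally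
    Lipschitz field becomes globally Lipschitz and bounded and is unchanged in the ball. *)
Definition clamp r x : 'rV[R]_n := \row_i Num.max (- r) (Num.min r (x 0 i)).

Lemma clamp_norm r x : 0 <= r -> `|clamp r x| <= r.
Proof.
move=> r0; apply: rV_norm_le => // i; rewrite mxE ler_norml.
by rewrite le_max lexx/= ge_max ge_min lexx/= andbT; lra.
Qed.

Lemma clamp_id r x : `|x| <= r -> clamp r x = x.
Proof.
move=> xr; apply/rowP => i; rewrite mxE.
have := le_trans (rV_coord_le x i) xr; rewrite ler_norml => /andP[h1 h2].
by rewrite (min_idPr h2) (max_idPr h1).
Qed.

Lemma clamp_lip r x y : `|clamp r x - clamp r y| <= `|x - y|.
Proof.
pose c (s : R) := Num.max (- r) (Num.min r s).
have key a b : a <= b -> 0 <= c b - c a <= b - a.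
  move=> ab; rewrite /c !maxEle !minEle; apply/andP.
  by split; (do 4 case: ifPn); rewrite -?ltNge => *; lra.
apply: rV_norm_le => // i; rewrite !mxE.
have := rV_coord_le (x - y) i; rewrite !mxE; apply: le_trans.
move: (x 0 i) (y 0 i) => a b; wlog ab : a b / a <= b.
  by move=> H; have [/H//|/ltW/H] := leP a b; rewrite distrC (distrC b).
have /andP[h1 h2] := key _ _ ab.
by rewrite distrC (distrC a) !ger0_norm ?subr_ge0// -subr_ge0.
Qed.

End clamp.

Section solutions.
Context {R : realType} {n q : nat}.
Variable f : 'rV[R]_n -> 'rV[R]_q -> 'rV[R]_n.
Implicit Types (alpha : R -> 'rV[R]_q) (y phi : R -> 'rV[R]_n) (a b c s t tau : R).

Definition solution alpha y a b : Prop := forall t i, a <= t <= b ->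
  integrable_co (fun s => f (y s) (alpha s) 0 i) a t /\
  y t 0 i = y a 0 i + int_co (fun s => f (y s) (alpha s) 0 i) a t.

Lemma solution_at alpha y a b t i : solution alpha y a b -> a <= t -> t <= b ->
  integrable_co (fun s => f (y s) (alpha s) 0 i) a t /\
  y t 0 i = y a 0 i + int_co (fun s => f (y s) (alpha s) 0 i) a t.
Proof. by move=> sol at_ tb; apply: sol; rewrite at_. Qed.

Lemma solution_cat alpha y a b c : a <= b -> b <= c ->
  solution alpha y a b -> solution alpha y b c -> solution alpha y a c.
Proof.
move=> ab bc s1 s2 t i /andP[at_ tc].
have [tb|/ltW bt] := leP t b; first by apply: s1; rewrite at_.
have [i1 e1] := solution_at i s1 ab (lexx b).
have [i2 e2] := solution_at i s2 bt tc.
have i12 := integrable_co_cat ab bt i1 i2.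
by split=> //; rewrite (int_co_cat ab bt i12) addrA -e1.
Qed.

Lemma eq_solution alpha y alpha' y' a b :
  (forall s, a <= s <= b -> y s = y' s) ->
  (forall s, a <= s < b -> alpha s = alpha' s) ->
  solution alpha y a b -> solution alpha' y' a b.
Proof.
move=> yy aa sol t i /andP[at_ tb].
have ab := le_trans at_ tb.
have [i1 e1] := solution_at i sol at_ tb.
have E s : a <= s < t -> f (y s) (alpha s) 0 i = f (y' s) (alpha' s) 0 i.
  move=> /andP[as_ st]; rewrite yy ?aa// as_/=; first exact: lt_le_trans tb.
  by rewrite (le_trans (ltW st)).
split; first exact: integrable_co_eq E i1.
by rewrite -(int_co_eq E) -!yy ?at_ ?lexx.
Qed.

Lemma sub_solution alpha y a b b' : b' <= b -> solution alpha y a b -> solution alpha y a b'.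
Proof. by move=> bb sol t i /andP[at_ tb]; apply: sol; rewrite at_ (le_trans tb). Qed.

Lemma solution_tail alpha y a b c : a <= b -> solution alpha y a c -> solution alpha y b c.
Proof.
move=> ab sol t i /andP[bt tc]; have at_ := le_trans ab bt.
have [i1 e1] := solution_at i sol at_ tc.
have [i2 e2] := solution_at i sol ab (le_trans bt tc).
split; first exact: integrable_coS i1.
by rewrite e1 e2 (int_co_cat ab bt i1) addrA.
Qed.

Lemma solution_refl alpha y a : solution alpha y a a.
Proof.
move=> t i /andP[at_ ta]; have -> : t = a by apply/eqP; rewrite eq_le at_ ta.
by split; [exact: integrable_co_nn|rewrite int_co_nn// addr0].
Qed.

Lemma solution_lip alpha y a b C : 0 <= C ->
  (forall s, a <= s < b -> `|f (y s) (alpha s)| <= C) -> solution alpha y a b ->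
  forall s t, a <= s -> s <= t -> t <= b -> `|y t - y s| <= C * (t - s).
Proof.
move=> C0 fC sol s t as_ st tb.
have sol' := solution_tail as_ sol.
apply: rV_norm_le; first by rewrite mulr_ge0 ?subr_ge0.
move=> i; have [i1 e1] := solution_at i sol' st tb.
rewrite mxE e1 [X in _ + X]mxE addrAC subrr add0r int_co_bound// => u /andP[su ut].
rewrite (le_trans (rV_coord_le _ _))// fC// (le_trans as_)//=.
exact: lt_le_trans tb.
Qed.

End solutions.

Section existence.
Context {R : realType} {n q : nat}.
Variables (A : set 'rV[R]_q) (f : 'rV[R]_n -> 'rV[R]_q -> 'rV[R]_n) (M : R).
Hypothesis M_gt0 : 0 < M.
Hypothesis f_growth : forall x a, A a -> `|f x a| <= M * (1 + `|x|).
Hypothesis f_lip : forall r : R, exists2 L : R, 0 < L & forall x1 x2 a,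
  `|x1| <= r -> `|x2| <= r -> A a -> `|f x1 a - f x2 a| <= L * `|x1 - x2|.

(* The length of the existence interval depends only on the growth constant:
   on it a solution from z stays in the ball of radius 2|z| + 1. *)
Lemma local_solution a (tau : R) z : A a -> exists phi : R -> 'rV[R]_n,
  [/\ phi tau = z, continuous phi, solution f (fun=> a) phi tau (tau + (4 * M)^-1),
      forall t, tau <= t <= tau + (4 * M)^-1 -> `|phi t| <= 2 * `|z| + 1 &
      forall t, tau <= t -> `|phi t - z| <= M * (2 + 2 * `|z|) * (t - tau)].
Proof.
move=> Aa; pose r := 2 * `|z| + 1.
have r0 : 0 <= r by rewrite addr_ge0// mulr_ge0.
have [L L0 fL] := f_lip r.
pose F x := f (clamp r x) a.
have FL x y : `|F x - F y| <= L * `|x - y|.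
  by rewrite (le_trans (fL _ _ _ _ _ Aa)) ?clamp_norm// ler_pM2l// clamp_lip.
(* The growth bound M(1 + r) on the ball of radius r. During a time 1/(4M) the solution then moves
   by at most (1 + |z|)/2 and stays in that ball. *)
pose B := M * (2 + 2 * `|z|).
have B0 : 0 <= B by rewrite mulr_ge0 ?(ltW M_gt0)// addr_ge0// mulr_ge0.
have FB x : `|F x| <= B.
  rewrite (le_trans (f_growth _ Aa))// ler_pM2l//.
  by have := clamp_norm x r0; rewrite /r; lra.
have [phi [phi0 phiL phiE]] := picard_lipschitz tau z L0 B0 FL FB.
have cphi : continuous phi by exact: lipschitz_continuous phiL.
have phiB t : tau <= t -> `|phi t - z| <= B * (t - tau).
  by move=> tt; rewrite -phi0 (le_trans (phiL _ _))// ger0_norm ?subr_ge0.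
have phir t : tau <= t <= tau + (4 * M)^-1 -> `|phi t| <= r.
  move=> /andP[tt th]; rewrite -[phi t](subrK z) (le_trans (ler_normD _ _))//.
  have : B * (t - tau) <= B * (4 * M)^-1 by rewrite ler_wpM2l//; lra.
  have -> : B * (4 * M)^-1 = (1 + `|z|) / 2 by rewrite /B; field; rewrite gt_eqF.
  have := phiB _ tt; have := normr_ge0 z; rewrite /r; lra.
exists phi; split => // t i /andP[tt th].
have E s : tau <= s < t -> F (phi s) 0 i = f (phi s) a 0 i.
  by move=> /andP[ts st]; rewrite /F clamp_id// phir// ts (le_trans (ltW st)).
split; last by rewrite phi0 -(int_co_eq E); exact: phiE.
apply: integrable_co_eq E _; apply: integrable_co_cont => //.
apply: (@coord_cont _ _ (F \o phi)); apply: (@lipschitz_continuous _ _ _ (L * B)) => s u /=.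
by rewrite (le_trans (FL _ _))// -mulrA ler_pM2l.
Qed.

End existence.

(** * Concatenation of pieces *)

Section pieces.
Context {R : realType}.
Variable t : nat -> R.
Hypothesis t_lt : forall k, t k < t k.+1.
Implicit Types s : R.

(** One less than the first k with s < t k. The value is 0 before [t 0], by truncated predecessor,
    and beyond all sampling times, by default. *)
Definition piece_index s : nat :=
  if pselect (exists k, s < t k) is left h then (ex_minn h).-1 else 0%N.

(** The interval from [t 0] to the supremum of the t k, written so that the supremum may be
    infinite. *)
Definition pieces_dom : set R := [set s | t 0%N <= s /\ exists k, s < t k].

Lemma times_le i j : (i <= j)%N -> t i <= t j.
Proof. by apply: (homo_leq (@le_refl _ R) (@le_trans _ R)) => k; exact: ltW. Qed.

Lemma piece_indexE k s : t k <= s < t k.+1 -> piece_index s = k.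
Proof.
move=> /andP[ks sk]; rewrite /piece_index; case: pselect => [h|]; last by case; exists k.+1.
case: ex_minnP => m sm mmin; have mk := mmin _ sk.
suff : (k < m)%N by move=> km; have -> : m = k.+1 by apply/eqP; rewrite eqn_leq mk.
rewrite ltnNge; apply/negP => /times_le mk'.
by have := lt_le_trans sm (le_trans mk' ks); rewrite ltxx.
Qed.

Lemma piece_ex s : pieces_dom s -> exists k, t k <= s < t k.+1.
Proof.
move=> [t0s h]; case: (ex_minnP h) => -[|m] sm mmin.
  by have := le_lt_trans t0s sm; rewrite ltxx.
exists m; rewrite sm andbT leNgt; apply/negP => /mmin.
by rewrite ltnn.
Qed.

Lemma pieces_domE : pieces_dom = \bigcup_k `[t k, t k.+1[%classic.
Proof.
apply/seteqP; split => s /=.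
  by move=> /piece_ex[k ks]; exists k => //=; rewrite in_itv.
move=> [k _ /=]; rewrite in_itv/= => /andP[ks sk]; split; last by exists k.+1.
exact: le_trans (times_le (leq0n k)) ks.
Qed.

Lemma measurable_pieces (G : R -> R) (g : nat -> R -> R) :
  (forall k s, t k <= s < t k.+1 -> G s = g k s) -> (forall k, continuous (g k)) ->
  measurable_fun (pieces_dom : set (lebesgue_type R)) (G : _ -> R).
Proof.
move=> Gg cg; rewrite pieces_domE; apply/measurable_fun_bigcup.
  by move=> k; exact: leb_itv_measurable.
move=> k; have mk := leb_continuous (measurable_itv `[t k, t k.+1[) (cg k).
by apply: eq_measurable_fun mk => s; rewrite inE/= in_itv/= => /Gg.
Qed.

Section glue.
Context {n q : nat}.
Variables (f : 'rV[R]_n -> 'rV[R]_q -> 'rV[R]_n).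
Variables (a : nat -> 'rV[R]_q) (phi : nat -> R -> 'rV[R]_n).
Hypothesis phi_sol : forall k, solution f (fun=> a k) (phi k) (t k) (t k.+1).
Hypothesis phi_link : forall k, phi k (t k.+1) = phi k.+1 (t k.+1).

Definition glue_control s := a (piece_index s).
Definition glue_path s := phi (piece_index s) s.

Lemma glue_controlE k s : t k <= s < t k.+1 -> glue_control s = a k.
Proof. by move=> ks; rewrite /glue_control (piece_indexE ks). Qed.

(** At the right endpoint the index has already jumped to k + 1; [phi_link] makes both pieces agree
    there, so the closed interval is allowed. *)
Lemma glue_pathE k s : t k <= s <= t k.+1 -> glue_path s = phi k s.
Proof.
move=> /andP[ks]; rewrite le_eqVlt => /predU1P[->|sk].
  rewrite /glue_path (@piece_indexE k.+1) ?phi_link//.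
  by rewrite lexx t_lt.
by rewrite /glue_path (@piece_indexE k) ?ks.
Qed.

Lemma glue_solution k : solution f glue_control glue_path (t 0%N) (t k).
Proof.
elim: k => [|k IH]; first exact: solution_refl.
refine (solution_cat (times_le (leq0n k)) (ltW (t_lt k)) IH _).
refine (eq_solution _ _ (@phi_sol k)) => s ks; first by rewrite (glue_pathE ks).
by rewrite (glue_controlE ks).
Qed.

Lemma glue_control_measurable j :
  measurable_fun (pieces_dom : set (lebesgue_type R)) (fun s => glue_control s 0 j : R).
Proof.
apply: (measurable_pieces (g := fun k _ => a k 0 j)).
  by move=> k s ks; rewrite (glue_controlE ks).
by move=> k; exact: cst_continuous.
Qed.

Lemma glue_measurable (h : 'rV[R]_n -> 'rV[R]_q -> R) :
  (forall k, continuous (fun x => h x (a k))) -> (forall k, continuous (phi k)) ->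
  measurable_fun (pieces_dom : set (lebesgue_type R))
    (fun s => h (glue_path s) (glue_control s) : R).
Proof.
move=> ch cphi; apply: (measurable_pieces (g := fun k s => h (phi k s) (a k))).
  move=> k s ks; rewrite (glue_controlE ks) (@glue_pathE k)//.
  by case/andP: ks => -> /ltW.
move=> k s; apply: (@continuous_comp _ _ _ (phi k) (fun x => h x (a k))); first exact: cphi.
exact: ch.
Qed.

End glue.

End pieces.

(** * Processes with an arbitrary initial time *)

Section processes.
Context {R : realType} {n q : nat}.
Variables (A : set 'rV[R]_q) (f : 'rV[R]_n -> 'rV[R]_q -> 'rV[R]_n).
Implicit Types (c : (R -> 'rV[R]_q) * (R -> 'rV[R]_n)) (tau : R) (z : 'rV[R]_n).

(** The initial time is free so that a run begun at tau can be appended to another process without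
    translating time. *)
Record process_from tau z c : Prop := {
  process_control : forall t, tau <= t -> A (c.1 t);
  process_measurable : forall j, measurable_fun
    ([set t | tau <= t] : set (lebesgue_type R)) (fun t => c.1 t 0 j : R);
  process_start : c.2 tau = z;
  process_solution : forall b, tau <= b -> solution f c.1 c.2 tau b }.

Lemma process_fromE x c : process A f x c <-> process_from 0 x c.
Proof.
split=> [[[cA cm] tr]|[cA cm c0 sol]].
  have c0 : c.2 0 = x.
    apply/rowP => i; have [_ ->] := tr 0 i (lexx _).
    rewrite int_cc ?lexx//; last exact: integrable_co_nn.
    by rewrite int_co_nn// addr0.
  split=> // b b0 t i /andP[t0 tb]; have [i1 e1] := tr t i t0.
  have i2 := (integrable_cc _ t0).1 i1.
  by split=> //; rewrite e1 c0 int_cc.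
split; first by split.
move=> t i t0; have [i1 e1] := solution_at i (sol t t0) t0 (lexx _).
by split; [exact/integrable_cc|rewrite e1 c0 int_cc].
Qed.

Definition switch tau c1 c2 : (R -> 'rV[R]_q) * (R -> 'rV[R]_n) :=
  (fun s => if s < tau then c1.1 s else c2.1 s, fun s => if s < tau then c1.2 s else c2.2 s).

Lemma process_switch sig tau z c1 c2 : sig <= tau ->
  (forall t, sig <= t < tau -> A (c1.1 t)) ->
  (forall j, measurable_fun (`[sig, tau[%classic : set (lebesgue_type R)) (fun t => c1.1 t 0 j : R)) ->
  c1.2 sig = z -> solution f c1.1 c1.2 sig tau ->
  process_from tau (c1.2 tau) c2 -> process_from sig z (switch tau c1 c2).
Proof.
move=> st A1 m1 z1 sol1 [A2 m2 z2 sol2]; split => [t tt|j||b sb] /=.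
- by case: ltP => [tlt|]; [apply: A1; rewrite tt|exact: A2].
- rewrite (_ : [set t | sig <= t] = `[sig, tau[%classic `|` [set t | tau <= t]); last first.
    apply/seteqP; split => t /=; rewrite in_itv/=.
      by move=> ->; case: (ltP t tau) => ?; [left|right].
    by move=> [/andP[]//|]; exact: le_trans.
  apply/measurable_funU; first exact: leb_itv_measurable.
    rewrite (_ : [set t | tau <= t] = `[tau, +oo[%classic); first exact: leb_itv_measurable.
    by apply/seteqP; split => t /=; rewrite in_itv/= andbT.
  split.
    apply: eq_measurable_fun (m1 j) => t; rewrite inE/= in_itv/= => /andP[_ tt].
    by rewrite tt.
  by apply: eq_measurable_fun (m2 j) => t; rewrite inE/= => tt; rewrite ltNge tt.
- case: ltP => // ts; have E : tau = sig by apply/eqP; rewrite eq_le ts st.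
  by rewrite -z1 -E z2.
- have s1 b' : b' <= tau -> solution f (switch tau c1 c2).1 (switch tau c1 c2).2 sig b'.
    move=> bt; refine (eq_solution _ _ (sub_solution bt sol1)) => s /andP[_ sb'] /=.
      case: ltP => // ts; have -> : s = tau by apply/eqP; rewrite eq_le ts (le_trans sb').
      by rewrite z2.
    by rewrite (lt_le_trans sb' bt).
  have [bt|/ltW tb] := leP b tau; first exact: s1.
  refine (solution_cat st tb (s1 _ (lexx _)) _).
  by refine (eq_solution _ _ (sol2 b tb)) => s /andP[ts _] /=; rewrite ltNge ts.
Qed.

End processes.

Section sampled_processes.
Context {R : realType} {n q : nat}.
Variables (A : set 'rV[R]_q) (f : 'rV[R]_n -> 'rV[R]_q -> 'rV[R]_n) (M : R).
Hypothesis M_gt0 : 0 < M.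
Hypothesis f_growth : forall x a, A a -> `|f x a| <= M * (1 + `|x|).
Hypothesis f_lip : forall r : R, exists2 L : R, 0 < L & forall x1 x2 a,
  `|x1| <= r -> `|x2| <= r -> A a -> `|f x1 a - f x2 a| <= L * `|x1 - x2|.

Lemma lip_continuous a : A a -> continuous (fun x => f x a).
Proof.
move=> Aa x; apply/continuous_dist => e e0.
have [L L0 fL] := f_lip (`|x| + 1).
exists (Num.min 1 (e / L)); first by rewrite lt_min ltr01 divr_gt0.
move=> y; rewrite lt_min => /andP[xy1 xye].
rewrite (le_lt_trans (fL _ _ _ _ _ Aa))//.
- by rewrite lerDl.
- by rewrite -[y](subKr x) (le_trans (ler_normB _ _))// lerD2l ltW.
- by rewrite mulrC -ltr_pdivlMr.
Qed.

Lemma lip_coord_continuous a i : A a -> continuous (fun x => f x a 0 i).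
Proof.
move=> Aa x; apply: (@continuous_comp _ _ _ (fun x => f x a) (fun v : 'rV[R]_n => v 0 i)).
  exact: lip_continuous.
exact: coord_continuous.
Qed.

Lemma unbounded_pieces (t : nat -> R) : ~ has_ubound (range t) ->
  pieces_dom t = [set s | t 0%N <= s].
Proof.
move=> ub; apply/seteqP; split => s /=; first by case.
move=> ts; split => //; apply: contrapT => h; apply: ub; exists s => _ [k _ <-].
by rewrite leNgt; apply/negP => st; apply: h; exists k.
Qed.

(** Local existence holds on an interval of length 1/(4M) whatever the initial point, so equally
    spaced pieces cover all later times. *)
Lemma constant_process a tau z : A a -> exists c, process_from A f tau z c.
Proof.
move=> Aa; pose h := (4 * M)^-1.
have h0 : 0 < h by rewrite invr_gt0 mulr_gt0.
pose sol s x := sval (cid (local_solution M_gt0 f_growth f_lip s x Aa)).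
have solP s x : [/\ sol s x s = x, continuous (sol s x) & solution f (fun=> a) (sol s x) s (s + h)].
  by rewrite /sol; case: cid => phi [].
pose t k := tau + k%:R * h.
have tS k : t k.+1 = t k + h by rewrite /t -natr1 mulrDl mul1r addrA.
have t_lt k : t k < t k.+1 by rewrite tS ltrDl.
pose zz := fix zz k := if k is k'.+1 then sol (t k') (zz k') (t k'.+1) else z.
pose phi k := sol (t k) (zz k).
have phi_sol k : solution f (fun=> a) (phi k) (t k) (t k.+1).
  by rewrite tS; have [] := solP (t k) (zz k).
have phi_link k : phi k (t k.+1) = phi k.+1 (t k.+1).
  by rewrite {2}/phi; have [-> _ _] := solP (t k.+1) (zz k.+1).
have ub : ~ has_ubound (range t).
  move=> [m mt]; have [N mN] : exists N, m < t N.
    exists (Num.truncn ((m - tau) / h)).+1.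
    by rewrite /t -ltrBlDl -ltr_pdivrMr// truncnS_gt.
  by have := mt (t N) (imageT _ _); rewrite leNgt mN.
have t0 : t 0%N = tau by rewrite /t mul0r addr0.
exists (glue_control t (fun=> a), glue_path t phi); split => /=.
- by [].
- move=> j; have := glue_control_measurable t_lt (fun=> a) j.
  by rewrite unbounded_pieces// t0.
- rewrite (glue_pathE t_lt phi_link (k := 0)) ?t0 ?lexx ?ltW//=.
    by rewrite /phi t0; have [] := solP tau z.
  by rewrite -[X in X < _]t0 t_lt.
- move=> b tb; have : pieces_dom t b by rewrite unbounded_pieces//= t0.
  move=> [_ [k /ltW bk]]; apply: (sub_solution bk).
  rewrite -[X in solution _ _ _ X _]t0; exact: (@glue_solution _ _ t_lt _ _ _ (fun=> a)).
Qed.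

Section limit.
Variables (t : nat -> R) (a : nat -> 'rV[R]_q) (phi : nat -> R -> 'rV[R]_n) (C : R).
Hypothesis t_lt : forall k, t k < t k.+1.
Hypothesis Aa : forall k, A (a k).
Hypothesis phi_cont : forall k, continuous (phi k).
Hypothesis phi_sol : forall k, solution f (fun=> a k) (phi k) (t k) (t k.+1).
Hypothesis phi_link : forall k, phi k (t k.+1) = phi k.+1 (t k.+1).
Hypothesis phi_bound : forall k s, t k <= s <= t k.+1 -> `|f (phi k s) (a k)| <= C.

(** If the sampling times have a finite supremum theta, the speed bound C makes the velocity
    integrable up to theta. The path then has a limit there and is continued by a constant control,
    just to be a process on a half-line. *)
Lemma sampled_process : exists c, [/\ process_from A f (t 0%N) (phi 0%N (t 0%N)) c,
  forall k s, t k <= s <= t k.+1 -> c.2 s = phi k s &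
  forall k s, t k <= s < t k.+1 -> c.1 s = a k].
Proof.
pose c0 := (glue_control t a, glue_path t phi).
have c0sol k : solution f c0.1 c0.2 (t 0%N) (t k).
  exact: (@glue_solution _ _ t_lt _ _ _ _ _ phi_sol phi_link).
have c0start : c0.2 (t 0%N) = phi 0%N (t 0%N).
  by rewrite /= (glue_pathE t_lt phi_link (k := 0)) ?lexx ?ltW//=.
have [ub|ub] := pselect (has_ubound (range t)); last first.
  exists c0; split; last 2 first.
  - by move=> k s ks; rewrite /= (glue_pathE t_lt phi_link ks).
  - by move=> k s ks; rewrite /= (glue_controlE t_lt _ ks).
  split; [by move=> s _; exact: Aa| |exact: c0start|].
  - by move=> j; rewrite -(unbounded_pieces ub); exact: glue_control_measurable.
  - move=> b tb; have : pieces_dom t b by rewrite unbounded_pieces.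
    by move=> [_ [k /ltW bk]]; apply: (sub_solution bk); exact: c0sol.
have hs : has_sup (range t) by split=> //; exists (t 0%N); exists 0%N.
pose theta := sup (range t).
have tth k : t k < theta.
  by apply: lt_le_trans (t_lt k) _; apply: ub_le_sup => //; exists k.+1.
have domE : pieces_dom t = `[t 0%N, theta[%classic.
  apply/seteqP; split => s /=; rewrite in_itv/=.
    by move=> [-> [k /lt_trans]]; apply.
  move=> /andP[ts sth]; split => //.
  by have [_ [k _ <-] h] := sup_gt hs.1 sth; exists k.
have dom s : t 0%N <= s < theta -> exists k, t k <= s < t k.+1.
  by move=> h; apply: piece_ex; rewrite domE /= in_itv.
pose G i s := f (c0.2 s) (c0.1 s) 0 i.
have iG i : integrable_co (G i) (t 0%N) theta.
  apply: (@integrable_co_bounded _ _ _ _ C); first exact/ltW.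
    rewrite -domE; apply: (glue_measurable t_lt phi_link (h := fun x a => f x a 0 i)) => // k.
    exact: lip_coord_continuous.
  move=> s sth; have [k ks] := dom s sth; rewrite (le_trans (rV_coord_le _ _))//.
  have ks' : t k <= s <= t k.+1 by case/andP: ks => -> /ltW.
  by rewrite /= (glue_pathE t_lt phi_link ks') (glue_controlE t_lt _ ks) phi_bound.
(* The value that the integral equation imposes at theta. *)
pose z1 := \row_i (phi 0%N (t 0%N) 0 i + int_co (G i) (t 0%N) theta).
pose c1 := (c0.1, fun s => if s < theta then c0.2 s else z1).
have [c2 c2P] := constant_process theta z1 (Aa 0%N).
have c1theta : c1.2 theta = z1 by rewrite /c1/= ltxx.
have c1sol : solution f c1.1 c1.2 (t 0%N) theta.
  have sol' b : b < theta -> solution f c1.1 c1.2 (t 0%N) b.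
    move=> bth; have [tb|bt] := leP (t 0%N) b; last first.
      by move=> s i /andP[h1 h2]; have := le_lt_trans (le_trans h1 h2) bt; rewrite ltxx.
    have [|k /andP[_ /ltW bk]] := dom b; first by rewrite tb.
    refine (eq_solution _ _ (sub_solution bk (c0sol k.+1))) => s //= /andP[_ sb].
    by rewrite (le_lt_trans sb bth).
  move=> s i /andP[ts]; rewrite le_eqVlt => /predU1P[->|sth]; last first.
    by apply: (sol' s sth); rewrite ts lexx.
  have E s' : t 0%N <= s' < theta -> G i s' = f (c1.2 s') (c1.1 s') 0 i.
    by move=> /andP[_ h]; rewrite /G /c1/= h.
  split; first exact: integrable_co_eq E _.
  by rewrite -(int_co_eq E) c1theta mxE /= tth -c0start.
exists (switch theta c1 c2); split.
- apply: process_switch c1sol _; first exact/ltW.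
  + by move=> s _; exact: Aa.
  + by move=> j; rewrite -domE; exact: glue_control_measurable.
  + by rewrite /= tth.
  + by rewrite c1theta.
- move=> k s ks; have sth : s < theta by case/andP: ks => _ /le_lt_trans; apply.
  by rewrite /= sth (glue_pathE t_lt phi_link ks).
- move=> k s ks; have sth : s < theta by case/andP: ks => _ /lt_trans; apply.
  by rewrite /= sth (glue_controlE t_lt _ ks).
Qed.

End limit.

End sampled_processes.

(** * Semiconcave functions and limiting gradients *)

Section gradients.
Context {R : realType} {n : nat}.
Implicit Types (U : 'rV[R]_n -> R) (x v g p : 'rV[R]_n).

Lemma dotv_is_linear g : linear (dotv g : 'rV[R]_n -> R).
Proof. by move=> c u v; rewrite dotvDr dotvZr. Qed.

HB.instance Definition _ g :=
  GRing.isLinear.Build R 'rV[R]_n R _ (dotv g) (dotv_is_linear g).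

Lemma dotv_gradient U x v : differentiable U x -> dotv (gradient U x) v = 'd U x v.
Proof.
move=> dU; rewrite {2}(row_sum_delta v) linear_sum/=; apply: eq_bigr => i _.
by rewrite linearZ/= mxE mulrC.
Qed.

Lemma dotv_continuous g : continuous (dotv g : 'rV[R]_n -> R).
Proof.
move=> x; apply/continuous_dist => e e0.
have K0 : 0 < n%:R * `|g| + 1 by rewrite ltr_wpDl// mulr_ge0.
exists (e / (n%:R * `|g| + 1)); first by rewrite divr_gt0.
move=> y; rewrite ltr_pdivlMr// => xy.
rewrite -dotvNr -dotvDr (le_lt_trans (dotv_le _ _))//.
by apply: le_lt_trans xy; have := normr_ge0 (x - y); rewrite mulrA; nra.
Qed.

Lemma differentiable_dist U x : differentiable U x -> forall e : R, 0 < e ->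
  exists2 d : R, 0 < d & forall v, `|v| < d ->
    `|U (x + v) - U x - 'd U x v| <= e * `|v|.
Proof.
move=> /diff_locally /eqaddoP H e e0.
have /nbhs_dist[d d0 dP] := H e e0.
exists d => // v vd; have := dP v; rewrite sub0r normrN => /(_ vd).
by rewrite -[(_ - _) v]/(U (v + x) - (U x + 'd U x v)) opprD addrA [v + x]addrC.
Qed.

Lemma dist_differentiable U x g (K d : R) : 0 < d ->
  (forall v, `|v| < d -> `|U (x + v) - U x - dotv g v| <= K * `|v| ^+ 2) ->
  differentiable U x.
Proof.
move=> d0 H.
pose df : {linear 'rV[R]_n -> R} := dotv g.
suff H' : forall e : R, 0 < e -> \forall v \near (0 : 'rV[R]_n),
    `|(U \o shift x - (cst (U x) + df)) v| <= e * `|v|.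
  have D : 'd U x = df :> ('rV[R]_n -> R).
    by apply: diff_unique; [exact: dotv_continuous|apply/eqaddoP].
  by apply/diff_locallyP; rewrite D; split; [exact: dotv_continuous|apply/eqaddoP].
move=> e e0; have K0 : 0 < `|K| + 1 by rewrite ltr_wpDl.
apply/nbhs_dist; exists (Num.min d (e / (`|K| + 1))).
  by rewrite lt_min d0 divr_gt0.
move=> v; rewrite sub0r normrN lt_min => /andP[vd ve].
rewrite -[(_ - _) v]/(U (v + x) - (U x + dotv g v)) opprD addrA [v + x]addrC.
rewrite (le_trans (H v vd))// expr2 mulrA ler_wpM2r//.
move: ve; rewrite ltr_pdivlMr// => ve; apply: le_trans (ltW ve).
by have := ler_norm K; have := normr_ge0 v; nra.
Qed.

End gradients.

Section sequences_dist.
Context {R : realType}.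

Lemma cvg_dist (V : normedModType R) (u : nat -> V) x :
  u @ \oo --> x <-> forall e : R, 0 < e -> exists N, forall k, (N <= k)%N -> `|x - u k| < e.
Proof.
split=> [ux e e0|H P /nbhs_dist[e e0 eP]].
  have : nbhs x [set w | `|x - w| < e] by apply/nbhs_dist; exists e.
  by move=> /ux[N _ NP]; exists N => k /NP.
by have [N NP] := H e e0; exists N => // k /NP/eP.
Qed.

Lemma cball_compact n (c : 'rV[R]_n) (r : R) : compact [set y | `|c - y| <= r].
Proof.
apply: bounded_closed_compact.
  exists (`|c| + r); split; first exact: num_real.
  move=> x xr y /= cy; rewrite (le_trans _ (ltW xr))//.
  rewrite -[y](subKr c) (le_trans (ler_normB _ _))//.
  by rewrite lerD2l.
rewrite -[X in closed X]setCK; apply: open_closedC; rewrite openE => y /= /negP.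
rewrite -ltNge => ry; apply/nbhs_dist; exists (`|c - y| - r); first by rewrite subr_gt0.
move=> w yw /=; apply/negP; rewrite -ltNge; have := ler_distD w c y.
by rewrite (distrC w y); lra.
Qed.

Lemma invS_lt (e : R) : 0 < e -> exists N : nat, forall k, (N <= k)%N -> k.+1%:R^-1 < e.
Proof.
move=> e0; exists (Num.truncn e^-1) => k Nk; rewrite invf_plt ?posrE//.
by rewrite (lt_le_trans (truncnS_gt _))// ler_nat ltnS.
Qed.

Lemma null_seq : exists dl : nat -> R, [/\ forall i, 0 < dl i, forall i, dl i <= 1 &
  forall e, 0 < e -> exists N, forall i, (N <= i)%N -> dl i < e].
Proof.
exists (fun i => i.+1%:R^-1); split => [i|i|e /invS_lt//]; first by rewrite invr_gt0.
by rewrite invf_le1// ler1n.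
Qed.

End sequences_dist.

Section semiconcave.
Context {R : realType} {n : nat}.
Variables (D : set 'rV[R]_n) (U : 'rV[R]_n -> R).
Hypothesis D_open : open D.
Hypothesis U_cont : forall x, D x -> {for x, continuous U}.
Hypothesis U_sc : locally_semiconcave D U.
Implicit Types (x y z h p : 'rV[R]_n) (r C e : R).

(** The inequalities hold on radius 2r so that x + h is covered for x in the r-ball and |h| <= r. C
    refers to the sup norm. *)
Definition semiconcave_ball z r C : Prop :=
  [/\ 0 < r, 0 < C, forall y, `|z - y| <= 2 * r -> D y &
      forall x y, `|z - x| <= 2 * r -> `|z - y| <= 2 * r ->
        U x + U y - 2 * U (2^-1 *: (x + y)) <= C * `|x - y| ^+ 2].

Lemma semiconcave_ballP z : D z -> exists r C, semiconcave_ball z r C.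
Proof.
move=> Dz; have /nbhs_dist[d d0 dD] := open_nbhs_nbhs (conj D_open Dz).
have rD y : `|z - y| <= 2 * (d / 4) -> D y.
  by move=> zy; apply: dD; apply: le_lt_trans zy _; lra.
have [C C0 HC] := U_sc (@cball_compact _ _ z (2 * (d / 4))) rD.
exists (d / 4), (C * n%:R + 1); split => //; first by rewrite divr_gt0.
  by rewrite ltr_wpDl// mulr_ge0// ltW.
move=> x y zx zy.
have : U x + U y - 2 * U (2^-1 *: (x + y)) <= C * enorm (x - y) ^+ 2.
  apply: HC => s /andP[s0 s1] /=.
  rewrite (_ : z - _ = (1 - s) *: (z - x) + s *: (z - y)); last first.
    by apply/rowP => i; rewrite !mxE; ring.
  rewrite (le_trans (ler_normD _ _))// !normrZ !ger0_norm ?subr_ge0//.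
  by nra.
move=> /le_trans; apply; have := enorm_sqr_le (x - y).
by have := sqr_ge0 `|x - y|; nra.
Qed.

Section ball.
Variables (z : 'rV[R]_n) (r C : R).
Hypothesis zr : semiconcave_ball z r C.

Lemma ballD x h : `|z - x| <= r -> `|h| <= r -> `|z - (x + h)| <= 2 * r.
Proof.
move=> zx hr; rewrite opprD addrA (le_trans (ler_normB _ _))//; lra.
Qed.

(** The vector p is a proximal supergradient of U at x, with a scale r and a constant 2C that do not
    depend on x. *)
Definition superdiff x p : Prop := forall h, `|h| <= r ->
  U (x + h) <= U x + dotv p h + 2 * C * `|h| ^+ 2.

(** Only the midpoint inequality is used. It is iterated along h, h/2, h/4, ..., the quadratic
    errors sum to at most 2C|h|^2, and 2^k (U(x + h/2^k) - U(x)) tends to the derivative along h. *)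
Lemma superdiff_gradient x : `|z - x| <= r -> differentiable U x -> superdiff x (gradient U x).
Proof.
move=> zx dU h hr; have [r0 C0 rD scU] := zr.
pose hk k : 'rV[R]_n := (2^-1) ^+ k *: h.
have hkn k : `|hk k| = (2^-1) ^+ k * `|h| by rewrite normrZ ger0_norm ?exprn_ge0.
have half_le k : (2^-1 : R) ^+ k <= 1 by rewrite exprn_ile1 ?invr_ge0// invf_le1// ler1n.
have hkr k : `|hk k| <= r.
  by rewrite hkn (le_trans _ hr)// ler_piMl.
have step k : U (x + hk k) - U x <= 2 * (U (x + hk k.+1) - U x) + C * `|hk k| ^+ 2.
  have := scU (x + hk k) x (ballD zx (hkr k)) _.
  rewrite (_ : 2^-1 *: _ = x + hk k.+1); last first.
    by apply/rowP => i; rewrite !mxE exprS; field.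
  rewrite (_ : x + hk k - x = hk k); last by rewrite addrAC subrr add0r.
  have zx2 : `|z - x| <= 2 * r by lra.
  by move=> /(_ zx2); lra.
have iter_ k : U (x + h) - U x <= 2 ^+ k * (U (x + hk k) - U x)
    + 2 * C * `|h| ^+ 2 * (1 - (2^-1) ^+ k).
  elim: k => [|k IH]; first by rewrite /hk !expr0 mul1r scale1r subrr mulr0 addr0.
  have := step k; rewrite hkn exprMn => st.
  have P0 : 0 < (2 : R) ^+ k by rewrite exprn_gt0.
  have PP : (2 : R) ^+ k * (2^-1) ^+ k = 1 by rewrite -exprMn divff ?expr1n.
  rewrite !exprS; move: IH st; move: P0 PP.
  set a := 2 ^+ k; set b := 2^-1 ^+ k; set u1 := U (x + h) - U x => a0 ab IH st.
  have {}st : a * (U (x + hk k) - U x) <= a * (2 * (U (x + hk k.+1) - U x) + C * (b ^+ 2 * `|h| ^+ 2)).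
    by rewrite ler_pM2l.
  have E : a * (C * (b ^+ 2 * `|h| ^+ 2)) = C * `|h| ^+ 2 * b.
    by rewrite -[RHS]mul1r -ab; ring.
  by rewrite [X in _ <= X]mulrDr E in st; lra.
suff H e : 0 < e -> U (x + h) - U x <= dotv (gradient U x) h + 2 * C * `|h| ^+ 2 + e * `|h|.
  rewrite -addrA -lerBlDl; apply/ler_addgt0Pr => e e0.
  have h1 : 0 < `|h| + 1 by rewrite ltr_wpDl.
  have := H (e / (`|h| + 1)) (divr_gt0 e0 h1) => /le_trans; apply.
  rewrite lerD2l mulrAC ler_pdivrMr//; nra.
move=> e0; have [d d0 dU'] := differentiable_dist dU e0.
have [k hkd] : exists k, `|hk k| < d.
  have : \forall k \near \oo, (fun k => `|h| * (2^-1) ^+ k) k < d.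
    apply: (@cvgr_lt _ _ _ _ _ (`|h| * 0)); last by rewrite mulr0.
    by apply: cvgMr; apply: cvg_expr; rewrite ger0_norm// invf_lt1// ltr1n.
  by move=> [N _ /(_ N (leqnn N))] /= hN; exists N; rewrite hkn mulrC.
have := dU' _ hkd; rewrite -dotv_gradient// dotvZr hkn => /ler_normlW st.
have := iter_ k.
have P0 : 0 < (2 : R) ^+ k by rewrite exprn_gt0.
have PP : (2 : R) ^+ k * (2^-1) ^+ k = 1 by rewrite -exprMn divff ?expr1n.
have b1 : 0 <= (2^-1 : R) ^+ k by rewrite exprn_ge0.
move: P0 PP b1 st; set a := 2 ^+ k; set b := 2^-1 ^+ k => a0 ab b0 st it.
have {}st : a * (U (x + hk k) - U x) <= a * (b * dotv (gradient U x) h + e * (b * `|h|)).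
  by rewrite ler_pM2l//; lra.
have E : a * (b * dotv (gradient U x) h + e * (b * `|h|)) = dotv (gradient U x) h + e * `|h|.
  by rewrite -[RHS]mul1r -ab; ring.
have : 0 <= 2 * C * `|h| ^+ 2 * b by rewrite !mulr_ge0 ?sqr_ge0 ?(ltW C0).
by rewrite E in st; lra.
Qed.

End ball.

End semiconcave.

Section limiting_gradients.
Context {R : realType} {n : nat}.
Variables (D : set 'rV[R]_n) (U : 'rV[R]_n -> R).
Hypothesis D_open : open D.
Hypothesis U_cont : forall x, D x -> {for x, continuous U}.
Hypothesis U_sc : locally_semiconcave D U.
Implicit Types (x y z h p : 'rV[R]_n) (r C e : R).

(** The inequality for gradients passes to the limit, U being continuous at x and at x + h. The
    strict bound on |z - x| keeps the approximating points in the ball. *)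
Lemma superdiff_Dstar z r C x p : semiconcave_ball D U z r C -> `|z - x| < r ->
  Dstar U x p -> superdiff U r C x p.
Proof.
move=> zr zx [xs [xsd /cvg_dist xsx /cvg_dist gp]] h hr.
have [r0 C0 rD _] := zr.
have Dx : D x by apply: rD; lra.
have Dxh : D (x + h) by apply: rD; apply: ballD => //; exact: ltW.
apply/ler_addgt0Pr => e e0.
have e3 : 0 < e / 3 by lra.
have [d1 d10 H1] := (continuous_dist U x).1 (U_cont Dx) _ e3.
have [d2 d20 H2] := (continuous_dist U (x + h)).1 (U_cont Dxh) _ e3.
have K0 : 0 < n%:R * `|h| + 1 by rewrite ltr_wpDl// mulr_ge0.
have [N1 P1] := xsx _ d10; have [N2 P2] := xsx _ d20.
have zx0 : 0 < r - `|z - x| by rewrite subr_gt0.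
have [N3 P3] := xsx _ zx0; have [N4 P4] := gp _ (divr_gt0 e3 K0).
pose j := maxn (maxn N1 N2) (maxn N3 N4).
have jle : [&& (N1 <= j)%N, (N2 <= j)%N, (N3 <= j)%N & (N4 <= j)%N].
  by rewrite /j !leq_max !leqnn !orbT.
have /and4P[j1 j2 j3 j4] := jle.
have [_ dj] := xsd j.
have zxj : `|z - xs j| <= r.
  have := ler_distD x z (xs j); have := P3 j j3; lra.
have := superdiff_gradient zr zxj dj hr.
have u1 := H1 _ (P1 j j1).
have u2 : `|U (x + h) - U (xs j + h)| < e / 3.
  by apply: H2; rewrite opprD addrACA subrr addr0; exact: P2.
have u3 : `|dotv (p - gradient U (xs j)) h| <= e / 3.
  rewrite (le_trans (dotv_le _ _))//.
  have := P4 j j4; rewrite ltr_pdivlMr// => /ltW; apply: le_trans.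
  have := normr_ge0 (p - gradient U (xs j)); have := normr_ge0 h.
  by rewrite mulrCA => h0 g0; rewrite ler_wpM2l// lerDl.
rewrite dotvBl in u3; move: u1 u2 u3; rewrite !ltr_norml ler_norml.
by move=> /andP[? ?] /andP[? ?] /andP[? ?]; lra.
Qed.

Lemma ball_bounded z r C : semiconcave_ball D U z r C ->
  exists B : R, forall y, `|z - y| <= 2 * r -> `|U y| <= B.
Proof.
move=> [r0 _ rD _].
have cK := @cball_compact _ _ z (2 * r).
have ne : [set y | `|z - y| <= 2 * r] !=set0.
  by exists z; rewrite /= subrr normr0; lra.
have cU : {within [set y | `|z - y| <= 2 * r], continuous (fun y => `|U y|)}.
  apply: continuous_in_subspaceT => y; rewrite inE/= => zy.
  apply: (@continuous_comp _ _ _ U (@Num.norm _ R)); first exact/U_cont/rD.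
  exact: norm_continuous.
have [c _ cP] := compact_EVT_max ne cK cU.
by exists `|U c| => y zy; apply: cP; rewrite inE.
Qed.

(** Testing with h of length at most r along the i-th axis, against the sign of p_i, gives r|p_i| <=
    U(x) - U(x + h) + 2Cr^2, and U is bounded on the ball. *)
Lemma superdiff_bounded z r C : semiconcave_ball D U z r C ->
  exists P : R, forall x p, `|z - x| <= r -> superdiff U r C x p -> `|p| <= P.
Proof.
move=> zr; have [B UB] := ball_bounded zr; have [r0 C0 rD _] := zr.
have B0 : 0 <= B by apply: le_trans (UB z _) => //; rewrite subrr normr0; lra.
exists ((2 * B + 2 * C * r ^+ 2) / r) => x p zx xp.
apply: rV_norm_le.
  by rewrite divr_ge0 ?(ltW r0)// addr_ge0 ?mulr_ge0 ?sqr_ge0// ltW.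
move=> i; pose h : 'rV[R]_n := (- (r * Num.sg (p 0 i))) *: delta_mx 0 i.
have hr : `|h| <= r.
  apply: rV_norm_le; first exact: ltW.
  move=> j; rewrite !mxE eqxx/= normrM normrN normrM (gtr0_norm r0) normr_sg normr_nat.
  by case: (_ == 0); case: (j == i); rewrite ?mulr1 ?mulr0 ?(ltW r0).
have hp : dotv p h = - (r * `|p 0 i|).
  rewrite /dotv (bigD1 i)//= big1 ?addr0; last first.
    by move=> j ji; rewrite !mxE eqxx/= (negPf ji) !mulr0.
  by rewrite !mxE !eqxx/= mulr1 mulrN mulrC -mulrA -normrEsg.
have := xp h hr; rewrite hp.
have := UB _ (ballD zx hr); rewrite ler_norml => /andP[u1 _].
have : `|U x| <= B by apply: UB; lra.
rewrite ler_norml => /andP[_ u2].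
have : 2 * C * `|h| ^+ 2 <= 2 * C * r ^+ 2.
  by rewrite ler_wpM2l ?mulr_ge0 ?(ltW C0)// ler_pXn2r// nnegrE// ltW.
by rewrite ler_pdivlMr// mulrC; lra.
Qed.

(* Where z |-> U z + N |z - c|^2 has a local minimum, U has a quadratic minorant
   and, by semiconcavity, a quadratic majorant with the same slope. *)
Lemma differentiable_dense c e : D c -> 0 < e -> exists2 x, `|c - x| < e & differentiable U x.
Proof.
move=> Dc e0; have [r [C cr]] := semiconcave_ballP D_open U_sc Dc.
have [B UB] := ball_bounded cr; have [r0 C0 rD scU] := cr.
pose d := Num.min r (e / 2).
have d0 : 0 < d by rewrite lt_min r0/=; lra.
have dr : d <= r by rewrite ge_min lexx.
have de : d < e by rewrite gt_min; apply/orP; right; lra.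
have d2 : 0 < d ^+ 2 by rewrite exprn_gt0.
have B0 : 0 <= B by apply: le_trans (UB c _) => //; rewrite subrr normr0; lra.
(* On the sphere of radius d the penalty is at least 2B + 1, more than U can vary, so the minimum is
   attained inside the ball. *)
pose N := (2 * B + 1) / d ^+ 2.
have N0 : 0 < N by rewrite divr_gt0// ltr_wpDl// mulr_ge0.
pose q x := dotv (x - c) (x - c).
have qge x : `|c - x| ^+ 2 <= q x.
  rewrite distrC -[q x](sqr_sqrtr (dotvv_ge0 (x - c))).
  by rewrite ler_pXn2r ?nnegrE ?enorm_ge0 ?norm_le_enorm.
have qD x v : q (x + v) = q x + 2 * dotv (x - c) v + dotv v v.
  rewrite /q /dotv mulr_sumr -!big_split/=; apply: eq_bigr => i _; rewrite !mxE; ring.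
have q_cont : continuous q.
  move=> x; apply/continuous_dist => e' e'0.
  pose K := 2 * (n%:R * `|x - c|) + n%:R + 1.
  have K0 : 0 < K by rewrite ltr_wpDl// addr_ge0 ?mulr_ge0.
  exists (Num.min 1 (e' / K)); first by rewrite lt_min ltr01 divr_gt0.
  move=> y; have -> : q y = q (x + (y - x)) by rewrite subrKC.
  rewrite qD (distrC x y); set v := y - x; rewrite lt_min ltr_pdivlMr// => /andP[v1 vK].
  rewrite (_ : q x - _ = - (2 * dotv (x - c) v + dotv v v)); last by ring.
  rewrite normrN; apply: le_lt_trans vK.
  rewrite (le_trans (ler_normD _ _))// normrM ger0_norm//.
  have := dotv_le (x - c) v; have := dotv_le v v.
  have : n%:R * (`|v| * `|v|) <= n%:R * `|v|.
    by rewrite ler_wpM2l// ler_piMl// ltW.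
  by have := normr_ge0 v; rewrite /K; lra.
have cK := @cball_compact _ _ c d.
have ne : [set y | `|c - y| <= d] !=set0 by exists c; rewrite /= subrr normr0 ltW.
have cU : {within [set y | `|c - y| <= d], continuous (fun y => U y + N * q y)}.
  apply: continuous_in_subspaceT => y; rewrite inE/= => cy.
  have Dy : D y by apply: rD; lra.
  apply: (@continuousD _ _ _ U (fun y => N * q y)); first exact: (U_cont Dy).
  by apply: (@continuousM _ _ (fun=> N) q); [exact: cst_continuous|exact: q_cont].
have [x xd xmin] := compact_EVT_min ne cK cU.
rewrite inE/= in xd.
have xlt : `|c - x| < d.
  rewrite lt_neqAle xd andbT; apply/eqP => xe.
  have := xmin c; rewrite inE/= subrr normr0 (ltW d0) => /(_ isT).
  have := UB c; rewrite subrr normr0 => /(_ _); have r2 : 0 <= 2 * r by lra.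
  move=> /(_ r2); have := UB x; have xr : `|c - x| <= 2 * r by lra.
  move=> /(_ xr); rewrite !ler_norml => /andP[? ?] /andP[? ?].
  have -> : q c = 0 by rewrite /q subrr /dotv big1// => i _; rewrite mxE mul0r.
  have : N * d ^+ 2 <= N * q x by rewrite ler_pM2l// -xe qge.
  have -> : N * d ^+ 2 = 2 * B + 1 by rewrite /N divfK// gt_eqF.
  by lra.
exists x; first exact: lt_trans xlt de.
pose g : 'rV[R]_n := (- (2 * N)) *: (x - c).
have dx0 : 0 < d - `|c - x| by rewrite subr_gt0.
have gE v : dotv g v = - (2 * N * dotv (x - c) v).
  by rewrite /g /dotv mulr_sumr -sumrN; apply: eq_bigr => i _; rewrite !mxE; ring.
apply: (@dist_differentiable _ _ U x g (N * n%:R + 4 * C) (d - `|c - x|) dx0) => v vd.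
have low w : `|w| < d - `|c - x| -> dotv g w - N * n%:R * `|w| ^+ 2 <= U (x + w) - U x.
  move=> wd; have := xmin (x + w); rewrite inE/= => /(_ _).
  have xw : `|c - (x + w)| <= d.
    by rewrite opprD addrA (le_trans (ler_normB _ _))//; lra.
  move=> /(_ xw); rewrite qD gE.
  have : N * dotv w w <= N * n%:R * `|w| ^+ 2.
    rewrite -mulrA ler_pM2l// (le_trans (ler_norm _))// (le_trans (dotv_le _ _))//.
  by lra.
have h1 := low v vd.
have h2 : dotv g (- v) - N * n%:R * `|v| ^+ 2 <= U (x - v) - U x.
  by have := low (- v); rewrite normrN => /(_ vd).
rewrite dotvNr in h2.
(* The majorant at x + v comes from semiconcavity at the midpoint x of x + v and x - v, combined
   with the minorant at x - v. *)
have := scU (x + v) (x - v) _ _.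
rewrite (_ : 2^-1 *: _ = x); last by apply/rowP => i; rewrite !mxE; field.
rewrite (_ : x + v - (x - v) = 2 *: v); last by apply/rowP => i; rewrite !mxE; ring.
rewrite normrZ ger0_norm// exprMn => sc.
have cx : `|c - x| <= r by lra.
have vr : `|v| <= r by have := normr_ge0 (c - x); lra.
have {}sc := sc (ballD cx vr) (ballD cx (eq_ind_r (fun t => t <= r) vr (normrN v))).
rewrite ler_norml; apply/andP; split; last by lra.
by have := sqr_ge0 `|v|; nra.
Qed.

(** Limiting gradients are taken along points different from the limit. If c is the point to avoid,
    the search is moved to a centre at distance s from c with radius s/2; in positive dimension
    there is such a centre. *)
Lemma differentiable_dense_neq (n_gt0 : (0 < n)%N) c w e : D c -> 0 < e ->
  exists x, [/\ `|c - x| < e, x != w & differentiable U x].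
Proof.
move=> Dc e0; have [cw|cw] := eqVneq c w; last first.
  have m0 : 0 < Num.min e `|c - w| by rewrite lt_min e0 normr_gt0 subr_eq0.
  have [x] := differentiable_dense Dc m0; rewrite lt_min => /andP[xe xw] dx.
  by exists x; split => //; apply: contraTneq xw => ->; rewrite ltxx.
have /nbhs_dist[d d0 dD] := open_nbhs_nbhs (conj D_open Dc).
pose s := Num.min (d / 2) (e / 2).
have s0 : 0 < s by rewrite lt_min; lra.
have sd : s < d by rewrite gt_min; apply/orP; left; lra.
have se : s <= e / 2 by rewrite ge_min lexx orbT.
pose i0 : 'I_n := Ordinal n_gt0.
pose c' : 'rV[R]_n := c + s *: delta_mx 0 i0.
have cc' : `|c - c'| = s.
  rewrite /c' opprD addrA subrr sub0r normrN; apply/eqP; rewrite eq_le; apply/andP; split.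
    apply: rV_norm_le; first exact: ltW.
    move=> j; rewrite !mxE normrM (gtr0_norm s0) eqxx/= normr_nat.
    by case: (j == i0); rewrite ?mulr1 ?mulr0 ?(ltW s0).
  have := rV_coord_le (s *: delta_mx 0 i0) i0.
  by rewrite !mxE !eqxx/= mulr1 (gtr0_norm s0).
have Dc' : D c' by apply: dD; rewrite cc'.
have s2 : 0 < s / 2 by lra.
have [x xc' dx] := differentiable_dense Dc' s2.
exists x; split => //.
  by have := ler_distD c' c x; rewrite cc'; lra.
apply: contraTneq xc' => ->; rewrite -cw distrC cc' -leNgt; lra.
Qed.

End limiting_gradients.

(** * Uniform decrease near a point *)

Section uniform_decrease.
Context {R : realType} {n q : nat}.
Variables (D : set 'rV[R]_n) (U : 'rV[R]_n -> R).
Hypothesis n_gt0 : (0 < n)%N.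
Hypothesis D_open : open D.
Hypothesis U_cont : forall x, D x -> {for x, continuous U}.
Hypothesis U_sc : locally_semiconcave D U.
Implicit Types (x y z h p : 'rV[R]_n) (r C e : R).

(** Gradients near z are bounded, being supergradients, so they cluster; a subsequence realises any
    cluster point as a limiting gradient. *)
Lemma Dstar_cluster z (xs : nat -> 'rV[R]_n) : D z ->
  (forall j, xs j != z /\ differentiable U (xs j)) -> xs @ \oo --> z ->
  exists2 p, Dstar U z p &
    forall e, 0 < e -> forall N, exists2 j, (N <= j)%N & `|p - gradient U (xs j)| < e.
Proof.
move=> Dz xsd /cvg_dist xsz; have [r [C zr]] := semiconcave_ballP D_open U_sc Dz.
have [P UP] := superdiff_bounded U_cont zr.
have [N0 xN0] := xsz r (let: And4 r0 _ _ _ := zr in r0).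
have gP k : [set g | `|0 - g| <= P] (gradient U (xs (k + N0)%N)).
  rewrite /= sub0r normrN; have xr := ltW (xN0 _ (leq_addl k N0)).
  by apply: (UP _ _ xr); apply: (superdiff_gradient zr xr); case: (xsd (k + N0)%N).
have [p _ cl] := compact_cvg_cluster (@cball_compact _ _ 0 P) gP.
have cl' e : 0 < e -> forall N, exists2 j, (N <= j)%N & `|p - gradient U (xs j)| < e.
  move=> e0 N; have [j Nj pj] := cl e e0 N.
  by exists (j + N0)%N => //; rewrite (leq_trans Nj)// leq_addr.
exists p => //; have inv0 i : (0 : R) < i.+1%:R^-1 by rewrite invr_gt0.
pose J i := sval (cid2 (cl' _ (inv0 i) i)).
have JP i : (i <= J i)%N /\ `|p - gradient U (xs (J i))| < i.+1%:R^-1.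
  by rewrite /J; case: cid2.
exists (xs \o J); split => [j| |]; first exact: xsd.
  apply/cvg_dist => e e0; have [N xN] := xsz e e0; exists N => k Nk.
  by apply: xN; rewrite (leq_trans Nk)//; case: (JP k).
apply/cvg_dist => e e0; have [N iN] := invS_lt e0; exists N => k Nk.
by apply: lt_trans (iN k Nk); case: (JP k).
Qed.

Lemma Dstar_nonempty z : D z -> exists p, Dstar U z p.
Proof.
move=> Dz; have inv0 i : (0 : R) < i.+1%:R^-1 by rewrite invr_gt0.
have ex i := cid (differentiable_dense_neq D_open U_cont U_sc n_gt0 z Dz (inv0 i)).
have exP i : [/\ `|z - sval (ex i)| < i.+1%:R^-1,
  sval (ex i) != z & differentiable U (sval (ex i))].
  by case: (ex i).
have [||p pz _] := @Dstar_cluster z (fun i => sval (ex i)) Dz; last by exists p.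
  by move=> j; have [] := exP j.
apply/cvg_dist => e e0; have [N iN] := invS_lt e0; exists N => k Nk.
by apply: lt_trans (iN k Nk); case: (exP k).
Qed.

(** For diagonal arguments: limiting gradients at points tending to w are replaced by gradients at
    points tending to w and different from w. *)
Lemma Dstar_approx z w p e : Dstar U z p -> 0 < e ->
  exists x, [/\ `|z - x| < e, x != w, differentiable U x & `|p - gradient U x| < e].
Proof.
move=> [xs [xsd /cvg_dist xsz /cvg_dist gp]] e0.
have [N1 h1] := xsz _ e0; have [N2 h2] := gp _ e0.
have [zw|zw] := eqVneq z w.
  exists (xs (maxn N1 N2)); split.
  - by apply: h1; exact: leq_maxl.
  - by rewrite -zw; case: (xsd (maxn N1 N2)).
  - by case: (xsd (maxn N1 N2)).
  - by apply: h2; exact: leq_maxr.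
have zw0 : 0 < `|z - w| by rewrite normr_gt0 subr_eq0.
have [N3 h3] := xsz _ zw0; pose j := maxn (maxn N1 N2) N3.
have /and3P[j1 j2 j3] : [&& N1 <= j, N2 <= j & N3 <= j]%N.
  by rewrite /j !leq_max !leqnn !orbT.
exists (xs j); split; [exact: h1| |by case: (xsd j)|exact: h2].
by apply: contraTneq (h3 j j3) => ->; rewrite ltxx.
Qed.

Variables (A : set 'rV[R]_q).
Variables (f : 'rV[R]_n -> 'rV[R]_q -> 'rV[R]_n) (l : 'rV[R]_n -> 'rV[R]_q -> R) (k : R).
Hypothesis f_cont : forall a, A a -> continuous (fun x => f x a).
Hypothesis l_cont : forall a, A a -> continuous (fun x => l x a).
Hypothesis decrease : forall x p, D x -> Dstar U x p ->
  exists2 a, A a & dotv p (f x a) + k * l x a < 0.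

Lemma hamiltonian_continuous a z p e : A a -> 0 < e -> exists2 d, 0 < d &
  forall x g, `|z - x| < d -> `|p - g| < d ->
    dotv g (f x a) + k * l x a <= dotv p (f z a) + k * l z a + e.
Proof.
move=> Aa e0.
(* K collects the coefficients of e' in the errors caused by changing the gradient, the velocity and
   the cost; the bound |f z a| + 1 covers the velocity at x. *)
pose K := n%:R * (`|f z a| + 1) + n%:R * `|p| + `|k| + 1.
have fa0 : 0 <= n%:R * (`|f z a| + 1) by rewrite mulr_ge0// addr_ge0.
have np0 : 0 <= n%:R * `|p| by rewrite mulr_ge0.
have K0 : 0 < K by rewrite ltr_wpDl// addr_ge0// addr_ge0.
pose e' := Num.min 1 (e / K).
have e'0 : 0 < e' by rewrite lt_min ltr01 divr_gt0.
have [d1 d10 H1] := (continuous_dist _ z).1 (@f_cont a Aa z) e' e'0.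
have [d2 d20 H2] := (continuous_dist _ z).1 (@l_cont a Aa z) e' e'0.
exists (Num.min e' (Num.min d1 d2)); first by rewrite lt_min e'0 lt_min d10.
move=> x g; rewrite lt_min => /andP[_]; rewrite lt_min => /andP[x1 x2].
rewrite lt_min => /andP[pg _].
have {}H1 := H1 x x1; have {}H2 := H2 x x2.
have fx : `|f x a| <= `|f z a| + 1.
  rewrite -[f x a](subKr (f z a)) (le_trans (ler_normB _ _))// lerD2l.
  by rewrite (le_trans (ltW H1))// ge_min lexx.
have E : dotv g (f x a) = dotv p (f z a) - dotv (p - g) (f x a) - dotv p (f z a - f x a).
  by rewrite dotvBl dotvDr dotvNr; ring.
have h1 : `|dotv (p - g) (f x a)| <= n%:R * (`|f z a| + 1) * e'.
  by rewrite (le_trans (dotv_le _ _))// -mulrA ler_wpM2l// mulrC ler_pM// ltW.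
have h2 : `|dotv p (f z a - f x a)| <= n%:R * `|p| * e'.
  by rewrite (le_trans (dotv_le _ _))// mulrA ler_wpM2l// ltW.
have h3 : `|k * (l z a - l x a)| <= `|k| * e'.
  by rewrite normrM ler_wpM2l// ltW.
have h4 : K * e' <= e.
  rewrite (@le_trans _ _ (K * (e / K)))//.
    by rewrite ler_pM2l// ge_min lexx orbT.
  by rewrite mulrC divfK// gt_eqF.
move: h1 h2 h3; rewrite !ler_norml mulrBr => /andP[h1 _] /andP[h2 _] /andP[h3 _].
by move: h4; rewrite /K E; lra.
Qed.

(** Otherwise points x_i tend to z at which no control gives decrease more than a vanishing amount.
    Their limiting gradients cluster at some p0 in D*U(z), and a control that decreases at (z, p0)
    decreases at (x_i, p_i) for some large i by a fixed amount. *)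
Lemma uniform_decrease z : D z -> exists r c, [/\ 0 < r, 0 < c &
  forall x, `|z - x| < r -> D x /\ exists p a,
    [/\ Dstar U x p, A a & dotv p (f x a) + k * l x a + c <= 0]].
Proof.
move=> Dz; have /nbhs_dist[d d0 dD] := open_nbhs_nbhs (conj D_open Dz).
apply: contrapT => H.
have [dl [inv0 _ dlN]] := @null_seq R.
have ex i : exists x, [/\ D x, `|z - x| < dl i & forall p a,
    Dstar U x p -> A a -> - dl i < dotv p (f x a) + k * l x a].
  apply: contrapT => Hi; apply: H; exists (Num.min d (dl i)), (dl i).
  split=> //; first by rewrite lt_min d0 inv0.
  move=> x; rewrite lt_min => /andP[xd xi]; split; first exact: dD.
  apply: contrapT => Hx; apply: Hi; exists x; split => //; first exact: dD.
  move=> p a px Aa; rewrite ltNge; apply/negP => pa; apply: Hx; exists p, a.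
  by split => //; lra.
pose x i := sval (cid (ex i)).
have xP i : [/\ D (x i), `|z - x i| < dl i & forall p a,
    Dstar U (x i) p -> A a -> - dl i < dotv p (f (x i) a) + k * l (x i) a].
  by rewrite /x; case: cid.
have pex i : exists p, Dstar U (x i) p by apply: Dstar_nonempty; case: (xP i).
pose p i := sval (cid (pex i)).
have pP i : Dstar U (x i) (p i) by exact: (svalP (cid (pex i))).
(* The p i are themselves only limits; they are traded for gradients at points y i different from z,
   to which [Dstar_cluster] applies. *)
have yex i := cid (Dstar_approx z (pP i) (inv0 i)).
pose y i := sval (yex i).
have yP i : [/\ `|x i - y i| < dl i, y i != z, differentiable U (y i) &
    `|p i - gradient U (y i)| < dl i] by exact: (svalP (yex i)).
have yz : y @ \oo --> z.
  apply/cvg_dist => e e0; have e2 : 0 < e / 2 by lra.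
  have [N iN] := dlN _ e2; exists N => i Ni.
  have := iN i Ni; have [_ xi _] := xP i; have [yi _ _ _] := yP i.
  by have := ler_distD (x i) z (y i); lra.
have [||p0 p0z cl] := @Dstar_cluster z y Dz => //.
  by move=> j; have [] := yP j.
have [a Aa neg] := decrease Dz p0z.
set v := dotv _ _ + _ in neg.
have v2 : 0 < - v / 2 by lra.
have [d' d'0 Hc] := hamiltonian_continuous z p0 Aa v2.
have d'2 : 0 < d' / 2 by lra.
have [N1 iN1] := dlN _ d'2; have [N2 iN2] := dlN _ v2.
have [i iN pi] := cl _ d'2 (maxn N1 N2).
have [i1 i2] : (N1 <= i)%N /\ (N2 <= i)%N by apply/andP; rewrite -geq_max.
have := iN1 i i1; have := iN2 i i2; have [_ xi H'] := xP i; have [_ _ _ yi] := yP i.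
move=> s2 s1; have := H' _ _ (pP i) Aa.
have := Hc (x i) (p i) _ _.
have b1 : `|z - x i| < d' by lra.
have b2 : `|p0 - p i| < d'.
  by have := ler_distD (gradient U (y i)) p0 (p i); rewrite (distrC (gradient _ _) (p i)); lra.
by move=> /(_ b1 b2); rewrite -/v; lra.
Qed.

End uniform_decrease.

(** * Decrease along sampled arcs *)

Section step_estimate.
Context {R : realType} {n q : nat}.
Variables (A : set 'rV[R]_q).
Variables (f : 'rV[R]_n -> 'rV[R]_q -> 'rV[R]_n) (l : 'rV[R]_n -> 'rV[R]_q -> R).
Variables (M k : R) (D : set 'rV[R]_n) (U : 'rV[R]_n -> R).
Hypothesis M_gt0 : 0 < M.
Hypothesis k_gt0 : 0 < k.
Hypothesis f_growth : forall x a, A a -> `|f x a| <= M * (1 + `|x|).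
Hypothesis fl_lip : forall r : R, exists2 L : R, 0 < L & forall x1 x2 a,
  `|x1| <= r -> `|x2| <= r -> A a ->
  `|f x1 a - f x2 a| <= L * `|x1 - x2| /\ `|l x1 a - l x2 a| <= L * `|x1 - x2|.
Hypothesis l_ge0 : forall x a, A a -> 0 <= l x a.
Hypothesis l_cont : forall a, A a -> continuous (fun x => l x a).
Hypothesis D_open : open D.
Hypothesis U_cont : forall x, D x -> {for x, continuous U}.
Hypothesis U_sc : locally_semiconcave D U.

Lemma continuous_along (h : 'rV[R]_n -> R) (phi : R -> 'rV[R]_n) :
  continuous h -> continuous phi -> continuous (fun s => h (phi s)).
Proof.
move=> ch cp s; apply: (@continuous_comp _ _ _ phi h); [exact: cp|exact: ch].
Qed.

(** The numbers r and h serve all z near z0, all limiting gradients and all controls. The rate w is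
    left free: it is [m (U z)] below level sigma and a local margin above it, and only c <= w is
    needed to absorb the errors. *)
Lemma step_estimate z0 (c e : R) : D z0 -> 0 < c -> 0 < e ->
  exists r h : R, [/\ 0 < r, 0 < h, h <= (4 * M)^-1 &
    forall (z p : 'rV[R]_n) (a : 'rV[R]_q) (w tau : R) (phi : R -> 'rV[R]_n),
    `|z0 - z| < r -> Dstar U z p -> A a -> c <= w ->
      dotv p (f z a) + k * l z a + w <= 0 ->
      phi tau = z -> continuous phi ->
      solution f (fun=> a) phi tau (tau + (4 * M)^-1) ->
      (forall t : R, tau <= t -> `|phi t - z| <= M * (2 + 2 * `|z|) * (t - tau)) ->
      forall t : R, 0 <= t <= h -> [/\ D (phi (tau + t)),
        U (phi (tau + t)) <= U z - t / 2 * (k * l z a + w),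
        U (phi (tau + t)) + k * int_co (fun s => l (phi s) a) tau (tau + t) <= U z &
        `|U z0 - U (phi (tau + t))| < e]].
Proof.
move=> Dz0 c0 e0; have [r [C zr]] := semiconcave_ballP D_open U_sc Dz0.
have [P0 UP] := superdiff_bounded U_cont zr.
have [r0 C0 rD _] := zr.
have [d d0 Ud] := (continuous_dist U z0).1 (U_cont Dz0) _ e0.
pose Rb := `|z0| + 2 * r.
have Rb0 : 0 <= Rb by rewrite addr_ge0// mulr_ge0// ltW.
have [L L0 HL] := fl_lip Rb.
have [P PE] : {P : R | P = `|P0|} by exists `|P0|.
have [B BE] : {B : R | B = M * (2 + 2 * Rb)} by exists (M * (2 + 2 * Rb)).
have B0 : 0 < B by rewrite BE mulr_gt0// ltr_wpDr// mulr_ge0.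
have Pge0 : 0 <= P by rewrite PE.
have [C0' L0' B0' k0'] := And4 (ltW C0) (ltW L0) (ltW B0) (ltW k_gt0).
(* The coefficients of t^2 come from replacing the displacement by t f(z, a), from the supergradient
   inequality, and from freezing the cost at z. *)
pose K : R := n%:R * P * L * B + 2 * C * B ^+ 2 + k * L * B + 1.
have nP : 0 <= n%:R * P by rewrite mulr_ge0.
have nPLB : 0 <= n%:R * P * L * B by rewrite !mulr_ge0.
have CB : 0 <= 2 * C * B ^+ 2 by rewrite !mulr_ge0// sqr_ge0.
have kLB : 0 <= k * L * B by rewrite !mulr_ge0.
have K0 : 0 < K by rewrite /K; lra.
(* The four bounds keep, in order, the arc in its existence interval, in the ball of radius 2r, at
   values of U within e of U z0, and t K below c/2, half of the guaranteed rate. *)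
pose h := Num.min (Num.min (4 * M)^-1 (r / B)) (Num.min (d / (2 * B)) (c / (2 * K))).
have h0 : 0 < h.
  by rewrite /h !lt_min invr_gt0 !divr_gt0 ?mulr_gt0.
exists (Num.min r (d / 2)), h; split => //; first by rewrite lt_min r0 divr_gt0.
  by rewrite /h !ge_min lexx.
move=> z p a w tau phi; rewrite lt_min => /andP[zr1 zd] pz Aa cw neg phit cphi sol phiL t /andP[t0 th].
have [hM hr hd hc] : [/\ t <= (4 * M)^-1, t * B <= r, t * B <= d / 2 & t * K <= c / 2].
  move: th; rewrite /h !le_min => /andP[/andP[-> h1] /andP[h2 h3]].
  split => //; first by rewrite -ler_pdivlMr.
    by move: h2; rewrite ler_pdivlMr ?mulr_gt0//; lra.
  by move: h3; rewrite ler_pdivlMr ?mulr_gt0//; lra.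
have zRb : `|z| <= Rb.
  rewrite -[z](subKr z0) (le_trans (ler_normB _ _))// /Rb; lra.
have phiB s : tau <= s -> `|phi s - z| <= B * (s - tau).
  move=> ts; rewrite (le_trans (phiL s ts))// BE ler_wpM2r ?subr_ge0//.
  by rewrite ler_pM2l// lerD2l ler_pM2l.
have phiBt s : tau <= s <= tau + t -> `|phi s - z| <= B * t.
  move=> /andP[ts st]; rewrite (le_trans (phiB s ts))// ler_pM2l//; lra.
have in2r s : tau <= s <= tau + t -> `|z0 - phi s| <= 2 * r.
  move=> sh; rewrite -[phi s](subrKC z); apply: ballD; first exact: ltW.
  by rewrite (le_trans (phiBt s sh))// mulrC.
have phiRb s : tau <= s <= tau + t -> `|phi s| <= Rb.
  move=> sh; rewrite -[phi s](subKr z0) (le_trans (ler_normB _ _))// lerD2l.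
  exact: in2r.
have tt : tau <= tau + t by rewrite lerDl.
have hs : tau <= tau + t <= tau + t by rewrite tt lexx.
set y := phi (tau + t); pose v := y - z.
have vB : `|v| <= B * t by exact: phiBt.
have vr : `|v| <= r by rewrite (le_trans vB)// mulrC.
have LB s : tau <= s <= tau + t -> L * `|phi s - z| <= L * B * t.
  by move=> sh; rewrite -mulrA ler_pM2l// phiBt.
have sub_cc s : tau <= s < tau + t -> tau <= s <= tau + t by move=> /andP[-> /ltW].
have fdiff : `|v - t *: f z a| <= L * B * t * t.
  apply: rV_norm_le; first by rewrite !mulr_ge0.
  move=> i; have [i1 e1] : integrable_co (fun s => f (phi s) a 0 i) tau (tau + t) /\
     phi (tau + t) 0 i = phi tau 0 i + int_co (fun s => f (phi s) a 0 i) tau (tau + t).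
    by apply: (solution_at i sol) => //; rewrite lerD2l.
  rewrite [X in `|X|](_ : _ = int_co (fun s => f (phi s) a 0 i) tau (tau + t)
    - t * f z a 0 i); last by rewrite /v !mxE /y e1 phit; ring.
  have ic := @integrable_co_cst _ tau (tau + t) (f z a 0 i) tt.
  have := @int_co_cst _ tau (tau + t) (f z a 0 i) tt; rewrite addrAC subrr add0r mulrC => <-.
  rewrite -int_co_B//.
  have -> : L * B * t * t = L * B * t * (tau + t - tau) by ring.
  apply: int_co_bound => //; first exact: integrable_co_B.
  move=> s /sub_cc sh; have := rV_coord_le (f (phi s) a - f z a) i; rewrite !mxE.
  move=> /le_trans; apply; rewrite (le_trans _ (LB s sh))//.
  by have [] := HL (phi s) z a (phiRb s sh) zRb Aa.
have il : integrable_co (fun s => l (phi s) a) tau (tau + t).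
  by apply: integrable_co_cont => //; exact: (continuous_along (@l_cont a Aa)).
have ldiff : `|int_co (fun s => l (phi s) a) tau (tau + t) - t * l z a| <= L * B * t * t.
  have ic := @integrable_co_cst _ tau (tau + t) (l z a) tt.
  have := @int_co_cst _ tau (tau + t) (l z a) tt; rewrite [_ + _ - _]addrAC subrr add0r mulrC => <-.
  rewrite -int_co_B//.
  have -> : L * B * t * t = L * B * t * (tau + t - tau) by ring.
  apply: int_co_bound => //; first exact: integrable_co_B.
  move=> s /sub_cc sh; rewrite (le_trans _ (LB s sh))//.
  by have [] := HL (phi s) z a (phiRb s sh) zRb Aa.
have pP : `|p| <= P.
  apply: (le_trans (UP _ _ (ltW zr1) (superdiff_Dstar U_cont zr zr1 pz))).
  by rewrite PE ler_norm.
have Uy : U y <= U z + dotv p v + 2 * C * `|v| ^+ 2.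
  have := superdiff_Dstar U_cont zr zr1 pz vr.
  by rewrite /v subrKC.
have v2 : 2 * C * `|v| ^+ 2 <= 2 * C * B ^+ 2 * t ^+ 2.
  rewrite -(mulrA (2 * C)) -exprMn ler_wpM2l ?mulr_ge0 ?(ltW C0)//.
  by rewrite ler_pXn2r// nnegrE// mulr_ge0// ltW.
have pv : dotv p v <= t * dotv p (f z a) + n%:R * P * L * B * t ^+ 2.
  have -> : dotv p v = t * dotv p (f z a) + dotv p (v - t *: f z a).
    by rewrite dotvDr dotvNr dotvZr; ring.
  rewrite lerD2l (le_trans (ler_norm _))// (le_trans (dotv_le _ _))//.
  have -> : n%:R * P * L * B * t ^+ 2 = n%:R * (P * (L * B * t * t)) by ring.
  by rewrite ler_wpM2l// ler_pM.
have kl : k * int_co (fun s => l (phi s) a) tau (tau + t) <= t * (k * l z a) + k * L * B * t ^+ 2.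
  move: ldiff; rewrite ler_norml => /andP[_ h2].
  have {}h2 : int_co (fun s => l (phi s) a) tau (tau + t) <= t * l z a + L * B * t * t by lra.
  by rewrite -(ler_pM2l k_gt0) in h2; lra.
have kz : 0 <= k * l z a by rewrite mulr_ge0 ?(ltW k_gt0)// l_ge0.
have tneg : t * (dotv p (f z a) + k * l z a + w) <= 0 by rewrite mulr_ge0_le0.
have tK : t * (t * K) <= t * (c / 2) by rewrite ler_wpM2l.
have tcw : t * c <= t * w by rewrite ler_wpM2l.
have tkz : 0 <= t * (k * l z a) by rewrite mulr_ge0.
have t2 : 0 <= t ^+ 2 by rewrite sqr_ge0.
have kLBt : 0 <= k * L * B * t ^+ 2 by rewrite mulr_ge0.
rewrite /K in tK.
have C0t : 0 <= n%:R * P * L * B * t ^+ 2 by rewrite mulr_ge0.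
have key : U y <= U z - t / 2 * (k * l z a + w) /\
    U y + k * int_co (fun s => l (phi s) a) tau (tau + t) <= U z.
  have tc0 : 0 <= t * c by rewrite mulr_ge0// ltW.
  move: Uy v2 pv tneg tK tcw tkz t2 kLBt C0t kl.
  move: (U y) (U z) (dotv p v) (dotv p (f z a)) (n%:R * P * L * B) (2 * C) (k * L * B)
    (`|v| ^+ 2) (k * l z a) (k * int_co _ _ _) => u1 u2 u3 u4 u5 u6 u7 u8 u9 u10 *.
  by split; lra.
split; [by apply: rD; exact: in2r|exact: key.1|exact: key.2|].
apply: Ud; rewrite -[y](subrKC z) opprD addrA (le_lt_trans (ler_normB _ _))//.
  by move: vB; rewrite /v; lra.
Qed.

End step_estimate.

Section steps.
Context {R : realType} {n q : nat}.
Variables (A : set 'rV[R]_q).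
Variables (f : 'rV[R]_n -> 'rV[R]_q -> 'rV[R]_n) (l rho : 'rV[R]_n -> 'rV[R]_q -> R).
Variables (M k : R) (D : set 'rV[R]_n) (U : 'rV[R]_n -> R).
Variables (sigma : R) (m ghat rhohat Psi : R -> R).
Hypothesis n_gt0 : (0 < n)%N.
Hypothesis M_gt0 : 0 < M.
Hypothesis k_gt0 : 0 < k.
Hypothesis f_growth : forall x a, A a -> `|f x a| <= M * (1 + `|x|).
Hypothesis fl_lip : forall r : R, exists2 L : R, 0 < L & forall x1 x2 a,
  `|x1| <= r -> `|x2| <= r -> A a ->
  `|f x1 a - f x2 a| <= L * `|x1 - x2| /\ `|l x1 a - l x2 a| <= L * `|x1 - x2|.
Hypothesis l_ge0 : forall x a, A a -> 0 <= l x a.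
Hypothesis l_cont : forall a, A a -> continuous (fun x => l x a).
Hypothesis rho_cont : forall a, A a -> continuous (fun x => rho x a).
Hypothesis D_open : open D.
Hypothesis U_cont : forall x, D x -> {for x, continuous U}.
Hypothesis U_sc : locally_semiconcave D U.
Hypothesis U_gt0 : forall x, D x -> 0 < U x.
Hypothesis decrease : forall x p, D x -> Dstar U x p ->
  exists2 a, A a & dotv p (f x a) + k * l x a < 0.
Hypothesis sigma_gt0 : 0 < sigma.
Hypothesis m_gt0 : forall s, 0 < s <= sigma -> 0 < m s.
Hypothesis m_incr : forall s t, 0 < s -> s <= t -> t <= sigma -> m s <= m t.
Hypothesis ghat_gt0 : forall s, 0 < s <= sigma -> 0 < ghat s.
Hypothesis rhohat_ge0 : forall s, 0 < s <= sigma -> 0 <= rhohat s.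
Hypothesis ratio_cont : forall u, 0 < u <= sigma -> forall e : R, 0 < e ->
  exists2 d : R, 0 < d & forall s, 0 < s <= sigma -> `|u - s| < d ->
    `|rhohat u / ghat u - rhohat s / ghat s| < e.
Hypothesis Psi_lower : forall u' u c, 0 < u' -> u' <= u -> u <= sigma ->
  (forall s, u' <= s <= u -> c <= rhohat s / ghat s + 1) ->
  2 * c * (u - u') <= Psi u - Psi u'.
Hypothesis feedbackP : forall z, D z -> U z <= sigma -> exists p a,
  [/\ Dstar U z p, A a, dotv p (f z a) + k * l z a + m (U z) <= 0,
      ghat (U z) <= k * l z a + m (U z) &
      forall x, D x -> U x <= U z -> rho x a <= rhohat (U z)].

Record step (tau : R) (z : 'rV[R]_n) (c : R * 'rV[R]_q * (R -> 'rV[R]_n)) : Prop := {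
  step_time : tau < c.1.1;
  step_control : A c.1.2;
  step_start : c.2 tau = z;
  step_cont : continuous c.2;
  step_solution : solution f (fun=> c.1.2) c.2 tau c.1.1;
  step_in : forall s, tau <= s <= c.1.1 -> D (c.2 s) /\ U (c.2 s) <= U z;
  step_cost : k * int_co (fun s => l (c.2 s) c.1.2) tau c.1.1 <= U z - U (c.2 c.1.1);
  step_rho : U z <= sigma ->
    int_co (fun s => rho (c.2 s) c.1.2) tau c.1.1 <= Psi (U z) - Psi (U (c.2 c.1.1)) }.

(** Both ratios are within 1/2 of the one at [U z0]. If [U z0] exceeds sigma, e is so small that no
    admissible u is near, and nothing is to be shown. *)
Lemma ratio_near z0 : D z0 -> exists2 e : R, 0 < e & forall u s : R,
  `|U z0 - u| < e -> `|U z0 - s| < e -> 0 < u <= sigma -> 0 < s <= sigma ->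
  rhohat u / ghat u <= rhohat s / ghat s + 1.
Proof.
move=> Dz0; have U0 := U_gt0 Dz0; have [Us|sU] := leP (U z0) sigma.
  have h0 : 0 < 2^-1 :> R by lra.
  have U0s : 0 < U z0 <= sigma by rewrite U0.
  have [e e0 He] := ratio_cont U0s h0; exists e => // u s ue se us ss.
  have := He u us ue; have := He s ss se; rewrite !ltr_norml.
  by move=> /andP[? ?] /andP[? ?]; lra.
exists (U z0 - sigma); first by rewrite subr_gt0.
by move=> u s; rewrite ltr_norml => /andP[? ?] _ /andP[? ?]; lra.
Qed.

(** The ball around z0 may meet levels on both sides of sigma, so the gain must be uniform over two
    kinds of control: those of A(z) at levels at most sigma, those of [uniform_decrease] above. *)
Lemma local_step z0 : D z0 -> exists r eta : R, [/\ 0 < r, 0 < eta &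
  forall z tau, `|z0 - z| < r -> D z /\
    exists2 c, step tau z c & eta <= U z - U (c.2 c.1.1)].
Proof.
move=> Dz0; have U0 := U_gt0 Dz0.
have f_lip (r : R) : exists2 L : R, 0 < L & forall x1 x2 a,
    `|x1| <= r -> `|x2| <= r -> A a -> `|f x1 a - f x2 a| <= L * `|x1 - x2|.
  have [L L0 HL] := fl_lip r.
  by exists L => // x1 x2 a h1 h2 Aa; have [] := HL x1 x2 a h1 h2 Aa.
have f_cont a : A a -> continuous (fun x => f x a).
  exact: (lip_continuous f_lip).
have [r1 [c1 [r10 c10 H1]]] :=
  uniform_decrease n_gt0 D_open U_cont U_sc f_cont l_cont decrease Dz0.
(* A common lower bound for U near z0; since m increases, m u1 bounds from below the rate m(U z)
   used at levels up to sigma. *)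
pose u1 := Num.min (U z0 / 2) sigma.
have u10 : 0 < u1 by rewrite lt_min divr_gt0.
have u1s : u1 <= sigma by rewrite ge_min lexx orbT.
have u1U : u1 <= U z0 / 2 by rewrite ge_min lexx.
have c20 : 0 < m u1 by apply: m_gt0; rewrite u10.
pose c := Num.min c1 (m u1).
have c0 : 0 < c by rewrite lt_min c10.
have [e1 e10 He1] := ratio_near Dz0.
pose e := Num.min e1 (U z0 / 2).
have e0 : 0 < e by rewrite lt_min e10 divr_gt0.
have ee1 : e <= e1 by rewrite ge_min lexx.
have eU : e <= U z0 / 2 by rewrite ge_min lexx orbT.
have [r2 [h [r20 h0 hM H2]]] :=
  step_estimate M_gt0 k_gt0 fl_lip l_ge0 l_cont D_open U_cont U_sc Dz0 c0 e0.
have [r3 r30 H3] := (continuous_dist U z0).1 (U_cont Dz0) _ e0.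
exists (Num.min r1 (Num.min r2 r3)), (h / 2 * c); split.
- by rewrite lt_min r10 lt_min r20.
- by rewrite mulr_gt0// divr_gt0.
move=> z tau; rewrite lt_min => /andP[zr1]; rewrite lt_min => /andP[zr2 zr3].
have Uz := H3 z zr3; have [Dz [p1 [a1 [p1z Aa1 neg1]]]] := H1 z zr1.
have Uz0 : u1 <= U z by move: Uz; rewrite ltr_norml => /andP[? ?]; lra.
split => //.
have [p [a [w [pz Aa cw neg wP]]]] : exists p a w, [/\ Dstar U z p, A a, c <= w,
    dotv p (f z a) + k * l z a + w <= 0 &
    U z <= sigma -> ghat (U z) <= k * l z a + w /\
      forall x, D x -> U x <= U z -> rho x a <= rhohat (U z)].
  have [Us|sU] := leP (U z) sigma.
    have [p [a [pz Aa neg gle rle]]] := feedbackP Dz Us.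
    exists p, a, (m (U z)); split => //.
    by rewrite (@le_trans _ _ (m u1)) ?m_incr// ge_min lexx orbT.
  by exists p1, a1, c1; split => //; rewrite ge_min lexx.
have [phi [phit cphi sol phir phiL]] := local_solution M_gt0 f_growth f_lip tau z Aa.
have est := H2 z p a w tau phi zr2 pz Aa cw neg phit cphi sol phiL.
have hh : 0 <= h <= h by rewrite lexx ltW.
have [_ gain cost Unear] := est h hh.
have kl0 : 0 <= k * l z a by rewrite mulr_ge0 ?(ltW k_gt0)// l_ge0.
have gain' : h / 2 * c <= U z - U (phi (tau + h)).
  have hw : h / 2 * c <= h / 2 * (k * l z a + w).
    by rewrite ler_wpM2l ?divr_ge0 ?(ltW h0)//; lra.
  by lra.
exists (tau + h, a, phi) => //; split => //=.
- by rewrite ltrDl.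
- by apply: sub_solution sol; rewrite lerD2l.
- move=> s /andP[ts sh]; have [|Ds Us _ _] := est (s - tau).
    by rewrite subr_ge0 ts lerBlDl.
  rewrite subrKC in Ds Us; split => //; rewrite (le_trans Us)// gerBl.
  by rewrite mulr_ge0 ?divr_ge0 ?subr_ge0//; lra.
- lra.
move=> Us; have [gle rle] := wP Us.
have Uzs : 0 < U z <= sigma by rewrite U_gt0.
have Dy : D (phi (tau + h)) by have [] := est h hh.
set y := phi (tau + h) in gain cost Unear gain' Dy *.
have hc0 : 0 < h / 2 * c by rewrite mulr_gt0// divr_gt0.
have Uy : U y <= U z by lra.
have g0 := ghat_gt0 Uzs; have r0 := rhohat_ge0 Uzs.
have rho_le : int_co (fun s => rho (phi s) a) tau (tau + h) <= rhohat (U z) * h.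
  have hE : h = tau + h - tau by rewrite addrAC subrr add0r.
  have th : tau <= tau + h by rewrite lerDl ltW.
  rewrite {2}hE -int_co_cst//; apply: int_co_le.
  - by apply: integrable_co_cont => //; exact: (continuous_along (@rho_cont a Aa)).
  - exact: integrable_co_cst.
  - move=> s /andP[ts st]; have [|Ds Us' _ _] := est (s - tau).
      by rewrite subr_ge0 ts lerBlDl ltW.
    rewrite subrKC in Ds Us'; apply: rle => //; rewrite (le_trans Us')// gerBl.
    by rewrite mulr_ge0 ?divr_ge0 ?subr_ge0//; lra.
(* The drop of U is at least half of h times [ghat (U z)], so the duration h is at most twice the
   drop divided by [ghat (U z)]. *)
apply: (le_trans rho_le); apply: (@le_trans _ _ (2 * (rhohat (U z) / ghat (U z)) * (U z - U y))).
  have -> : 2 * (rhohat (U z) / ghat (U z)) * (U z - U y) =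
    rhohat (U z) * (2 * (U z - U y) / ghat (U z)) by ring.
  rewrite ler_wpM2l// ler_pdivlMr//.
  have hg : h * ghat (U z) <= h * (k * l z a + w) by rewrite ler_wpM2l// ltW.
  by lra.
apply: Psi_lower => //; first exact: U_gt0.
move=> s /andP[ys sz]; apply: He1 => //.
- exact: lt_le_trans Uz ee1.
- move: Unear Uz; rewrite !ltr_norml => /andP[? ?] /andP[? ?].
  by apply/andP; split; lra.
- by rewrite (lt_le_trans (U_gt0 Dy) ys) (le_trans sz).
Qed.

End steps.

Section pieces_integral.
Context {R : realType}.
Variables (t : nat -> R) (G : R -> R) (g : nat -> R -> R).
Hypothesis t_lt : forall k, t k < t k.+1.
Hypothesis Gg : forall k s, t k <= s < t k.+1 -> G s = g k s.
Hypothesis g_cont : forall k, continuous (g k).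

Lemma pieces_integrable k : integrable_co G (t 0%N) (t k) /\
  int_co G (t 0%N) (t k) = \sum_(j < k) int_co (g j) (t j) (t j.+1).
Proof.
elim: k => [|k [iG eG]].
  by rewrite big_ord0; split; [exact: integrable_co_nn|exact: int_co_nn].
have Gk s : t k <= s < t k.+1 -> g k s = G s by move=> /Gg.
have ik : integrable_co G (t k) (t k.+1).
  by apply: (integrable_co_eq Gk); apply: integrable_co_cont => //; exact: ltW.
have t0k : t 0%N <= t k by exact: times_le.
have i' := integrable_co_cat t0k (ltW (t_lt k)) iG ik.
split=> //; rewrite (int_co_cat t0k (ltW (t_lt k)) i') eG big_ord_recr/=.
by congr (_ + _); apply: int_co_eq => s /Gg.
Qed.

(** The integrand is continuous on each piece, hence measurable on their union, and monotone
    convergence carries the bound on partial sums up to the possibly infinite end. *)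
Lemma pieces_integral_le C : (forall s, pieces_dom t s -> 0 <= G s) ->
  (forall k, \sum_(j < k) int_co (g j) (t j) (t j.+1) <= C) ->
  (\int[leb]_(s in pieces_dom t) (G s)%:E <= C%:E)%E.
Proof.
move=> G0 sumC; pose F k : set R := `[t 0%N, t k[%classic.
have domF : pieces_dom t = \bigcup_k F k.
  apply/seteqP; split => s /=.
    by move=> [ts [k sk]]; exists k => //; rewrite /F /= in_itv/= ts.
  by move=> [k _]; rewrite /F /= in_itv/= => /andP[ts sk]; split => //; exists k.
have mG : measurable_fun (pieces_dom t : set (lebesgue_type R)) (EFin \o G).
  by apply/measurable_EFinP; exact: (measurable_pieces t_lt Gg).
have nd : nondecreasing_seq (F : nat -> set (lebesgue_type R)).
  move=> i j ij; apply/subsetPset => s; rewrite /F /= !in_itv/= => /andP[-> si].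
  exact: lt_le_trans si (times_le t_lt ij).
have mF k : measurable (F k : set (lebesgue_type R)) by exact: leb_itv_measurable.
have mD : measurable (pieces_dom t : set (lebesgue_type R)).
  by rewrite domF; apply: bigcup_measurable => k _; exact: mF.
have FD k : F k `<=` pieces_dom t by rewrite domF => s Fs; exists k.
have cv := @ge0_nondecreasing_set_cvg_integral _ (lebesgue_type R) R F (EFin \o G) leb nd mF.
rewrite [X in integral _ X _]domF.
have {}cv := cv (fun k => measurable_funS mD (FD k) mG) (fun k s Fs => G0 s (FD k s Fs)).
rewrite -(cvg_lim _ cv)//; apply: lime_le; first by apply/cvg_ex; eexists; exact: cv.
apply: nearW => k /=; have [ik ek] := pieces_integrable k.
by rewrite (integral_coE ik) ek lee_fin.
Qed.

End pieces_integral.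

(** * Infinite sequences of greedy steps *)

Section runs.
Context {R : realType} {n q : nat}.
Variables (A : set 'rV[R]_q).
Variables (f : 'rV[R]_n -> 'rV[R]_q -> 'rV[R]_n) (l rho : 'rV[R]_n -> 'rV[R]_q -> R).
Variables (M k : R) (D : set 'rV[R]_n) (U : 'rV[R]_n -> R) (sigma : R) (Psi : R -> R).
Hypothesis M_gt0 : 0 < M.
Hypothesis k_gt0 : 0 < k.
Hypothesis f_growth : forall x a, A a -> `|f x a| <= M * (1 + `|x|).
Hypothesis f_lip : forall r : R, exists2 L : R, 0 < L & forall x1 x2 a,
  `|x1| <= r -> `|x2| <= r -> A a -> `|f x1 a - f x2 a| <= L * `|x1 - x2|.
Hypothesis l_ge0 : forall x a, A a -> 0 <= l x a.
Hypothesis rho_ge0 : forall x a, A a -> 0 <= rho x a.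
Hypothesis l_cont : forall a, A a -> continuous (fun x => l x a).
Hypothesis rho_cont : forall a, A a -> continuous (fun x => rho x a).
Hypothesis U_gt0 : forall x, D x -> 0 < U x.
Hypothesis sigma_gt0 : 0 < sigma.
Hypothesis Psi_ge0 : forall s, 0 < s <= sigma -> 0 <= Psi s.
Hypothesis annulus_compact : forall s1 s2, 0 < s1 -> compact [set x | D x /\ s1 <= U x <= s2].
Hypothesis sublevel_bounded : forall s, exists B : R, forall x, D x -> U x <= s -> `|x| <= B.
Local Notation step := (step A f l rho k D U sigma Psi).
Hypothesis local_stepP : forall z0, D z0 -> exists r eta : R, [/\ 0 < r, 0 < eta &
  forall z tau, `|z0 - z| < r -> D z /\
    exists2 c, step tau z c & eta <= U z - U (c.2 c.1.1)].

Let gain z (c : R * 'rV[R]_q * (R -> 'rV[R]_n)) := U z - U (c.2 c.1.1).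

Lemma step_end tau z c : step tau z c -> D (c.2 c.1.1).
Proof.
move=> st; have cc : tau <= c.1.1 <= c.1.1 by rewrite lexx ltW// (step_time st).
by have [] := step_in st cc.
Qed.

(* The greedy choice keeps the steps from stalling at a positive level: near a limit
   point some step with a definite gain is available. *)
Lemma greedy_step tau z : D z -> exists2 c, step tau z c &
  forall c', step tau z c' -> gain z c' <= 2 * gain z c.
Proof.
move=> Dz; have [r [eta [r0 eta0 H]]] := local_stepP Dz.
have [|_ [c0 st0 g0]] := H z tau; first by rewrite subrr normr0.
pose E := [set g | exists2 c, step tau z c & g = gain z c].
have ub : has_ubound E.
  exists (U z) => _ [c st ->]; rewrite /gain gerBl.
  exact/ltW/U_gt0/(step_end st).
have hs : has_sup E by split=> //; exists (gain z c0); exists c0.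
have supE : eta <= sup E by apply: le_trans g0 _; apply: ub_le_sup => //; exists c0.
have [|_ [c st ->] gc] := @sup_gt _ E (sup E / 2) hs.1; first by lra.
exists c => // c' st'.
have : gain z c' <= sup E by apply: ub_le_sup => //; exists c'.
by lra.
Qed.

Lemma greedy_run tau z : D z ->
  exists (t : nat -> R) (a : nat -> 'rV[R]_q) (phi : nat -> R -> 'rV[R]_n),
  [/\ t 0%N = tau, phi 0%N tau = z, forall j, D (phi j (t j)),
      forall j, step (t j) (phi j (t j)) (t j.+1, a j, phi j) /\
        phi j (t j.+1) = phi j.+1 (t j.+1) &
      forall s, 0 < s -> exists j, U (phi j (t j)) < s].
Proof.
move=> Dz; pose nx tau' (z' : {x | D x}) := cid2 (greedy_step tau' (svalP z')).
(* A state carries the proof that its point lies in D, so that the greedy choice can be iterated. *)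
pose next (st : R * {x | D x}) : R * {x | D x} :=
  let c := nx st.1 st.2 in ((s2val c).1.1, exist D _ (step_end (s2valP c))).
pose st j := iter j next (tau, exist D z Dz).
pose cc j := s2val (nx (st j).1 (st j).2).
have ccP j : step (st j).1 (sval (st j).2) (cc j) := s2valP (nx (st j).1 (st j).2).
have ccG j c' : step (st j).1 (sval (st j).2) c' ->
    gain (sval (st j).2) c' <= 2 * gain (sval (st j).2) (cc j).
  exact: (s2valP' (nx (st j).1 (st j).2)).
have stS1 j : (st j.+1).1 = (cc j).1.1 by [].
have stS2 j : sval (st j.+1).2 = (cc j).2 (cc j).1.1 by [].
have start j : (cc j).2 (st j).1 = sval (st j).2 by exact: step_start (ccP j).
exists (fun j => (st j).1), (fun j => (cc j).1.2), (fun j => (cc j).2); split => //.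
- by move=> j; rewrite start; exact: svalP.
- move=> j; rewrite start; split; last by rewrite start stS1.
  by rewrite stS1; have := ccP j; case: (cc j) => -[].
move=> s s0; apply: contrapT => nlt.
pose zz j := sval (st j).2.
have Dzz j : D (zz j) by exact: svalP.
have sU j : s <= U (zz j).
  by rewrite leNgt; apply/negP => lt; apply: nlt; exists j; rewrite start.
have UzS j : U (zz j.+1) = U (zz j) - gain (zz j) (cc j).
  by rewrite /gain /zz -stS2; ring.
have Umono j : U (zz j.+1) <= U (zz j).
  rewrite /zz stS2; have cc1 : (st j).1 <= (cc j).1.1 <= (cc j).1.1.
    by rewrite lexx ltW// (step_time (ccP j)).
  by have [] := step_in (ccP j) cc1.
have Udec i j : (i <= j)%N -> U (zz j) <= U (zz i).
  move=> ij; apply: (homo_leq (f := fun j => U (zz j)) (r := fun x y => y <= x)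
    (@le_refl _ R) (fun y x z a b => le_trans b a) Umono ij).
have U0 j : U (zz j) <= U z by exact: (Udec 0%N).
have Kj j : [set x | D x /\ s <= U x <= U z] (zz j) by rewrite /= sU U0.
have [z0 [Dz0 _] cl] := compact_cvg_cluster (annulus_compact s0) Kj.
have [r [eta [r0 eta0 H]]] := local_stepP Dz0.
have lbU : has_inf (range (fun j => U (zz j))).
  by split; [exists (U (zz 0%N)); exists 0%N|exists s => _ [j _ <-]].
have e2 : 0 < eta / 2 by lra.
(* After index N less than eta/2 of U is left to lose, whereas a greedy step from a point near z0
   loses at least eta/2. *)
have [_ [N _ <-] hN] := inf_adherent e2 lbU.
have [j Nj zj] := cl r r0 N.
have [_ [c' stc' gc']] := H (zz j) (st j).1 zj.
have := ccG j c' stc'; rewrite -/(zz j) => g2.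
have : inf (range (fun j => U (zz j))) <= U (zz j.+1).
  by apply: ge_inf; [case: lbU|exists j.+1].
have := Udec N j Nj; rewrite UzS; move: g2 gc'; rewrite /gain; lra.
Qed.

Lemma run_process tau z : D z -> exists c (theta : \bar R) (C : R),
  [/\ process_from A f tau z c /\ (tau%:E < theta)%E,
      (forall s, tau <= s -> (s%:E < theta)%E -> D (c.2 s)) /\
      (forall s t : R, 0 < s -> (t%:E < theta)%E ->
        exists t', [/\ t < t', tau <= t', (t'%:E < theta)%E &
         U (c.2 t') < s]),
      forall s t, tau <= s -> s <= t -> (t%:E <= theta)%E -> `|c.2 t - c.2 s| <= C * (t - s),
      (\int[leb]_(s in [set s : R | (tau <= s)%R /\ s%:E < theta]) (l (c.2 s) (c.1 s))%:E <= (k^-1 * U z)%:E)%E &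
      (\int[leb]_(s in [set s : R | (tau <= s)%R /\ s%:E < theta]) (rho (c.2 s) (c.1 s))%:E < +oo)%E].
Proof.
move=> Dz; have [t [a [phi [t0 phi0 Dphi stP Usmall]]]] := greedy_run tau Dz.
have st j : step (t j) (phi j (t j)) (t j.+1, a j, phi j) by case: (stP j).
have link j : phi j (t j.+1) = phi j.+1 (t j.+1) by case: (stP j).
have t_lt j : t j < t j.+1 := step_time (st j).
have Aa j : A (a j) := step_control (st j).
have cphi j : continuous (phi j) := step_cont (st j).
have inD j s : t j <= s <= t j.+1 -> D (phi j s) /\ U (phi j s) <= U (phi j (t j)).
  by move=> ?; exact: (step_in (st j)).
have cc_end j : t j <= t j.+1 <= t j.+1 by rewrite lexx ltW.
have cc_start j : t j <= t j <= t j.+1 by rewrite lexx ltW.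
have UzS j : U (phi j.+1 (t j.+1)) <= U (phi j (t j)).
  by rewrite -link; have [] := inD j _ (cc_end j).
have Udec i j : (i <= j)%N -> U (phi j (t j)) <= U (phi i (t i)).
  move=> ij; apply: (homo_leq (f := fun j => U (phi j (t j))) (r := fun x y => y <= x)
    (@le_refl _ R) (fun y x z a b => le_trans b a) UzS ij).
have U0 j : U (phi j (t j)) <= U z by rewrite -phi0 -t0; exact: (Udec 0%N).
have [B BP] := sublevel_bounded (U z).
(* The whole run stays in a sublevel of U, which is bounded, so one constant bounds its speed. *)
pose C := M * (1 + B).
have fC j s : t j <= s <= t j.+1 -> `|f (phi j s) (a j)| <= C.
  move=> js; have [Ds Us] := inD j s js.
  rewrite (le_trans (f_growth _ (Aa j)))// ler_pM2l// lerD2l BP//.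
  exact: le_trans Us (U0 j).
have C0 : 0 <= C by apply: le_trans (fC 0%N _ (cc_start 0%N)).
have [c [cP c2P c1P]] := sampled_process M_gt0 f_growth f_lip t_lt Aa cphi
  (fun j => step_solution (st j)) link fC.
rewrite t0 phi0 in cP.
pose theta := ereal_sup (range (EFin \o t)).
have thetaP s : (s%:E < theta)%E <-> exists j, s < t j.
  split=> [/ereal_sup_gt[_ [j _ <-]]|[j sj]]; first by rewrite lte_fin; exists j.
  apply: (@lt_le_trans _ _ (t j)%:E); first by rewrite lte_fin.
  by apply: ereal_sup_ubound; exists j.
have domE : [set s : R | tau <= s /\ (s%:E < theta)%E] = pieces_dom t.
  apply/seteqP; split => s /= [ts h]; split; rewrite ?t0//.
  - exact/thetaP.
  - by rewrite -t0.
  - exact/thetaP.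
have pieceP s : tau <= s -> (s%:E < theta)%E -> exists j, t j <= s < t j.+1.
  by move=> ts sth; apply: (piece_ex (t := t)); rewrite -domE.
have ltW' j s : t j <= s < t j.+1 -> t j <= s <= t j.+1.
  by move=> /andP[-> /ltW].
have eqG (h : 'rV[R]_n -> 'rV[R]_q -> R) j s : t j <= s < t j.+1 ->
    h (c.2 s) (c.1 s) = h (phi j s) (a j).
  by move=> js; rewrite (c2P j s (ltW' j s js)) (c1P j s js).
exists c, theta, C; split.
- by split=> //; apply/thetaP; exists 1%N; rewrite -t0.
- split=> [s ts sth|s s1 s0 /thetaP[i ti]].
    have [j js] := pieceP s ts sth; rewrite (c2P j s (ltW' j s js)).
    by have [] := inD j s (ltW' j s js).
  have [j Uj] := Usmall s s0; pose i' := maxn i.+1 j.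
  exists (t i'); split.
  + by rewrite (lt_le_trans ti)// times_le// /i' (leq_trans (leqnSn i))// leq_maxl.
  + by rewrite -t0 times_le.
  + by apply/thetaP; exists i'.+1.
  + rewrite (c2P i' _ (cc_start i')).
    by rewrite (le_lt_trans (Udec j i' _))// leq_maxr.
- move=> s s1 ts ss s1th; have sol := process_solution cP (le_trans ts ss).
  apply: (solution_lip C0 _ sol) => // u /andP[tu us].
  have us' : (u%:E < s1%:E)%E by rewrite lte_fin.
  have [j ju] := pieceP u tu (lt_le_trans us' s1th).
  by rewrite (c2P j u (ltW' j u ju)) (c1P j u ju) fC// ltW'.
- rewrite domE; apply: (pieces_integral_le t_lt (eqG l)).
  + by move=> j; exact: (continuous_along (@l_cont _ (Aa j)) (cphi j)).
  + by move=> s [ts _]; apply: l_ge0; apply: (process_control cP); rewrite -t0.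
  move=> N; rewrite -(ler_pM2l k_gt0) mulVKf ?gt_eqF//.
  apply: (@le_trans _ _ (U z - U (phi N (t N)))); last first.
    by rewrite gerBl; apply/ltW/U_gt0.
  elim: N => [|N IH]; first by rewrite big_ord0 mulr0 t0 phi0 subrr.
  rewrite big_ord_recr/= mulrDr; have := step_cost (st N); rewrite /= link.
  by move: IH; lra.
(* The first J steps contribute a finite sum; from J on the level is below sigma and the integrals
   telescope in Psi. *)
rewrite domE; have [J UJ] := Usmall sigma sigma_gt0.
pose I_ j := int_co (fun s => rho (phi j s) (a j)) (t j) (t j.+1).
have I0 j : 0 <= I_ j.
  by apply: int_co_ge0 => s _; exact: rho_ge0.
apply: (@le_lt_trans _ _ (\sum_(j < J) I_ j + Psi (U (phi J (t J))))%:E); last exact: ltry.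
apply: (pieces_integral_le t_lt (eqG rho)).
- by move=> j; exact: (continuous_along (@rho_cont _ (Aa j)) (cphi j)).
- by move=> s [ts _]; apply: rho_ge0; apply: (process_control cP); rewrite -t0.
have Psi0 j : (J <= j)%N -> 0 <= Psi (U (phi j (t j))).
  by move=> Jj; apply: Psi_ge0; rewrite U_gt0//= (le_trans (Udec J j Jj))// ltW.
have tail i : \sum_(j < J + i) I_ j <=
    \sum_(j < J) I_ j + Psi (U (phi J (t J))) - Psi (U (phi (J + i)%N (t (J + i)%N))).
  elim: i => [|i IH]; first by rewrite addn0 addrK.
  rewrite addnS big_ord_recr/=.
  have := step_rho (st (J + i)%N); rewrite -/(I_ (J + i)%N) /= link.
  have UJi : U (phi (J + i)%N (t (J + i)%N)) <= sigma.
    by rewrite (le_trans (Udec J _ (leq_addr _ _)))// ltW.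
  by move=> /(_ UJi); move: IH; rewrite /I_; lra.
move=> N; have [NJ|/ltnW JN] := leqP N J; last first.
  have := tail (N - J)%N; rewrite subnKC// => /le_trans; apply.
  by rewrite gerBl Psi0.
rewrite -[leLHS]addr0 lerD ?Psi0//.
rewrite -(big_mkord xpredT (fun j => I_ j)) -(big_mkord xpredT (fun j => I_ j)).
by rewrite [leRHS](big_cat_nat (n := N))//= lerDl sumr_ge0.
Qed.

End runs.

Section running_costs.
Context {R : realType} {n q : nat}.
Variables (A : set 'rV[R]_q).
Hypothesis A_cpt : compact A.

Lemma within_prod_continuous_dist (W : normedModType R) (h : 'rV[R]_n -> 'rV[R]_q -> W) :
  {within setT `*` A, continuous (uncurry h)} -> forall x a, A a -> forall e : R, 0 < e ->
  exists2 d : R, 0 < d & forall y b, A b -> `|x - y| < d -> `|a - b| < d ->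
    `|h x a - h y b| < e.
Proof.
move=> ch x a Aa e e0.
have [d d0 H] := within_continuous_dist ch (conj Logic.I Aa : (setT `*` A) (x, a)) e0.
exists d => // y b Ab xy ab; apply: (H (y, b)); first by split.
by rewrite [X in X < _](prod_normE (x - y, a - b)) gt_max xy.
Qed.

Lemma running_cost_continuous (h : 'rV[R]_n -> 'rV[R]_q -> R) a : running_cost A h ->
  A a -> continuous (fun x => h x a).
Proof.
move=> [_ ch] Aa x; apply/continuous_dist => e e0.
have [d d0 H] := within_prod_continuous_dist ch x Aa e0.
by exists d => // y xy; apply: H => //; rewrite subrr normr0.
Qed.

Lemma within_snd_continuous (h : 'rV[R]_n -> 'rV[R]_q -> R) x :
  (forall a, A a -> forall e : R, 0 < e -> exists2 d : R, 0 < d &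
    forall b, A b -> `|a - b| < d -> `|h x a - h x b| < e) ->
  {within A, continuous (h x)}.
Proof.
move=> H; apply/subspace_continuousP => a Aa P /nbhs_dist[e e0 eP].
have [d d0 dP] := H a Aa e e0; apply/within_dist; exists d => // b ab Ab.
by apply: eP; exact: dP.
Qed.

Lemma running_cost_bounded (h : 'rV[R]_n -> 'rV[R]_q -> R) (Y : R) : running_cost A h ->
  exists2 C : R, 0 <= C & forall x a, `|x| <= Y -> A a -> h x a <= C.
Proof.
move=> [h0 ch].
pose K : set ('rV[R]_n * 'rV[R]_q) := [set x | `|0 - x| <= Y] `*` A.
have cK : compact K by apply: compact_setX => //; exact: cball_compact.
have KS : K `<=` setT `*` A by move=> [x a] [_ Aa].
have [[[x0 a0] [/= x0Y Aa0]]|K0] := pselect (K !=set0); last first.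
  exists 0 => // x a xY Aa; case: K0; exists (x, a); split => //=.
  by rewrite sub0r normrN.
have [|c Kc cmax] := compact_EVT_max _ cK (continuous_subspaceW KS ch).
  by exists (x0, a0).
exists (uncurry h c).
  by case: c Kc {cmax} => x1 a1; rewrite inE => -[_ /=]; exact: h0.
move=> x a xY Aa; apply: (cmax (x, a)); rewrite inE; split => //=.
by rewrite sub0r normrN.
Qed.

End running_costs.

(** * The potential that bounds the rho-integral *)

Section resource_potential.
Context {R : realType}.
Variables (sigma : R) (g r : R -> R).
Hypothesis sigma_gt0 : 0 < sigma.
Hypothesis g_cont : {within `]0, sigma], continuous g}.
Hypothesis r_cont : {within `]0, sigma], continuous r}.
Hypothesis g_gt0 : forall s, 0 < s <= sigma -> 0 < g s.
Hypothesis r_ge0 : forall s, 0 < s <= sigma -> 0 <= r s.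

Let H s := r s / g s.

Lemma ratio_continuous u : 0 < u <= sigma -> forall e : R, 0 < e ->
  exists2 d : R, 0 < d & forall s, 0 < s <= sigma -> `|u - s| < d ->
    `|r u / g u - r s / g s| < e.
Proof.
move=> us e e0.
have uin : `]0, sigma]%classic u by rewrite /= in_itv.
have cg : g x @[x --> within `]0, sigma]%classic (nbhs u)] --> g u.
  by move/subspace_continuousP : g_cont; apply.
have cr : r x @[x --> within `]0, sigma]%classic (nbhs u)] --> r u.
  by move/subspace_continuousP : r_cont; apply.
have g0 : g u != 0 by rewrite gt_eqF// g_gt0.
have cH : r x / g x @[x --> within `]0, sigma]%classic (nbhs u)] --> r u / g u.
  by apply: cvgM => //; apply: cvgV.
have : nbhs (r u / g u) [set w | `|r u / g u - w| < e] by apply/nbhs_dist; exists e.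
move=> /cH /within_dist[d d0 dP]; exists d => // s ss us'.
by apply: dP => //; rewrite /= in_itv.
Qed.

Hypothesis H_int : (\int[leb]_(s in `]0%R, sigma]) (r s / g s)%:E < +oo)%E.

Let H_cont : {within `]0, sigma], continuous H}.
Proof.
apply/subspace_continuousP => u; rewrite /= in_itv/= => us P /nbhs_dist[e e0 eP].
have [d d0 dP] := ratio_continuous us e0; apply/within_dist; exists d => // s us'.
by rewrite /= in_itv/= => ss; apply: eP; exact: dP.
Qed.

Let H_integrable : leb.-integrable (`]0, sigma]%classic : set R) (EFin \o H).
Proof.
have mH : measurable_fun (`]0, sigma]%classic : set (lebesgue_type R)) (H : _ -> R).
  apply: leb_measurable_fun; first exact: measurable_itv.
  apply: subspace_continuous_measurable_fun => //; exact: measurable_itv.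
apply/integrableP; split; first exact/measurable_EFinP.
apply: le_lt_trans H_int; apply: le_integral_restrict.
- by move=> x _; exact: abse_ge0.
- move=> x xs; split => //=; rewrite /= in_itv/= in xs.
  by rewrite ger0_norm// divr_ge0 ?r_ge0 ?(ltW (g_gt0 _)).
- by move=> x; rewrite /= in_itv/= => xs; rewrite lee_fin divr_ge0 ?r_ge0 ?(ltW (g_gt0 _)).
Qed.

(** The factor 2 matches the halved decrease along an arc; the summand u has slope 1 and pays for
    replacing the ratio at the current level by the ratio at the start of the step. *)
Definition potential u : R := 2 * (\int[leb]_(s in `]0, u]) (r s / g s) + u).

Lemma potential_ge0 u : 0 < u <= sigma -> 0 <= potential u.
Proof.
move=> /andP[u0 us]; rewrite mulr_ge0// addr_ge0 ?(ltW u0)//.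
apply: Rintegral_ge0 => s /=; rewrite in_itv/= => /andP[s0 su].
have ss : 0 < s <= sigma by rewrite s0 (le_trans su).
by rewrite divr_ge0 ?r_ge0 ?(ltW (g_gt0 _)).
Qed.

(** The integral of r/g over ]u', u] is at least (c - 1)(u - u'), and the linear summand restores
    the missing u - u'. *)
Lemma potential_lower u' u c : 0 < u' -> u' <= u -> u <= sigma ->
  (forall s, u' <= s <= u -> c <= r s / g s + 1) ->
  2 * c * (u - u') <= potential u - potential u'.
Proof.
move=> u'0 uu us cH.
have arith X1 X2 : (c - 1) * (u - u') <= X2 ->
  2 * c * (u - u') <= 2 * (X1 + X2 + u) - 2 * (X1 + u') by lra.
have E : `]0, u]%classic = `]0, u']%classic `|` `]u', u]%classic :> set R.
  by apply: itv_bndbnd_setU; rewrite bnd_simp ?(ltW u'0).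
have mI (i : interval R) := @leb_itv_measurable R i.
have iu : leb.-integrable (`]0, u]%classic : set R) (EFin \o H).
  apply: integrableS H_integrable => //.
  by apply: subset_itvl; rewrite bnd_simp.
have iu' : leb.-integrable (`]u', u]%classic : set R) (EFin \o H).
  apply: integrableS iu => //; apply: subset_itvr; rewrite bnd_simp; exact: ltW.
have split_ : \int[leb]_(s in `]0, u]) H s =
    \int[leb]_(s in `]0, u']) H s + \int[leb]_(s in `]u', u]) H s.
  rewrite E; apply: Rintegral_setU => //; first by rewrite -E.
  apply/disj_setPS => s [/=]; rewrite !in_itv/= => /andP[_ sb] /andP[+ _].
  by rewrite ltNge sb.
have low : (c - 1) * (u - u') <= \int[leb]_(s in `]u', u]) H s.
  have muE : leb (`]u', u]%classic : set R) = (u - u')%:E.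
    rewrite lebE lebesgue_measure_itv/= lte_fin.
    move: uu; rewrite le_eqVlt => /predU1P[->|->]; last by rewrite EFinB.
    by rewrite ltxx subrr.
  have -> : (c - 1) * (u - u') = \int[leb]_(s in (`]u', u]%classic : set R)) (c - 1).
    by rewrite Rintegral_cst//; have /= -> := muE.
  apply: le_Rintegral => //.
    apply: measurable_bounded_integrable => //.
    - by have /= -> := muE; rewrite ltry.
    - exact: bounded_cst.
  move=> s /=; rewrite in_itv/= => /andP[s1 s2].
  by rewrite lerBlDr; apply: cH; rewrite s2 ltW.
rewrite /potential [X in 2 * (X + u)]split_; apply: arith low.
Qed.

End resource_potential.

(** * Restraint functions near the target *)

Section restraint_function.
Context {R : realType} {n q : nat}.
Variables (A : set 'rV[R]_q) (T : set 'rV[R]_n).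
Variables (f : 'rV[R]_n -> 'rV[R]_q -> 'rV[R]_n) (l : 'rV[R]_n -> 'rV[R]_q -> R).
Variables (Omega : set 'rV[R]_n) (U : 'rV[R]_n -> R) (U0 : \bar R) (k : R).
Hypothesis hyps : standing_hypotheses A T f l.
Hypothesis mrf : local_MRF A T f l Omega U U0 k.

Let D := Omega `\` T.
Let E := Omega `\` T°.

Lemma target_compl_open : open D.
Proof.
by apply: openI; [exact: (Omega_open mrf)|apply: closed_openC; exact: (T_closed hyps)].
Qed.

Lemma target_compl_sub : D `<=` E.
Proof. by move=> x [Ox Tx]; split => // /interior_subset. Qed.

Lemma domain_cases x : E x -> T x \/ D x.
Proof. by move=> [Ox _]; case: (pselect (T x)); [left|right]. Qed.

Lemma U_target_eq0 x : E x -> T x -> U x = 0.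
Proof.
by move=> [Ox nTx] Tx; apply: (U_eq0 mrf); split => //; exact: subset_closure.
Qed.

Lemma U_within_continuous x : E x -> forall e : R, 0 < e ->
  exists2 d : R, 0 < d & forall y, E y -> `|x - y| < d -> `|U x - U y| < e.
Proof. exact: within_continuous_dist (U_cont mrf) x. Qed.

Lemma U_continuous_at x : D x -> {for x, continuous U}.
Proof.
move=> Dx; apply/continuous_dist => e e0.
have [d1 d10 H1] := U_within_continuous (target_compl_sub Dx) e0.
have /nbhs_dist[d2 d20 H2] := open_nbhs_nbhs (conj target_compl_open Dx).
exists (Num.min d1 d2); first by rewrite lt_min d10.
by move=> y; rewrite lt_min => /andP[y1 y2]; apply: H1 => //; exact/target_compl_sub/H2.
Qed.

Lemma level_cc_compact s1 s2 : 0 <= s1 -> compact [set x | E x /\ s1 <= U x <= s2].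
Proof.
move=> s10; have sub : `[s1, s2]%classic `<=` [set s : R | 0 <= s].
  by move=> s /=; rewrite in_itv/= => /andP[+ _]; exact: le_trans.
have := U_proper mrf (@segment_compact R s1 s2) sub.
rewrite (_ : _ `&` _ = [set x | E x /\ s1 <= U x <= s2])//.
Qed.

(** Since U vanishes on the part of T in its domain, positive levels avoid T, and properness
    applies. *)
Lemma annulus_compactP s1 s2 : 0 < s1 -> compact [set x | D x /\ s1 <= U x <= s2].
Proof.
move=> s10; rewrite (_ : mkset _ = [set x | E x /\ s1 <= U x <= s2]).
  by apply: level_cc_compact; exact: ltW.
apply/seteqP; split => x /= [Ex sU]; split => //; first exact: target_compl_sub.
have [Tx|//] := domain_cases Ex; case/andP: sU => + _.
by rewrite (U_target_eq0 Ex Tx) leNgt s10.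
Qed.

Lemma sublevel_boundedP s : exists B : R, forall x, D x -> U x <= s -> `|x| <= B.
Proof.
have [B [_ HB]] := compact_bounded (@level_cc_compact 0 s (lexx _)).
exists (B + 1) => x Dx Us; apply: (HB (B + 1)); first by rewrite ltrDl.
by split; [exact: target_compl_sub|rewrite Us (U_ge0 mrf)//; exact: target_compl_sub].
Qed.

Lemma level_closed s : closed [set x | E x /\ 0 <= U x <= s].
Proof. by apply: compact_closed; [exact: norm_hausdorff|exact: level_cc_compact]. Qed.

(** Points with U tending to 0 and far from T would cluster, in the compact sublevel U <= 1, at a
    zero of U outside T. The result turns U -> 0 along a run into distance -> 0. *)
Lemma small_U_near_T e : 0 < e -> exists2 s : R, 0 < s & forall x, D x -> U x < s ->
  exists2 w, T w & `|x - w| < e.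
Proof.
move=> e0; apply: contrapT => H.
have [dl [dl0 dl1 dlN]] := @null_seq R.
have ex (i : nat) : exists x, [/\ D x, U x < dl i & forall w, T w -> e <= `|x - w|].
  apply: contrapT => Hi; apply: H; exists (dl i) => //.
  move=> x Dx Ux; apply: contrapT => Hx; apply: Hi; exists x; split => // w Tw.
  by rewrite leNgt; apply/negP => xw; apply: Hx; exists w.
pose x i := sval (cid (ex i)).
have xP i : [/\ D (x i), U (x i) < dl i & forall w, T w -> e <= `|x i - w|].
  by exact: (svalP (cid (ex i))).
have Kx i : [set y | E y /\ 0 <= U y <= 1] (x i).
  have [Di Ui _] := xP i; have Ei := target_compl_sub Di; split => //.
  by rewrite (U_ge0 mrf Ei)/= (le_trans (ltW Ui)).
have [p [Ep Up] cl] := compact_cvg_cluster (@level_cc_compact 0 1 (lexx _)) Kx.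
have Up0 : U p <= 0.
  apply/ler_addgt0Pr => e' e'0; rewrite add0r; have e2 : 0 < e' / 2 by lra.
  have [d d0 Hd] := U_within_continuous Ep e2; have [N HN] := dlN _ e2.
  have [j Nj pj] := cl d d0 N; have [Dj Uj _] := xP j.
  have := Hd _ (target_compl_sub Dj) pj; have := HN j Nj; rewrite ltr_norml => ? /andP[? ?].
  by lra.
have Tp : T p.
  have [//|Dp] := domain_cases Ep.
  by have := U_gt0 mrf Dp; rewrite ltNge Up0.
have [j _ pj] := cl e e0 0%N; have [_ _ far] := xP j.
by have := far p Tp; rewrite distrC leNgt pj.
Qed.

(** T itself may be unbounded and only its boundary is compact; the first point of T on the segment
    from z to w moves the comparison to the boundary. *)
Lemma segment_boundary z w : ~ T z -> T w -> exists2 b, boundary T b & `|z - b| <= `|z - w|.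
Proof.
move=> Tz Tw; pose pt (s : R) := z + s *: (w - z).
pose S := [set s | 0 <= s <= 1 /\ T (pt s)].
have S1 : S 1 by split; [rewrite ler01 lexx|rewrite /pt scale1r subrKC].
have hi : has_inf S by split; [exists 1|exists 0 => s [/andP[]]].
pose s0 := inf S.
have s0ge : 0 <= s0 by apply: lb_le_inf; [exists 1|move=> s [/andP[]]].
have s0le : s0 <= 1 by apply: ge_inf => //; case: hi.
have ptd s t : `|pt s - pt t| = `|s - t| * `|w - z|.
  by rewrite /pt opprD addrACA subrr add0r -scalerBl normrZ.
have wz0 : 0 < `|w - z| + 1 by rewrite ltr_wpDl.
have Tb : T (pt s0).
  rewrite (closure_id T).1; last exact: (T_closed hyps).
  move=> P /nbhs_dist[d d0 dP].
  have dw : 0 < d / (`|w - z| + 1) by rewrite divr_gt0.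
  have [s [s01 Ts] sd] := inf_adherent dw hi.
  have ss : s0 <= s by apply: ge_inf; [case: hi|].
  exists (pt s); split => //; apply: dP; rewrite ptd distrC ger0_norm ?subr_ge0//.
  have : s - s0 < d / (`|w - z| + 1) by rewrite /s0; lra.
  rewrite ltr_pdivlMr// => h; apply: le_lt_trans h.
  by rewrite ler_wpM2l ?subr_ge0// lerDl.
have s0pos : 0 < s0.
  rewrite lt_neqAle s0ge andbT; apply/eqP => s00; apply: Tz.
  by move: Tb; rewrite -s00 /pt scale0r addr0.
exists (pt s0).
  split; first exact: subset_closure.
  move=> /nbhs_dist[d d0 dT].
  (* If [pt s0] were interior, a slightly smaller parameter would still give a point of T; the
     maximum with 0 keeps it on the segment. *)
  pose s := Num.max 0 (s0 - d / (`|w - z| + 1) / 2).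
  have dw : 0 < d / (`|w - z| + 1) by rewrite divr_gt0.
  have s_lt : s < s0 by rewrite gt_max s0pos; lra.
  have s_ge : 0 <= s by rewrite le_max lexx.
  have s_near : s0 - d / (`|w - z| + 1) / 2 <= s by rewrite le_max lexx orbT.
  have Ts : T (pt s).
    apply: dT; rewrite ptd ger0_norm ?subr_ge0 ?(ltW s_lt)//.
    have : s0 - s < d / (`|w - z| + 1) by lra.
    rewrite ltr_pdivlMr// => h; apply: le_lt_trans h.
    by rewrite ler_wpM2l ?subr_ge0 ?(ltW s_lt)// lerDl.
  have : s0 <= s.
    by apply: ge_inf; [case: hi|split => //; rewrite s_ge (le_trans (ltW s_lt))].
  by rewrite leNgt s_lt.
have -> : z - pt s0 = - (s0 *: (w - z)) by rewrite /pt opprD addrA subrr sub0r.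
by rewrite normrN normrZ ger0_norm// (distrC z w) ler_piMl.
Qed.

(** Uniform in the point of T by compactness of the boundary, on which U is 0. It tells when an
    arbitrary approaching process is close enough to switch at small cost. *)
Lemma near_T_small_U e : 0 < e -> exists2 d : R, 0 < d & forall z w, ~ T z -> T w ->
  `|z - w| < d -> D z /\ U z < e.
Proof.
move=> e0; apply: contrapT => H.
have [dl [dl0 dl1 dlN]] := @null_seq R.
have ex (i : nat) : exists zb : 'rV[R]_n * 'rV[R]_n, [/\ ~ T zb.1, boundary T zb.2,
    `|zb.1 - zb.2| < dl i & ~ (D zb.1 /\ U zb.1 < e)].
  apply: contrapT => Hi; apply: H; exists (dl i) => //.
  move=> z w Tz Tw zw; apply: contrapT => Hz; apply: Hi.
  have [b bT zb] := segment_boundary Tz Tw.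
  by exists (z, b); split => //=; exact: le_lt_trans zw.
pose x i := sval (cid (ex i)).
have xP i : [/\ ~ T (x i).1, boundary T (x i).2,
    `|(x i).1 - (x i).2| < dl i & ~ (D (x i).1 /\ U (x i).1 < e)].
  by exact: (svalP (cid (ex i))).
have Kx i : boundary T (x i).2 by case: (xP i).
have [b Tb cl] := compact_cvg_cluster (T_boundary hyps) Kx.
have TTb : T b by case: Tb => + _; rewrite -(closure_id T).1//; exact: (T_closed hyps).
have Ob : Omega b by exact: (T_sub_Omega mrf).
have Eb : E b by split => //; case: Tb.
have [d1 d10 H1] := U_within_continuous Eb e0.
have /nbhs_dist[d2 d20 H2] := open_nbhs_nbhs (conj (Omega_open mrf) Ob).
pose d := Num.min d1 d2; have d0 : 0 < d by rewrite lt_min d10.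
have dd : 0 < d / 2 by lra.
have [N HN] := dlN _ dd; have [j Nj bj] := cl _ dd N.
have [Tj _ zj nj] := xP j; apply: nj.
have bz : `|b - (x j).1| < d.
  have := ler_distD (x j).2 b (x j).1; rewrite (distrC (x j).2).
  by have := HN j Nj; lra.
move: bz; rewrite lt_min => /andP[bz1 bz2].
have Dz : D (x j).1 by split => //; exact: H2.
split => //; have := H1 _ (target_compl_sub Dz) bz1.
by rewrite (U_target_eq0 Eb TTb) sub0r normrN => /ltr_normlW.
Qed.

End restraint_function.

Section process_regularity.
Context {R : realType} {n q : nat}.
Variables (A : set 'rV[R]_q) (f : 'rV[R]_n -> 'rV[R]_q -> 'rV[R]_n) (M : R).
Hypothesis M_gt0 : 0 < M.
Hypothesis f_growth : forall x a, A a -> `|f x a| <= M * (1 + `|x|).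

(** No Gronwall argument: integrability of the velocity is part of being a solution and bounds the
    path at once. *)
Lemma process_bounded x c (r : R) : process_from A f 0 x c -> 0 <= r ->
  exists Y : R, forall s, 0 <= s <= r -> `|c.2 s| <= Y.
Proof.
move=> cP r0; pose F i s := f (c.2 s) (c.1 s) 0 i.
exists (`|x| + \sum_i int_co (fun s => `|F i s|) 0 r) => s /andP[s0 sr].
have I0 i : 0 <= int_co (fun s => `|F i s|) 0 r by exact: int_co_ge0.
apply: rV_norm_le; first by rewrite addr_ge0// sumr_ge0.
move=> i; have [is_ es] := solution_at i (process_solution cP s0) s0 (lexx _).
have [ir _] := solution_at i (process_solution cP r0) r0 (lexx _).
rewrite es (process_start cP) (le_trans (ler_normD _ _))// lerD//.
  exact: rV_coord_le.
rewrite (le_trans (int_co_abs is_))// (bigD1 i)//= -[leLHS]addr0 lerD ?sumr_ge0//.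
by rewrite (int_co_cat s0 sr (integrable_co_abs ir)) lerDl; exact: int_co_ge0.
Qed.

Lemma process_lip x c (r : R) : process_from A f 0 x c -> 0 <= r ->
  exists2 C : R, 0 <= C & forall s t, 0 <= s -> s <= t -> t <= r ->
    `|c.2 t - c.2 s| <= C * (t - s).
Proof.
move=> cP r0; have [Y HY] := process_bounded cP r0.
have Y0 : 0 <= Y by apply: le_trans (HY 0 _) => //; rewrite lexx.
have C0 : 0 <= M * (1 + Y) by rewrite mulr_ge0 ?(ltW M_gt0)// addr_ge0.
exists (M * (1 + Y)) => // s t s0 st tr.
apply: (solution_lip C0 _ (process_solution cP r0)) => // u /andP[u0 ur].
rewrite (le_trans (f_growth _ (process_control cP u0)))//.
by rewrite ler_pM2l// lerD2l HY// u0 ltW.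
Qed.

Lemma process_cost_bounded (A_cpt : compact A) (h : 'rV[R]_n -> 'rV[R]_q -> R) x c (r : R) :
  running_cost A h -> process_from A f 0 x c -> 0 <= r ->
  (\int[leb]_(s in `[0%R, r[) (h (c.2 s) (c.1 s))%:E < +oo)%E.
Proof.
move=> hc cP r0; have [Y HY] := process_bounded cP r0.
have [C C0 HC] := running_cost_bounded A_cpt Y hc.
apply: (@le_lt_trans _ _ (C%:E * leb (`[0%R, r[%classic : set R))%E).
  apply: ge0_integral_cst_le => //; first exact: leb_itv_measurable.
  move=> s /=; rewrite in_itv/= => /andP[s0 sr].
  have As := process_control cP s0.
  rewrite !lee_fin (running_cost_ge0 hc)//= HC// HY// s0 ltW//.
by have /= -> := leb_itv_co r0; rewrite -EFinM ltry.
Qed.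

End process_regularity.

(** * Runs to the target *)

Section left_filters.
Context {R : realType}.

Lemma left_filter_itv (theta : \bar R) (V : set R) (t0 : R) : (t0%:E < theta)%E ->
  left_filter theta V -> exists2 t : R, (t%:E < theta)%E &
    forall s : R, t < s -> (s%:E < theta)%E -> V s.
Proof.
case: theta => [r| |] //=.
  rewrite lte_fin => _ /within_dist[d d0 dV]; exists (r - d).
    by rewrite lte_fin ltrBlDr ltrDl.
  by move=> s rs; rewrite lte_fin => sr; apply: dV => //; rewrite gtr0_norm ?subr_gt0//; lra.
by move=> _ [t [_ tV]]; exists t => [|s ts _]; [exact: ltry|exact: tV].
Qed.

Lemma left_filterT (theta : \bar R) : left_filter theta setT.
Proof. by case: theta => [r| |] /=; exact: filterT. Qed.

Lemma pinfty_left_filter (V : set R) : (exists t : R, forall s, t < s -> V s) ->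
  left_filter +oo%E V.
Proof. by move=> [t tV]; exists t; split => //; exact: num_real. Qed.

Lemma limf_einf_left_eq0 (g : R -> \bar R) (theta : \bar R) (t0 : R) :
  (forall s, 0 <= g s)%E -> (t0%:E < theta)%E ->
  (forall (e t : R), 0 < e -> (t%:E < theta)%E ->
    exists s : R, [/\ t < s, (s%:E < theta)%E & (g s <= e%:E)%E]) ->
  limf_einf g (left_filter theta) = 0%E.
Proof.
move=> g0 t0th H; rewrite limf_einfE; apply/eqP; rewrite eq_le; apply/andP; split; last first.
  apply: (@le_trans _ _ (ereal_inf (g @` setT))).
    by apply: le_ereal_inf_tmp => _ [s _ <-].
  by apply: ereal_sup_ubound; exists setT => //; exact: left_filterT.
apply: ge_ereal_sup => _ [V VF <-]; apply/lee_addgt0Pr => e e0; rewrite add0e.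
have [t tth tV] := left_filter_itv t0th VF.
have [s [ts sth gs]] := H e t e0 tth.
apply: le_trans gs; apply: ereal_inf_lbound; exists s => //; exact: tV.
Qed.

End left_filters.

Section distances.
Context {R : realType} {n : nat}.

Lemma distance_ge0 (S : set 'rV[R]_n) x : (0 <= distance S x)%E.
Proof. by apply: le_ereal_inf_tmp => _ [z _ <-]; rewrite lee_fin enorm_ge0. Qed.

Lemma distance_le (S : set 'rV[R]_n) x w : S w -> (distance S x <= (n%:R * `|x - w|)%:E)%E.
Proof.
move=> Sw; apply: (@le_trans _ _ (enorm (x - w))%:E); last by rewrite lee_fin enorm_le.
by apply: ereal_inf_lbound; exists w.
Qed.

End distances.

Section restraint_runs.
Context {R : realType} {n q : nat}.
Variables (A : set 'rV[R]_q) (T : set 'rV[R]_n).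
Variables (f : 'rV[R]_n -> 'rV[R]_q -> 'rV[R]_n) (l : 'rV[R]_n -> 'rV[R]_q -> R).
Variables (Omega : set 'rV[R]_n) (U : 'rV[R]_n -> R) (U0 : \bar R) (k : R).
Hypothesis n_gt0 : (0 < n)%N.
Hypothesis hyps : standing_hypotheses A T f l.
Hypothesis mrf : local_MRF A T f l Omega U U0 k.
Local Notation D := (Omega `\` T).

(** In [run_lip] the end theta is included when finite, so that [c.2 theta] is the limit of the
    run. *)
Record good_run (rho : 'rV[R]_n -> 'rV[R]_q -> R) (tau : R) (z : 'rV[R]_n)
    (c : (R -> 'rV[R]_q) * (R -> 'rV[R]_n)) (theta : \bar R) (C : R) : Prop := {
  run_from : process_from A f tau z c;
  run_time : (tau%:E < theta)%E;
  run_in : forall s, tau <= s -> (s%:E < theta)%E -> D (c.2 s);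
  run_small : forall s t : R, 0 < s -> (t%:E < theta)%E ->
    exists t', [/\ t < t', tau <= t', (t'%:E < theta)%E & U (c.2 t') < s];
  run_lip : forall s t, tau <= s -> s <= t -> (t%:E <= theta)%E ->
    `|c.2 t - c.2 s| <= C * (t - s);
  run_cost : (\int[leb]_(s in [set s : R | (tau <= s)%R /\ s%:E < theta])
    (l (c.2 s) (c.1 s))%:E <= (k^-1 * U z)%:E)%E;
  run_resource : (\int[leb]_(s in [set s : R | (tau <= s)%R /\ s%:E < theta])
    (rho (c.2 s) (c.1 s))%:E < +oo)%E }.

Section run_existence.
Variables (rho : 'rV[R]_n -> 'rV[R]_q -> R) (sigma : R) (m : R -> R).
Variables (psel : 'rV[R]_n -> 'rV[R]_n) (ghat rhohat : R -> R).
Hypothesis rho_cost : running_cost A rho.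
Hypothesis sigma_gt0 : 0 < sigma.
Hypothesis mP : admissible_m A T f l Omega U k sigma m.
Hypothesis pselP : forall x, level T Omega U `]0, sigma] x -> Dstar U x (psel x).
Hypothesis ghatP : is_ghat A T f l Omega U k sigma m psel ghat.
Hypothesis rhohatP : is_rhohat A T f l rho Omega U k sigma m psel rhohat.
Hypothesis ratio_int : (\int[leb]_(s in `]0%R, sigma]) (rhohat s / ghat s)%:E < +oo)%E.

(** The inequality for g is weak, so a control realising it must come from an attained minimum, by
    compactness of A; in [decrease_attained] the inequality is strict and the infimum suffices. *)
Lemma hamiltonian_attained x p : A !=set0 ->
  (hamiltonian A f (gcost l U k m) x p <= 0)%E ->
  exists2 a, A a & dotv p (f x a) + gcost l U k m x a <= 0.
Proof.
move=> A0 H; pose h (y : 'rV[R]_n) a := dotv p (f x a) + gcost l U k m x a.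
have ch : {within A, continuous (h x)}.
  apply: within_snd_continuous => a Aa e e0.
  have k0 := k_gt0 mrf.
  have P0 : 0 < n%:R * `|p| + 1 by rewrite ltr_wpDl// mulr_ge0.
  have e1 : 0 < e / 2 / (n%:R * `|p| + 1) by rewrite !divr_gt0.
  have e2 : 0 < e / 2 / k by rewrite !divr_gt0.
  have [d1 d10 H1] := within_prod_continuous_dist (f_cont hyps) x Aa e1.
  have [d2 d20 H2] := within_prod_continuous_dist (running_cost_cont (l_cost hyps)) x Aa e2.
  exists (Num.min d1 d2); first by rewrite lt_min d10.
  move=> b Ab; rewrite lt_min => /andP[b1 b2].
  have := H1 x b Ab; rewrite subrr normr0 => /(_ d10 b1).
  have := H2 x b Ab; rewrite subrr normr0 => /(_ d20 b2).
  rewrite !ltr_pdivlMr// => h2 h1.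
  have -> : h x a - h x b = dotv p (f x a - f x b) + k * (l x a - l x b).
    by rewrite /h /gcost dotvDr dotvNr; ring.
  rewrite (le_lt_trans (ler_normD _ _))// normrM (gtr0_norm k0).
  have := dotv_le p (f x a - f x b).
  have := normr_ge0 (f x a - f x b).
  by move: h1 h2; rewrite mulrDr mulr1 mulrA [_ * k]mulrC [`|_ - _| * _]mulrC; lra.
have [a Aa amin] := compact_EVT_min A0 (A_compact hyps) ch.
rewrite inE in Aa; exists a => //; rewrite -/(h x a) leNgt; apply/negP => pos.
suff : ((h x a)%:E <= 0)%E by rewrite lee_fin leNgt pos.
apply: le_trans H; apply: le_ereal_inf_tmp => _ [b Ab <-].
by rewrite lee_fin; apply: (amin b); rewrite inE.
Qed.

Lemma decrease_attained x p : D x -> Dstar U x p ->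
  exists2 a, A a & dotv p (f x a) + k * l x a < 0.
Proof.
move=> Dx px; have /ereal_inf_lt[_ [a Aa <-]] := U_decrease mrf Dx px.
by rewrite lte_fin; exists a.
Qed.

Lemma in_level z s1 s2 : D z -> s1 < U z <= s2 -> level T Omega U `]s1, s2] z.
Proof.
by move=> Dz sU; split; [exact: target_compl_sub|rewrite /= in_itv/=].
Qed.

Lemma ghat_gt0 s : 0 < s <= sigma -> 0 < ghat s.
Proof.
move=> ss; have sin : s \in `]0, sigma]%R by rewrite in_itv.
by apply: lt_le_trans (m_gt0 mP sin) _; exact: (ghat_ge_m ghatP).
Qed.

(** The control a of A(z) is frozen while the arc moves on to other points x of lower level. The
    pair (x, a) is among those over which [rhohat_exact] takes its supremum at level U z, so one
    number bounds rho along the arc. *)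
Lemma feedback_exists z : D z -> U z <= sigma -> exists p a,
  [/\ Dstar U z p, A a, dotv p (f z a) + k * l z a + m (U z) <= 0,
      ghat (U z) <= k * l z a + m (U z) &
      forall x, D x -> U x <= U z -> rho x a <= rhohat (U z)].
Proof.
move=> Dz Us; have Uz0 := U_gt0 mrf Dz.
have Uzs : 0 < U z <= sigma by rewrite Uz0.
have Uin : U z \in `]0, sigma]%R by rewrite in_itv.
have lz := in_level Dz Uzs; have pz := pselP lz.
have A0 : A !=set0 by have [a Aa _] := decrease_attained Dz pz; exists a.
have [a Aa neg] := hamiltonian_attained A0 (m_decrease mP lz pz).
have fa : feedback A f (gcost l U k m) psel z a by [].
exists (psel z), a; split => //.
- by move: neg; rewrite /gcost addrA.
- rewrite -lee_fin; apply: le_trans (ghat_le ghatP Uin) _.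
  have lz' : level T Omega U `[U z, sigma] z.
    by split; [exact: target_compl_sub|rewrite /= in_itv/= lexx].
  apply: ereal_inf_lbound; exists (z, a) => //; split => //=.
  by exists z.
- move=> x Dx Ux; rewrite -lee_fin; apply: le_trans (rhohat_ge rhohatP Uin).
  apply: ereal_sup_ubound; exists (x, a) => //; split => /=.
    by apply: in_level => //; rewrite (U_gt0 mrf Dx).
  by exists z => //; apply: in_level => //; rewrite Uz0 lexx.
Qed.

Lemma good_run_exists tau z : D z -> exists c theta C, good_run rho tau z c theta C.
Proof.
move=> Dz; have [M M0 fM] := growth_supnorm hyps.
have flip := lipschitz_supnorm hyps.
have f_lip (r : R) : exists2 L : R, 0 < L & forall x1 x2 a,
    `|x1| <= r -> `|x2| <= r -> A a -> `|f x1 a - f x2 a| <= L * `|x1 - x2|.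
  have [L L0 HL] := flip r.
  by exists L => // x1 x2 a h1 h2 Aa; have [] := HL x1 x2 a h1 h2 Aa.
have l0 := running_cost_ge0 (l_cost hyps).
have rho0 := running_cost_ge0 rho_cost.
have lc a (Aa : A a) := running_cost_continuous (l_cost hyps) Aa.
have rc a (Aa : A a) := running_cost_continuous rho_cost Aa.
have itvP s : 0 < s <= sigma -> s \in `]0, sigma]%R by rewrite in_itv.
have rhat0 s : 0 < s <= sigma -> 0 <= rhohat s by move=> /itvP; exact: (rhohat_ge0 rhohatP).
have m0 s : 0 < s <= sigma -> 0 < m s by move=> /itvP; exact: (m_gt0 mP).
have mi s t : 0 < s -> s <= t -> t <= sigma -> m s <= m t.
  move=> s0; rewrite le_eqVlt => /predU1P[->//|st ts]; apply/ltW/(m_incr mP) => //.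
    by apply: itvP; rewrite s0 (le_trans (ltW st)).
  by apply: itvP; rewrite (lt_trans s0 st).
have LS := local_step n_gt0 M0 (k_gt0 mrf) fM flip l0 lc rc (target_compl_open hyps mrf)
  (U_continuous_at hyps mrf) (U_semiconcave mrf) (U_gt0 mrf) decrease_attained sigma_gt0 m0 mi
  ghat_gt0 rhat0
  (ratio_continuous (ghat_cont ghatP) (rhohat_cont rhohatP) ghat_gt0)
  (potential_lower (ghat_cont ghatP) (rhohat_cont rhohatP) ghat_gt0 rhat0 ratio_int)
  feedback_exists.
have [c [theta [C [[cP tth] [inD small] lip cost res]]]] :=
  run_process M0 (k_gt0 mrf) fM f_lip l0 rho0 lc rc (U_gt0 mrf) sigma_gt0
  (potential_ge0 ghat_gt0 rhat0) (annulus_compactP mrf) (sublevel_boundedP mrf) LS tau Dz.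
by exists c, theta, C; split.
Qed.

End run_existence.
End restraint_runs.

Section concatenation.
Context {R : realType} {n q : nat}.
Variables (A : set 'rV[R]_q) (T : set 'rV[R]_n).
Variables (f : 'rV[R]_n -> 'rV[R]_q -> 'rV[R]_n) (l : 'rV[R]_n -> 'rV[R]_q -> R).
Variables (Omega : set 'rV[R]_n) (U : 'rV[R]_n -> R) (U0 : \bar R) (k : R).
Hypothesis hyps : standing_hypotheses A T f l.
Hypothesis mrf : local_MRF A T f l Omega U U0 k.
Local Notation D := (Omega `\` T).

(** The sublevels of U are closed and the run enters each of them at times arbitrarily close to
    theta, so U <= s at the limit point for every s > 0; U is positive off T. *)
Lemma run_hits_target rho tau z c (theta C : R) :
  good_run A T f l Omega U k rho tau z c theta%:E C -> T (c.2 theta).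
Proof.
move=> run; have tth : tau < theta by have := run_time run; rewrite lte_fin.
have C0 : 0 < `|C| + 1 by rewrite ltr_wpDl.
have lev s : 0 < s -> (Omega `\` T°) (c.2 theta) /\ 0 <= U (c.2 theta) <= s.
  move=> s0; have E := (closure_id _).1 (level_closed mrf (s := s)).
  suff : closure [set x | (Omega `\` T°) x /\ 0 <= U x <= s] (c.2 theta) by rewrite -E.
  move=> P /nbhs_dist[d d0 dP].
  have dc : 0 < d / (`|C| + 1) by rewrite divr_gt0.
  have [|t' [t1 t2 t3 Ut]] := @run_small _ _ _ _ _ _ _ _ _ _ _ _ _ _ _ _ run s (theta - d / (`|C| + 1)) s0.
    by rewrite lte_fin ltrBlDr ltrDl.
  rewrite lte_fin in t3; have Dt : D (c.2 t') by apply: (run_in run) => //; rewrite lte_fin.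
  exists (c.2 t'); split.
    by split; [exact: target_compl_sub|rewrite (U_ge0 mrf) ?(ltW Ut)//; exact: target_compl_sub].
  apply: dP; rewrite (le_lt_trans (run_lip run t2 (ltW t3) (lexx _)))//.
  have tt : theta - t' < d / (`|C| + 1) by lra.
  rewrite ltr_pdivlMr// in tt; apply: le_lt_trans tt; rewrite mulrC ler_wpM2l ?subr_ge0 ?(ltW t3)//.
  by rewrite (le_trans (ler_norm _))// lerDl.
have [|E _] := lev 1; first exact: ltr01.
have [//|Dy] := domain_cases E.
have Uy := U_gt0 mrf Dy; have U2 : 0 < U (c.2 theta) / 2 by lra.
by have [_ /andP[_ h]] := lev _ U2; lra.
Qed.

Lemma measurable_left_itv (tau : R) (theta : \bar R) :
  measurable ([set s : R | (tau <= s)%R /\ (s%:E < theta)%E] : set (lebesgue_type R)).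
Proof.
case: theta => [r| |].
- rewrite (_ : mkset _ = `[tau, r[%classic); first exact: leb_itv_measurable.
  by apply/seteqP; split => s /=; rewrite lte_fin in_itv/=; [case=> -> ->|move/andP].
- rewrite (_ : mkset _ = `[tau, +oo[%classic); first exact: leb_itv_measurable.
  by apply/seteqP; split => s /=; rewrite in_itv/= andbT; [case|rewrite ltry].
- rewrite (_ : mkset _ = set0); first exact: measurable0.
  by apply/seteqP; split => s //= -[_]; rewrite ltNge leNye.
Qed.

Variable rho : 'rV[R]_n -> 'rV[R]_q -> R.
Hypothesis rho_cost : running_cost A rho.
Hypothesis runP : forall tau z, D z ->
  exists c theta C, good_run A T f l Omega U k rho tau z c theta C.

(** The exit time of the new process is the end theta of the run: T is avoided before tau by
    assumption and during the run by [run_in], and reached at theta if finite. *)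
Lemma concatenate x c0 (tau : R) : process_from A f 0 x c0 -> 0 <= tau ->
  (forall s, 0 <= s -> s < tau -> ~ T (c0.2 s)) -> D (c0.2 tau) ->
  exists c, approaching_rho A T f rho x c /\
    (cost l c.2 c.1 (exit_time T c.2) <=
     \int[leb]_(s in `[0%R, tau[) (l (c0.2 s) (c0.1 s))%:E + (k^-1 * U (c0.2 tau))%:E)%E.
Proof.
move=> c0P tau0 notT Dtau; have [c1 [theta [C run]]] := runP tau Dtau.
have tth := run_time run.
pose c := switch tau c0 c1.
have cP : process_from A f 0 x c.
  refine (process_switch tau0 _ _ _ _ (run_from run)).
  - by move=> t /andP[t0 _]; exact: (process_control c0P).
  - move=> j; apply: measurable_funS (process_measurable c0P j).
      rewrite (_ : mkset _ = `[0, +oo[%classic); first exact: leb_itv_measurable.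
      by apply/seteqP; split => s /=; rewrite in_itv/= andbT.
    by move=> s /=; rewrite in_itv/= => /andP[].
  - exact: (process_start c0P).
  - exact: (process_solution c0P tau0).
have cbefore s : s < tau -> c.1 s = c0.1 s /\ c.2 s = c0.2 s by rewrite /c /= => ->.
have cafter s : tau <= s -> c.1 s = c1.1 s /\ c.2 s = c1.2 s by rewrite /c /= ltNge => ->.
clearbody c.
have exitE : exit_time T c.2 = theta.
  apply/eqP; rewrite eq_le; apply/andP; split.
    case E : theta tth run => [r| |] tth run //; last by rewrite leey.
    rewrite lte_fin in tth; apply: ereal_inf_lbound; exists r => //; split.
      by rewrite (le_trans tau0)// ltW.
    by have [_ ->] := cafter r (ltW tth); exact: (run_hits_target run).
  apply: le_ereal_inf_tmp => _ [t [t0 Tt] <-]; rewrite leNgt; apply/negP => tlt.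
  have [ttau|taut] := ltP t tau.
    by apply: (notT t t0 ttau); have [_ <-] := cbefore t ttau.
  have [_ ct] := cafter t taut; have [_] := run_in run taut tlt.
  by rewrite -ct.
have domE : [set s : R | (0 <= s)%R /\ (s%:E < theta)%E] =
    `[0, tau[%classic `|` [set s : R | (tau <= s)%R /\ (s%:E < theta)%E].
  apply/seteqP; split => s /=; rewrite in_itv/=.
    move=> [-> sth]; case: (ltP s tau) => st; [by left|by right].
  move=> [/andP[-> st]|[ts ->]]; split => //; last exact: le_trans tau0 ts.
  by apply: lt_trans tth; rewrite lte_fin.
(* The integrand of the arbitrary process c0 is not known to be measurable; subadditivity over the
   two time sets suffices. *)
have cost_le h : running_cost A h -> (cost h c.2 c.1 (exit_time T c.2) <=
    \int[leb]_(s in `[0%R, tau[) (h (c0.2 s) (c0.1 s))%:E +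
    \int[leb]_(s in [set s : R | (tau <= s)%R /\ s%:E < theta]) (h (c1.2 s) (c1.1 s))%:E)%E.
  move=> hc; rewrite exitE /cost domE.
  apply: le_trans (ge0_integral_setU_le _ _ _ _ _) _.
  - exact: leb_itv_measurable.
  - exact: measurable_left_itv.
  - apply/disj_setPS => s [/=]; rewrite in_itv/= => /andP[_ st] [ts _].
    by move: st; rewrite ltNge ts.
  - move=> s; rewrite -domE => -[s0 _]; rewrite lee_fin.
    exact: (running_cost_ge0 hc _ (process_control cP s0)).
  apply: leeD; rewrite le_eqVlt; apply/orP; left; apply/eqP; apply: eq_integral => s.
    by rewrite inE/= in_itv/= => /andP[_ st]; have [-> ->] := cbefore s st.
  by rewrite inE/= => -[ts _]; have [-> ->] := cafter s ts.
exists c; split; last first.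
  by apply: le_trans (cost_le l (l_cost hyps)) _; apply: leeD => //; exact: (run_cost run).
have M_ex := growth_supnorm hyps; have [M M0 fM] := M_ex.
split; first split; first exact/process_fromE.
  rewrite exitE; apply: (@limf_einf_left_eq0 _ _ _ tau) => //.
    by move=> s; exact: distance_ge0.
  move=> e t e0 tlt.
  (* [small_U_near_T] speaks of the sup norm; the Euclidean distance is at most n times larger. *)
  have n1 : 0 < n%:R + 1 :> R by rewrite ltr_wpDl.
  have [s s0 Hs] := small_U_near_T mrf (divr_gt0 e0 n1).
  have mlt : ((Num.max t tau)%:E < theta)%E by rewrite maxEle; case: ifP.
  have [t' [t1 t2 t3 Ut]] := run_small run s0 mlt.
  exists t'; split => //; first by apply: le_lt_trans t1; rewrite le_max lexx.
  have [_ ->] := cafter t' t2.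
  have [w Tw xw] := Hs _ (run_in run t2 t3) Ut.
  apply: le_trans (distance_le _ Tw) _; rewrite lee_fin.
  move: xw; rewrite ltr_pdivlMr// => xw; apply: le_trans (ltW xw).
  by rewrite mulrC ler_wpM2l// lerDl.
apply: le_lt_trans (cost_le rho rho_cost) _; rewrite lte_add_pinfty//;
  last exact: (run_resource run).
exact: (process_cost_bounded (A_compact hyps) rho_cost c0P tau0).
Qed.

End concatenation.

(** * Value functions *)

Section values.
Context {R : realType} {n q : nat}.
Variables (A : set 'rV[R]_q) (T : set 'rV[R]_n).
Variables (f : 'rV[R]_n -> 'rV[R]_q -> 'rV[R]_n) (l : 'rV[R]_n -> 'rV[R]_q -> R).
Variables (Omega : set 'rV[R]_n) (U : 'rV[R]_n -> R) (U0 : \bar R) (k : R).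
Hypothesis hyps : standing_hypotheses A T f l.
Hypothesis mrf : local_MRF A T f l Omega U U0 k.
Local Notation D := (Omega `\` T).
Local Notation adm_t := ('rV[R]_n -> set ((R -> 'rV[R]_q) * (R -> 'rV[R]_n))).

Lemma value_in (adm : adm_t) x : T x -> value T l adm x = 0%E.
Proof. by move=> Tx; rewrite /value; case: asboolP. Qed.

Lemma value_out (adm : adm_t) x : ~ T x ->
  value T l adm x = ereal_inf [set cost l c.2 c.1 (exit_time T c.2) | c in adm x].
Proof. by move=> Tx; rewrite /value; case: asboolP. Qed.

Lemma value_ge0 (adm : adm_t) x : (forall c, adm x c -> process A f x c) ->
  (0 <= value T l adm x)%E.
Proof.
move=> admP; have [Tx|Tx] := pselect (T x); first by rewrite value_in.
rewrite value_out//; apply: le_ereal_inf_tmp => _ [c /admP cP <-].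
apply: integral_ge0 => s [s0 _]; rewrite lee_fin.
by apply: (running_cost_ge0 (l_cost hyps)); exact: cP.1.1.
Qed.

Lemma value_mono (adm1 adm2 : adm_t) x : (~ T x -> adm1 x `<=` adm2 x) ->
  (value T l adm2 x <= value T l adm1 x)%E.
Proof.
move=> sub; have [Tx|Tx] := pselect (T x); first by rewrite !value_in.
rewrite !value_out//; apply: le_ereal_inf_tmp => _ [c cP <-].
by apply: ereal_inf_lbound; exists c => //; exact: sub.
Qed.

(** W lies between 0 and U/k, and U is continuous up to the boundary, where it is 0. *)
Lemma bounded_continuous_on_boundary (W : 'rV[R]_n -> \bar R) :
  (forall x, 0 <= W x)%E -> (forall x, T x -> W x = 0%E) ->
  (forall x, (Omega `\` T°) x -> W x <= (k^-1 * U x)%:E)%E ->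
  continuous_on_boundary T W.
Proof.
move=> W0 WT WU z Tz; have k0 := k_gt0 mrf.
have TTz : T z by case: Tz => + _; rewrite -(closure_id T).1//; exact: (T_closed hyps).
have Oz : Omega z by exact: (T_sub_Omega mrf).
have Ez : (Omega `\` T°) z by split => //; case: Tz.
rewrite (WT z TTz) => P; rewrite /= => /nbhs_dist[e e0 eP].
have ke : 0 < k * e by rewrite mulr_gt0.
have [d1 d10 H1] := U_within_continuous mrf Ez ke.
have /nbhs_dist[d2 d20 H2] := open_nbhs_nbhs (conj (Omega_open mrf) Oz).
apply/within_dist; exists (Num.min d1 d2); first by rewrite lt_min d10.
move=> x; rewrite lt_min => /andP[x1 x2] nTx.
have Ex : (Omega `\` T°) x by split => //; exact: H2.
have := H1 x Ex x1; rewrite (U_target_eq0 mrf Ez TTz) sub0r normrN => /ltr_normlW Ux.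
have := WU x Ex; have := W0 x; rewrite /preimage /=.
case: (W x) => [r| |] //; rewrite !lee_fin => r0 rU.
apply: eP; rewrite sub0r normrN ger0_norm//; apply: le_lt_trans rU _.
by rewrite mulrC ltr_pdivrMr// mulrC.
Qed.

Lemma exit_time_ge0 y : (0 <= exit_time T y)%E.
Proof. by apply: le_ereal_inf_tmp => _ [t [t0 _] <-]; rewrite lee_fin. Qed.

Lemma exit_timeP y : (exit_time T y < +oo)%E -> exists2 r : R, 0 <= r & exit_time T y = r%:E.
Proof.
have := exit_time_ge0 y; case: (exit_time T y) => [r| |] //; rewrite lee_fin => r0 _.
by exists r.
Qed.

(** T is closed and the path continuous, so the exit time is attained and the distance to T tends to
    0 from the left. Up to a finite time the path is bounded, hence so is rho along it. *)
Lemma finite_exit_approaching rho x c : ~ T x -> running_cost A rho ->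
  finite_exit A T f x c -> approaching_rho A T f rho x c.
Proof.
move=> nTx rho_cost [cP fin].
have [r r0 er] := exit_timeP fin; have cP' := (process_fromE _ _ _ _).1 cP.
have [M M0 fM] := growth_supnorm hyps.
(* The times in T that approximate the infimum r lie at or after r, so the Lipschitz bound is taken
   slightly beyond. *)
have r10 : 0 <= r + 1 by lra.
have [C C0 lip] := process_lip M0 fM cP' r10.
have C1 : 0 < C + 1 by lra.
have Tr : T (c.2 r).
  rewrite (closure_id T).1; last exact: (T_closed hyps).
  move=> P /nbhs_dist[d d0 dP].
  pose e := Num.min 1 (d / (C + 1)).
  have e0 : 0 < e by rewrite lt_min ltr01 divr_gt0.
  have e1 : e <= 1 by rewrite ge_min lexx.
  have ed : e <= d / (C + 1) by rewrite ge_min lexx orbT.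
  have : (exit_time T c.2 < (r + e)%:E)%E by rewrite er lte_fin ltrDl.
  move=> /ereal_inf_lt[_ [t [t0 Tt] <-]]; rewrite lte_fin => tre.
  have rt : r <= t by rewrite -lee_fin -er; apply: ereal_inf_lbound; exists t.
  exists (c.2 t); split => //; apply: dP; rewrite distrC.
  apply: (le_lt_trans (lip r t r0 rt _)); first by lra.
  have trd : t - r < d / (C + 1) by lra.
  rewrite ltr_pdivlMr// in trd; apply: le_lt_trans trd.
  by rewrite mulrC ler_wpM2l ?subr_ge0//; lra.
have rpos : 0 < r.
  rewrite lt_neqAle r0 andbT; apply/eqP => r00; apply: nTx.
  by rewrite -(process_start cP') r00.
split; last first.
  rewrite er /cost (_ : mkset _ = `[0, r[%classic).
    exact: (process_cost_bounded (A_compact hyps) rho_cost cP' r0).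
  by apply/seteqP; split => s /=; rewrite lte_fin in_itv/=; [case=> -> ->|move/andP].
split => //; rewrite er; apply: (@limf_einf_left_eq0 _ _ _ 0).
- by move=> s; exact: distance_ge0.
- by rewrite lte_fin.
move=> e t e0; rewrite lte_fin => tr.
have nC : 0 < n%:R * C + 1 by rewrite ltr_wpDl// mulr_ge0.
pose t1 := Num.max 0 (Num.max t (r - e / (n%:R * C + 1))).
have t1r : t1 < r by rewrite !gt_max rpos tr ltrBlDr ltrDl divr_gt0.
have [t10 tt1 re] : [/\ 0 <= t1, t <= t1 & r - e / (n%:R * C + 1) <= t1].
  by rewrite !le_max !lexx !orbT.
pose s := (t1 + r) / 2.
have [s1 sr] : t1 < s /\ s < r by rewrite /s; split; lra.
exists s; split; [exact: le_lt_trans tt1 s1|by rewrite lte_fin|].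
apply: le_trans (distance_le _ Tr) _; rewrite lee_fin distrC.
have s0 : 0 <= s by lra.
have r_le : r <= r + 1 by lra.
have l1 := lip s r s0 (ltW sr) r_le.
have rse : r - s < e / (n%:R * C + 1) by lra.
rewrite ltr_pdivlMr// in rse; apply: le_trans (ltW rse).
have : n%:R * `|c.2 r - c.2 s| <= n%:R * (C * (r - s)) by rewrite ler_wpM2l.
by move=> /le_trans; apply; lra.
Qed.

Variable rho : 'rV[R]_n -> 'rV[R]_q -> R.
Hypothesis rho_cost : running_cost A rho.
Hypothesis runP : forall tau z, D z ->
  exists c theta C, good_run A T f l Omega U k rho tau z c theta C.

(** At a time t when the process is close to T, a run with cost at most U/k < e takes over. The cost
    before t is part of the original one, l being nonnegative. *)
Lemma approaching_improve x c (e : R) : approaching A T f x c ->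
  exit_time T c.2 = +oo%E -> 0 < e -> exists2 c', approaching_rho A T f rho x c' &
    (cost l c'.2 c'.1 (exit_time T c'.2) <= cost l c.2 c.1 (exit_time T c.2) + e%:E)%E.
Proof.
move=> [cP liminf] eoo e0; have cP' := (process_fromE _ _ _ _).1 cP; have k0 := k_gt0 mrf.
have [d d0 Hd] := near_T_small_U hyps mrf (mulr_gt0 k0 e0).
have notT s : 0 <= s -> ~ T (c.2 s).
  move=> s0 Ts; have : (exit_time T c.2 <= s%:E)%E by apply: ereal_inf_lbound; exists s.
  by rewrite eoo leye_eq.
have [t t0 [w Tw tw]] : exists2 t : R, 0 <= t & exists2 w, T w & `|c.2 t - w| < d.
  (* This set belongs to the filter at +oo, so the infimum of the distance over it is at most the
     lower limit, which is 0. *)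
  pose nonneg : set R := [set t | 0 <= t].
  have : (ereal_inf ((fun t : R => distance T (c.2 t)) @` nonneg) <= 0)%E.
    rewrite -liminf eoo limf_einfE; apply: ereal_sup_ubound.
    exists nonneg => //; apply: pinfty_left_filter.
    by exists 0 => s; exact: ltW.
  have dE : (0 < d%:E)%E by rewrite lte_fin.
  move=> /le_lt_trans /(_ dE) /ereal_inf_lt[_ [t t0 <-]]
    /ereal_inf_lt[_ [w Tw <-]]; rewrite lte_fin => wd.
  exists t => //; exists w => //; apply: le_lt_trans wd; exact: norm_le_enorm.
have [Dt Ut] := Hd _ _ (notT t t0) Tw tw.
have [c' [c'a c'c]] := concatenate hyps mrf rho_cost runP cP' t0 (fun s s0 _ => notT s s0) Dt.
exists c' => //; apply: (le_trans c'c); apply: leeD; last first.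
  by rewrite lee_fin mulrC ler_pdivrMr// mulrC ltW.
have l0 s : 0 <= s -> (0 <= (l (c.2 s) (c.1 s))%:E)%E.
  move=> s0; rewrite lee_fin; apply: (running_cost_ge0 (l_cost hyps)).
  exact: (process_control cP' s0).
rewrite eoo; apply: le_integral_restrict => s /=.
- by rewrite in_itv/= => /andP[s0 _]; exact: l0.
- by rewrite in_itv/= => /andP[s0 _]; split => //; split => //; exact: ltry.
- by move=> [s0 _]; exact: l0.
Qed.

Lemma value_bound (adm : adm_t) : (forall x c, ~ T x -> approaching_rho A T f rho x c -> adm x c) ->
  forall x, (Omega `\` T°) x -> (value T l adm x <= (k^-1 * U x)%:E)%E.
Proof.
move=> sub x Ex; have k0 := k_gt0 mrf.
have [Tx|Dx] := domain_cases Ex.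
  by rewrite value_in// lee_fin mulr_ge0 ?invr_ge0 ?(ltW k0)// (U_ge0 mrf).
have nTx : ~ T x by case: Dx.
have [c0 [theta [C run]]] := runP 0 Dx.
have cP := run_from run; have start := process_start cP.
have none s : 0 <= s -> s < 0 -> ~ T (c0.2 s).
  by move=> s0 s1; have := le_lt_trans s0 s1; rewrite ltxx.
have D0 : D (c0.2 0) by rewrite start.
have [c [ca cc]] := concatenate hyps mrf rho_cost runP cP (lexx 0) none D0.
rewrite value_out//; apply: (@le_trans _ _ (cost l c.2 c.1 (exit_time T c.2))).
  by apply: ereal_inf_lbound; exists c => //; exact: sub.
apply: le_trans cc _; rewrite start (_ : `[0, 0[%classic = set0).
  by rewrite integral_set0 add0e.
by apply/seteqP; split => s //=; rewrite in_itv/= => /andP[s0 s1]; have := le_lt_trans s0 s1; rewrite ltxx.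
Qed.

(** A process with finite exit time is admissible as it stands; one with infinite exit time is
    replaced, at an extra cost e, by one with finite rho-integral. *)
Lemma value_le_V (adm : adm_t) x :
  (forall c, ~ T x -> approaching_rho A T f rho x c -> adm x c) ->
  (forall c, ~ T x -> finite_exit A T f x c -> adm x c) ->
  (value T l adm x <= V A T f l x)%E.
Proof.
move=> sub1 sub2; have [Tx|Tx] := pselect (T x); first by rewrite /V !value_in.
rewrite /V !value_out//; apply: le_ereal_inf_tmp => _ [c ca <-].
have [fin|] := boolP (exit_time T c.2 < +oo)%E.
  apply: ereal_inf_lbound; exists c; last by [].
  exact: (sub2 c Tx (conj ca.1 fin)).
rewrite -leNgt leye_eq => /eqP eoo; apply/lee_addgt0Pr => e e0.
have [c' c'a c'c] := approaching_improve ca eoo e0.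
apply: le_trans c'c; apply: ereal_inf_lbound; exists c' => //; exact: sub1.
Qed.

End values.

Lemma time_cost (R : realType) n q (A : set 'rV[R]_q) (T : set 'rV[R]_n)
    (f : 'rV[R]_n -> 'rV[R]_q -> 'rV[R]_n) x c :
  approaching_rho A T f (fun _ _ => 1) x c -> finite_exit A T f x c.
Proof.
move=> [[cP _] fin]; split => //; rewrite ltNge leye_eq; apply/negP => /eqP eoo.
move: fin; rewrite eoo /cost (_ : mkset _ = `[0, +oo[%classic); last first.
  by apply/seteqP; split => s /=; rewrite in_itv/= andbT; [case|rewrite ltry].
rewrite integral_cst; last exact: leb_itv_measurable.
have muE : leb (`[0%R, +oo[%classic : set R) = +oo%E.
  by rewrite lebE lebesgue_measure_itv/= ltry.
by have /= -> := muE; rewrite mul1e.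
Qed.

Theorem theorem4p2 (R : realType) (n q : nat) (n_gt0 : (0 < n)%N)
  (A : set 'rV[R]_q) (T : set 'rV[R]_n)
  (f : 'rV[R]_n -> 'rV[R]_q -> 'rV[R]_n) (l : 'rV[R]_n -> 'rV[R]_q -> R)
  (hyps : standing_hypotheses A T f l)
  (rho : 'rV[R]_n -> 'rV[R]_q -> R) (rho_cost : running_cost A rho)
  (Omega : set 'rV[R]_n) (U : 'rV[R]_n -> R) (U0 : \bar R) (k : R)
  (mrf : local_MRF A T f l Omega U U0 k)
  (sigma : R) (sigma_gt0 : 0 < sigma) (sigma_lt : (sigma%:E < U0)%E)
  (m : R -> R) (mP : admissible_m A T f l Omega U k sigma m)
  (psel : 'rV[R]_n -> 'rV[R]_n)
  (pselP : forall x, level T Omega U `]0, sigma] x -> Dstar U x (psel x))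
  (ghat : R -> R) (ghatP : is_ghat A T f l Omega U k sigma m psel ghat)
  (rhohat : R -> R)
  (rhohatP : is_rhohat A T f l rho Omega U k sigma m psel rhohat) :
  ((\int[leb]_(s in `]0%R, sigma]) ((ghat s)^-1)%:E = +oo)%E ->
   (\int[leb]_(s in `]0%R, sigma]) (rhohat s / ghat s)%:E < +oo)%E ->
   [/\ forall x, (Omega `\` T°) x ->
         (Urho A T f l rho x <= (k^-1 * U x)%:E)%E,
       continuous_on_boundary T (Urho A T f l rho) &
       forall x, Urho A T f l rho x = V A T f l x])
  /\
  ((\int[leb]_(s in `]0%R, sigma]) ((ghat s)^-1)%:E < +oo)%E ->
   [/\ forall x, (Omega `\` T°) x ->
         (Vf A T f l x <= (k^-1 * U x)%:E)%E,
       continuous_on_boundary T (Vf A T f l) &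
       forall rho' : 'rV[R]_n -> 'rV[R]_q -> R, running_cost A rho' ->
         forall x, Vf A T f l x = Urho A T f l rho' x /\
                   Urho A T f l rho' x = V A T f l x]).
Proof.
split=> [_ int_rho|int_time].
  have runP tau z (Dz : (Omega `\` T) z) := good_run_exists n_gt0 hyps mrf rho_cost sigma_gt0 mP pselP
    ghatP rhohatP int_rho tau Dz.
  have bound x : (Omega `\` T°) x -> (Urho A T f l rho x <= (k^-1 * U x)%:E)%E.
    by apply: (value_bound hyps mrf rho_cost runP).
  split => //.
    apply: (bounded_continuous_on_boundary hyps mrf) => // x.
      by apply: (value_ge0 hyps) => c [[]].
    by move=> Tx; rewrite /Urho value_in.
  move=> x; apply/eqP; rewrite eq_le; apply/andP; split.
    apply: (value_le_V hyps mrf rho_cost runP) => c nTx; first exact: id.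
    exact: (finite_exit_approaching hyps nTx rho_cost).
  by apply: value_mono => _ c [].
pose one : 'rV[R]_n -> 'rV[R]_q -> R := fun _ _ => 1.
have one_cost : running_cost A one.
  split; first by move=> *; exact: ler01.
  rewrite (_ : uncurry one = cst 1); last by apply/funext => -[].
  by apply: continuous_subspaceT; exact: cst_continuous.
(* For the resource 1 the constant 1 is a valid [rhohat], and the integral of 1/ghat takes the place
   of that of rhohat/ghat. *)
have oneP : is_rhohat A T f l one Omega U k sigma m psel (fun=> 1).
  split.
  - by apply: continuous_subspaceT; exact: cst_continuous.
  - by move=> s _; exact: ler01.
  - by exists 1 => s _.
  - by move=> s _; apply: ge_ereal_sup => _ [z _ <-].
have int_one : (\int[leb]_(s in `]0%R, sigma]) (1 / ghat s)%:E < +oo)%E.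
  by under eq_integral do rewrite div1r.
have runP tau z (Dz : (Omega `\` T) z) := good_run_exists n_gt0 hyps mrf one_cost sigma_gt0 mP pselP
  ghatP oneP int_one tau Dz.
have sub x c : ~ T x -> approaching_rho A T f one x c -> finite_exit A T f x c.
  by move=> _; exact: time_cost.
have bound x : (Omega `\` T°) x -> (Vf A T f l x <= (k^-1 * U x)%:E)%E.
  by apply: (value_bound hyps mrf one_cost runP) => y c; exact: sub.
split => //.
  apply: (bounded_continuous_on_boundary hyps mrf) => // x.
    by apply: (value_ge0 hyps) => c [].
  by move=> Tx; rewrite /Vf value_in.
move=> rho' rho'_cost x.
(* The values satisfy a cycle of inequalities. This one uses runs of finite duration; the other two
   are inclusions between sets of processes. *)
have VfV : (Vf A T f l x <= V A T f l x)%E.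
  by apply: (value_le_V hyps mrf one_cost runP) => c; [exact: sub|move=> _; exact: id].
have UVf : (Urho A T f l rho' x <= Vf A T f l x)%E.
  by apply: value_mono => nTx c; exact: (finite_exit_approaching hyps nTx rho'_cost).
have VU : (V A T f l x <= Urho A T f l rho' x)%E.
  by apply: value_mono => _ c [].
by split; apply/eqP; rewrite eq_le ?UVf ?VU ?andbT//= ?(le_trans VfV)// (le_trans UVf).
Qed.
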